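(* There are exactly sixteen equivalence classes of cocyclic $\mathrm{BH}(27,3)$, and the following hold. (1) Some of these classes, but fewer than half of them, contain a Kronecker product of a cocyclic $\mathrm{BH}(9,3)$ with a $\mathrm{BH}(3,3)$. (2) Every cocyclic $\mathrm{BH}(27,3)$ is equivalent to its transpose. (3) Exactly two of the classes are self-equivalent under the Hermitian $H\mapsto H^*$; the remaining classes occur in pairs of distinct classes interchanged by $H\mapsto H^*$. (4) If $H$ is a cocyclic $\mathrm{BH}(27,3)$ not equivalent to the generalized Sylvester matrix $[\zeta_3^{xy^\top}]_{x,y\in \mathrm{GF}(3)^3}$, then $|\mathrm{Aut}(H)|=2^a3^b$ for some integers $a,b\ge 0$. (5) Every non-cyclic group of order $27$ is an indexing group of at least one cocyclic $\mathrm{BH}(27,3)$. (6) There is no circulant $\mathrm{BH}(27,3)$.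
   Context: Write $\zeta_k=e^{2\pi \mathrm{i}/k}$. A $\mathrm{BH}(n,k)$ is an $n\times n$ matrix $H$ with entries in $\langle\zeta_k\rangle$ such that $HH^*=nI_n$, where $H^*$ is the complex conjugate transpose (Hermitian). Two $\mathrm{BH}(n,k)$s $X,Y$ are equivalent, $X\approx Y$, if $MXN=Y$ for some monomial matrices $M,N$ with non-zero entries in $\langle\zeta_k\rangle$. For a finite group $G$, a (normalized) cocycle is a map $\psi:G\times G\to\langle\zeta_k\rangle$ with $\psi(x,y)\psi(xy,z)=\psi(x,yz)\psi(y,z)$ for all $x,y,z$ and $\psi(x,y)=1$ if $x=1$ or $y=1$. If $H\approx[\psi(x,y)]_{x,y\in G}$ for a group $G$ of order $n$ and a cocycle $\psi$, then $H$ is cocyclic and $G$ is an indexing group of $H$. $\mathrm{Aut}(H)$ is the group of all pairs $(M,N)$ of $n\times n$ monomial matrices with non-zero entries in $\langle\zeta_k\rangle$ such that $MHN^*=H$. In the generalized Sylvester matrix, $x,y$ run over row vectors in $\mathrm{GF}(3)^3$. *)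

(* Defs.v *)
From HB Require Import structures.
From mathcomp Require Import all_boot all_order all_algebra all_fingroup.
From mathcomp Require Import cyclic spectral complex mxtens.
From mathcomp Require Import all_classical all_reals all_analysis.

Set Implicit Arguments.
Unset Strict Implicit.
Unset Printing Implicit Defensive.

Import Order.TTheory GRing.Theory Num.Theory.

Local Open Scope classical_set_scope.
Local Open Scope card_scope.
Local Open Scope ring_scope.
Local Open Scope complex_scope.
Local Open Scope sesquilinear_scope.

Definition zeta (R : realType) (k : nat) : R[i] :=
  cos (2 * pi / k%:R) +i* sin (2 * pi / k%:R).

(* For 0 < k, zeta has finite order, so its powers with natural exponents
   already form the cyclic group it generates. *)
Definition zeta_group (R : realType) (k : nat) : set R[i] :=
  range (fun j : nat => zeta R k ^+ j).
Arguments zeta_group : clear implicits.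

Definition is_BH (R : realType) (n k : nat) (H : 'M[R[i]]_n) : Prop :=
  (forall i j, zeta_group R k (H i j)) /\ H *m H ^t* = n%:R%:M.

Definition is_monomial (R : realType) (n k : nat) (M : 'M[R[i]]_n) : Prop :=
  [/\ forall i, exists! j, M i j != 0,
      forall j, exists! i, M i j != 0
    & forall i j, M i j != 0 -> zeta_group R k (M i j)].

Definition BH_equiv (R : realType) (n k : nat) (X Y : 'M[R[i]]_n) : Prop :=
  exists M N : 'M[R[i]]_n,
    [/\ is_monomial k M, is_monomial k N & M *m X *m N = Y].

(* The matrix [f(x,y)]_{x,y \in T}; rows and columns are listed in the same
   order, that of the library's enumeration of T. *)
Definition indexed_mx (R : realType) (n : nat) (T : finType) (cardT : #|T| = n)
    (f : T -> T -> R[i]) : 'M[R[i]]_n :=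
  \matrix_(i, j) f (enum_val (cast_ord (esym cardT) i))
                   (enum_val (cast_ord (esym cardT) j)).

Definition is_cocycle (R : realType) (k : nat) (gT : finGroupType)
    (psi : gT -> gT -> R[i]) : Prop :=
  [/\ forall x y, zeta_group R k (psi x y),
      forall x y z, psi x y * psi (x * y)%g z = psi x (y * z)%g * psi y z
    & forall x y, x = 1%g \/ y = 1%g -> psi x y = 1].

Definition is_indexing_group (R : realType) (n k : nat) (gT : finGroupType)
    (H : 'M[R[i]]_n) : Prop :=
  exists (cardG : #|gT| = n) (psi : gT -> gT -> R[i]),
    is_cocycle k psi /\ BH_equiv k H (indexed_mx cardG psi).

Definition cocyclic_BH (R : realType) (n k : nat) (H : 'M[R[i]]_n) : Prop :=
  is_BH k H /\ exists gT : finGroupType, is_indexing_group k gT H.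

Definition BH_class (R : realType) (n k : nat) (H : 'M[R[i]]_n) :
    set 'M[R[i]]_n :=
  [set X | is_BH k X /\ BH_equiv k H X].

Definition cocyclic_classes (R : realType) (n k : nat) :
    set (set 'M[R[i]]_n) :=
  [set BH_class k H | H in [set H | cocyclic_BH k H]].
Arguments cocyclic_classes : clear implicits.

Definition hermitian_class (R : realType) (n : nat) (C : set 'M[R[i]]_n) :
    set 'M[R[i]]_n :=
  [set H ^t* | H in C].

Definition BH_aut (R : realType) (n k : nat) (H : 'M[R[i]]_n) :
    set ('M[R[i]]_n * 'M[R[i]]_n) :=
  [set MN | [/\ is_monomial k MN.1, is_monomial k MN.2
              & MN.1 *m H *m MN.2 ^t* = H]].

Lemma card_GF3_3 : #|{: 'rV['F_3]_3}| = 27%N.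
Proof. by rewrite card_mx card_Fp. Qed.

(* The exponent is the representative in {0, 1, 2} of x y^T \in GF(3). *)
Definition sylvester_27_3 (R : realType) : 'M[R[i]]_27 :=
  indexed_mx card_GF3_3
    (fun x y : 'rV['F_3]_3 => zeta R 3 ^+ nat_of_ord ((x *m y^T) 0 0)).

(* Each row is the previous one shifted cyclically one place to the right. *)
Definition is_circulant (R : realType) (n : nat) (H : 'M[R[i]]_n) : Prop :=
  exists c : nat -> R[i], forall i j : 'I_n, H i j = c ((j + (n - i)) %% n)%N.

(* Main.v *)
(* Up to equivalence a BH(27,3) is a 27 x 27 matrix of exponents in Z/3 any two
   of whose rows have a balanced difference, considered up to permuting rows and
   columns and adding constants to them.  A cocycle psi on G defines a central
   extension E of G by Z/3, and its matrix is equivalent to [Phi(g_i g_j)] for a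
   function Phi on E with Phi(x z) = Phi(x) + 1.  If E is cyclic, the entries of
   a row telescope, so that the matrix is not BH.  Otherwise E is presented by
   y, k, t and the central element z with y and k commuting, by eight ternary
   parameters, and Phi is given by its 27 values at the normal forms y^e k^i t^n.

   Changing generators leaves 22 tuples of parameters, and moves that preserve
   the tuple allow Phi to be taken lexicographically minimal.  The counts of each
   value in the row differences add over the three cosets of <y, k, z>, hence all
   solutions are found by joining restrictions to these cosets through a
   dictionary; each solution is matched with one of sixteen explicit matrices by
   labelling its columns by three of its rows.  The sixteen representatives have
   the form [f(x + y)] on an abelian group of order 27, which makes them symmetric
   and homogeneous.

   The distribution of values of the sums of three rows, up to rotation, is an
   invariant: it separates the sixteen classes, and in a Kronecker product with a
   BH(3,3) all these counts are multiples of 9, which leaves three classes.  It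
   also yields (4): an automorphism of prime order p >= 5 fixes a row, then, by
   the cell sizes of the invariant, two more rows; as the entries of the three
   rows take each joint value at most four times, it fixes every column. *)
Require Import Defs.
From Stdlib Require Import BinPos FMapPositive.
From HB Require Import structures.
From mathcomp Require Import all_boot all_order all_algebra all_fingroup.
From mathcomp Require Import zify.

Set Implicit Arguments.
Unset Strict Implicit.
Unset Printing Implicit Defensive.

Import Order.TTheory GRing.Theory Num.Theory.

(** * Ternary exponent matrices *)

Local Open Scope ring_scope.

(** Only completeness of the enumeration has to be proved, not irredundancy. Every pruning step is a
    necessary condition on a balanced function that is minimal among those attached to the same
    [Phi] and the same parameters. Hence any selection of moves is legitimate, and a repeated
    solution does no harm, since it is matched with a representative like the others; inequivalence
    of the representatives rests on the row-sum invariant alone. Likewise the groups of order 81 are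
    never classified up to isomorphism: each tuple of parameters that passes two associativity tests
    is sent to a listed tuple by explicit generators.

    There are too many functions, 3^27, but only 3^9 restrictions to a coset of <y, k, z>, and each
    row difference involves the cosets in pairs. The rows of t y^e k^j also constrain the sums of
    the function over cosets of <k> alone, because the sum of the squared differences factors modulo
    3; this discards whole families of restrictions at once.

    A tuple with an empty list of solutions is a nonexistence result. The one for Z/27 x Z/3 gives
    (6), because a circulant matrix is a development over Z/27 after its rows are reversed. *)

Variant trit := t0 | t1 | t2.

Definition trit_of_nat (n : nat) : trit :=
  match n with 0%N => t0 | 1%N => t1 | _ => t2 end.

Definition nat_of_trit (a : trit) : nat :=
  match a with t0 => 0%N | t1 => 1%N | t2 => 2%N end.

Lemma nat_of_tritK : cancel nat_of_trit trit_of_nat.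
Proof. by case. Qed.

Definition teqb (a b : trit) : bool :=
  match a, b with t0, t0 | t1, t1 | t2, t2 => true | _, _ => false end.

Lemma teqbP : Equality.axiom teqb.
Proof. by do 2!case; constructor. Qed.

HB.instance Definition _ := hasDecEq.Build trit teqbP.
HB.instance Definition _ := CanIsCountable nat_of_tritK.

Definition trits : seq trit := [:: t0; t1; t2].

Lemma trits_enumP : Finite.axiom trits.
Proof. by case. Qed.

HB.instance Definition _ := isFinite.Build trit trits_enumP.

Definition tadd (a b : trit) : trit :=
  match a with
  | t0 => b
  | t1 => match b with t0 => t1 | t1 => t2 | t2 => t0 end
  | t2 => match b with t0 => t2 | t1 => t0 | t2 => t1 end
  end.

Definition topp (a : trit) : trit :=
  match a with t0 => t0 | t1 => t2 | t2 => t1 end.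

Definition tmul (a b : trit) : trit :=
  match a with t0 => t0 | t1 => b | t2 => topp b end.

Lemma taddA : associative tadd. Proof. by do 3!case. Qed.
Lemma taddC : commutative tadd. Proof. by do 2!case. Qed.
Lemma tadd0 : left_id t0 tadd. Proof. by []. Qed.
Lemma taddN : left_inverse t0 topp tadd. Proof. by case. Qed.

HB.instance Definition _ := GRing.isZmodule.Build trit taddA taddC tadd0 taddN.

Lemma tmulA : associative tmul. Proof. by do 3!case. Qed.
Lemma tmulC : commutative tmul. Proof. by do 2!case. Qed.
Lemma tmul1 : left_id t1 tmul. Proof. by []. Qed.
Lemma tmulDl : left_distributive tmul tadd. Proof. by do 3!case. Qed.
Lemma t1_neq0 : t1 != 0. Proof. by []. Qed.

HB.instance Definition _ :=
  GRing.Zmodule_isComNzRing.Build trit tmulA tmulC tmul1 tmulDl t1_neq0.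

Lemma taddE a b : tadd a b = a + b. Proof. by []. Qed.
Lemma tmulE a b : tmul a b = a * b. Proof. by []. Qed.
Lemma toppE a : topp a = - a. Proof. by []. Qed.

Notation idx := (trit * trit * trit)%type.

(** Nested [if] replaces [&&], whose two sides are both computed under call-by-value evaluation. The
    same reason lies behind [geqb], [allw] and [hasw]. *)
Definition xeqb (x y : idx) : bool :=
  let: (a, b, c) := x in let: (a', b', c') := y in
  if teqb a a' then if teqb b b' then teqb c c' else false else false.

Lemma xeqbE (x y : idx) : xeqb x y = (x == y).
Proof.
case: x y => [[a b] c] [[a' b'] c']; rewrite !xpair_eqE /=.
by rewrite -[a == a']/(teqb a a') -[b == b']/(teqb b b'); case: (teqb a a') => //; case: (teqb b b').
Qed.

Definition idxs : seq idx :=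
  flatten [seq flatten [seq [seq (n, e, i) | i <- trits] | e <- trits] | n <- trits].

Lemma idxs_uniq : uniq idxs. Proof. by vm_compute. Qed.

Lemma mem_idxs (x : idx) : x \in idxs.
Proof. by case: x => [[[] []] []]. Qed.

Lemma perm_idxs : perm_eq idxs (enum {: idx}).
Proof.
apply: uniq_perm; rewrite ?idxs_uniq ?enum_uniq // => x.
by rewrite mem_idxs mem_enum.
Qed.

Lemma card_idx : #|{: idx}| = 27%N.
Proof. by rewrite cardE -(perm_size perm_idxs). Qed.

Lemma card_trit : #|{: trit}| = 3%N.
Proof. by rewrite cardT enumT unlock. Qed.

Definition balanced (F : idx -> trit) : Prop :=
  forall v, #|[pred x | F x == v]| = 9%N.

(** Each value has a budget, so that evaluation stops at the first excess. On 27 entries the three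
    upper bounds 9 force equality, which is the point of [balancedP]. *)
Fixpoint consume (s : seq trit) (a b c : nat) : bool :=
  match s with
  | [::] => true
  | t0 :: s' => match a with O => false | S a' => consume s' a' b c end
  | t1 :: s' => match b with O => false | S b' => consume s' a b' c end
  | t2 :: s' => match c with O => false | S c' => consume s' a b c' end
  end.

Lemma consumeE s a b c :
  consume s a b c =
  [&& (count_mem t0 s <= a)%N, (count_mem t1 s <= b)%N & (count_mem t2 s <= c)%N].
Proof.
elim: s a b c => [|[] s IH] a b c //=; rewrite !add0n add1n.
- by case: a => // a; rewrite IH ltnS.
- by case: b => [|b]; rewrite ?IH ?ltnS // ltn0 andbF.
- by case: c => [|c]; rewrite ?IH ?ltnS // ltn0 !andbF.
Qed.

Definition balancedb (F : idx -> trit) : bool := consume [seq F x | x <- idxs] 9 9 9.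

Lemma count_idxs (F : idx -> trit) v :
  count_mem v [seq F x | x <- idxs] = #|[pred x | F x == v]|.
Proof.
rewrite count_map (seq.permP perm_idxs) enumT cardE /enum_mem size_filter.
exact: eq_count.
Qed.

Lemma count_trits (s : seq trit) :
  (count_mem t0 s + count_mem t1 s + count_mem t2 s)%N = size s.
Proof.
elim: s => // a s IH /=; rewrite -IH; case: a => /=;
  by rewrite ?addnS ?add0n ?add1n ?addSn ?addnS.
Qed.

Lemma balancedP F : reflect (balanced F) (balancedb F).
Proof.
rewrite /balancedb consumeE; apply: (iffP and3P) => [[h0 h1 h2] v|bF].
  rewrite -count_idxs; set s := map _ _ in h0 h1 h2 *.
  have := count_trits s; rewrite size_map -[size idxs]/27%N => hs.
  have: (count_mem t0 s + count_mem t1 s + count_mem t2 s == 9 + 9 + 9)%N by rewrite hs.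
  move: h0 h1 h2; case: v; lia.
by rewrite !count_idxs !bF.
Qed.

(** Serves as an array indexed by trits: a tabulated function is evaluated once and then read off by
    pattern matching. *)
Record tri (A : Type) := Tri { tri0 : A; tri1 : A; tri2 : A }.

Definition sel A (v : tri A) (a : trit) : A :=
  let: Tri x y z := v in match a with t0 => x | t1 => y | t2 => z end.

Definition tab A (F : trit -> A) : tri A := Tri (F t0) (F t1) (F t2).

Lemma tabK A (F : trit -> A) a : sel (tab F) a = F a.
Proof. by case: a. Qed.

Definition get9 A (v : tri (tri A)) (x : trit * trit) : A := sel (sel v x.1) x.2.

Definition tab9 A (F : trit * trit -> A) : tri (tri A) :=
  tab (fun e => tab (fun i => F (e, i))).

Definition get27 A (v : tri (tri (tri A))) (x : idx) : A :=
  get9 (sel v x.1.1) (x.1.2, x.2).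

Definition tab27 A (F : idx -> A) : tri (tri (tri A)) :=
  tab (fun n => tab9 (fun x => F (n, x.1, x.2))).

Lemma tab9K A (F : trit * trit -> A) x : get9 (tab9 F) x = F x.
Proof. by case: x => e i; rewrite /get9 /tab9 !tabK. Qed.

Lemma tab27K A (F : idx -> A) x : get27 (tab27 F) x = F x.
Proof. by case: x => [[n e] i]; rewrite /get27 /tab27 tabK tab9K. Qed.

(** * Exponent matrices and their equivalence *)

Definition tmat := idx -> idx -> trit.

Definition is_tBH (M : tmat) : Prop :=
  forall x y, x != y -> balanced (fun j => M x j - M y j).

Definition teq (M N : tmat) : Prop :=
  exists s u : idx -> idx, exists r c : idx -> trit,
    [/\ injective s, injective u & forall x y, N x y = r x + M (s x) (u y) + c y].

Lemma teq_ext (M N : tmat) : (forall x y, N x y = M x y) -> teq M N.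
Proof.
move=> MN; exists id, id, (fun=> 0), (fun=> 0); split=> // x y.
by rewrite add0r addr0 MN.
Qed.

Lemma teq_refl (M : tmat) : teq M M.
Proof. exact: teq_ext. Qed.

Lemma teq_sym (M N : tmat) : teq M N -> teq N M.
Proof.
case=> s [u] [r] [c] [/injF_bij[s' sK s'K] /injF_bij[u' uK u'K] MN].
exists s', u', (fun x => - r (s' x)), (fun y => - c (u' y)).
split; [exact: can_inj s'K | exact: can_inj u'K | move=> x y].
by rewrite MN s'K u'K addrA addKr addrK.
Qed.

Lemma teq_trans (M N K : tmat) : teq M N -> teq N K -> teq M K.
Proof.
case=> s [u] [r] [c] [si ui MN] [s'] [u'] [r'] [c'] [s'i u'i NK].
exists (s \o s'), (u \o u'), (fun x => r' x + r (s' x)), (fun y => c (u' y) + c' y).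
by split=> [||x y]; rewrite ?NK ?MN ?addrA //; apply: inj_comp.
Qed.

Definition ttr (M : tmat) : tmat := fun x y => M y x.
Definition tneg (M : tmat) : tmat := fun x y => - M x y.

Lemma teq_tr (M N : tmat) : teq M N -> teq (ttr M) (ttr N).
Proof.
case=> s [u] [r] [c] [si ui MN]; exists u, s, c, r; split=> // x y.
by rewrite /ttr MN -addrA addrC [M _ _ + _]addrC.
Qed.

Lemma teq_neg (M N : tmat) : teq M N -> teq (tneg M) (tneg N).
Proof.
case=> s [u] [r] [c] [si ui MN]; exists s, u, (fun x => - r x), (fun y => - c y).
by split=> // x y; rewrite /tneg MN !opprD.
Qed.

Lemma balanced_bij (F : idx -> trit) (u : idx -> idx) (a : trit) :
  injective u -> balanced F -> balanced (fun j => a + F (u j)).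
Proof.
move=> ui bF v; rewrite -(bF (v - a)) -(card_image ui); apply: eq_card => x.
have [u' uK u'K] := injF_bij ui.
rewrite -(u'K x) mem_image // !inE u'K.
by rewrite [RHS]eq_sym subr_eq [F x + a]addrC eq_sym.
Qed.

Lemma teq_tBH (M N : tmat) : teq M N -> is_tBH M -> is_tBH N.
Proof.
case=> s [u] [r] [c] [si ui MN] BM x y xy.
have /(balanced_bij (r x - r y) ui) : balanced (fun j => M (s x) j - M (s y) j).
  by apply: BM; rewrite inj_eq.
move=> b v; rewrite -(b v); apply: eq_card => j; rewrite !inE !MN; congr (_ == _).
by rewrite opprD addrACA subrr addr0 opprD addrACA.
Qed.

Definition is_tBHb (M : tmat) : bool :=
  all (fun x => all (fun y => xeqb x y || balancedb (fun j => tadd (M x j) (topp (M y j))))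
    idxs) idxs.

Lemma is_tBHP M : reflect (is_tBH M) (is_tBHb M).
Proof.
apply: (iffP allP) => [h x y xy|h x _].
  have /allP/(_ y (mem_idxs y)) := h x (mem_idxs x).
  by rewrite xeqbE (negPf xy) => /balancedP.
by apply/allP => y _; rewrite xeqbE; case: eqVneq => // xy; apply/balancedP/h.
Qed.

Local Close Scope ring_scope.

(** * Normal forms in groups of order 81 *)

Local Open Scope group_scope.

(** The eight exponents of the presentation y^3 = k^p z^q, t k = k z^l t, t y = y k^r z^s t, t^3 =
    y^u k^v z^w, in which z is central, z and k have trivial cubes, and y commutes with k. *)
Record par := Par
  { pp : trit; pq : trit; pl : trit; pr : trit;
    ps : trit; pu : trit; pv : trit; pw : trit }.

(** The carry of ternary addition: it tells when the cube of a generator has to be rewritten. *)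
Definition car (a b : trit) : trit :=
  match a, b with t2, t2 | t2, t1 | t1, t2 => t1 | _, _ => t0 end.

Definition amul (P : par) (x y : trit * trit * trit) : trit * trit * trit :=
  let: (e, i, d) := x in let: (e', i', d') := y in
  match car e e' with
  | t0 => (tadd e e', tadd i i', tadd d d')
  | _ => (tadd e e', tadd (tadd i i') (pp P), tadd (tadd d d') (pq P))
  end.

Definition atwist1 (P : par) (x : trit * trit * trit) : trit * trit * trit :=
  let: (e, i, d) := x in
  (e, tadd i (tmul e (pr P)), tadd d (tadd (tmul i (pl P)) (tmul e (ps P)))).

Definition atwist (P : par) (n : trit) (x : trit * trit * trit) :=
  match n with t0 => x | t1 => atwist1 P x | t2 => atwist1 P (atwist1 P x) end.

(** Collection into the form y^e k^i z^d t^n: the right factor is conjugated past t^n, and a carry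
    between the exponents of t brings in t^3. The formula makes sense for every tuple, whether or
    not the product is associative. *)
Definition gmul (P : par) (x y : idx * trit) : idx * trit :=
  let: (n, e, i, d) := x in let: (n', e', i', d') := y in
  let a := amul P (e, i, d) (atwist P n (e', i', d')) in
  match car n n' with
  | t0 => let: (e'', i'', d'') := a in (tadd n n', e'', i'', d'')
  | _ => let: (e'', i'', d'') := amul P a (pu P, pv P, pw P) in
         (tadd n n', e'', i'', d'')
  end.

Section NormalForms.

Variable gT : finGroupType.
Implicit Types z t y k x : gT.

Definition tpow x (a : trit) : gT := x ^+ nat_of_trit a.

Definition eva z y k (x : trit * trit * trit) : gT :=
  let: (e, i, d) := x in tpow y e * tpow k i * tpow z d.

Definition ev z t y k (x : idx * trit) : gT :=
  let: (n, e, i, d) := x in eva z y k (e, i, d) * tpow t n.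

Record relations z t y k (P : par) : Prop := Relations
  { rel_zc : forall x, commute z x;
    rel_z3 : z ^+ 3 = 1;
    rel_k3 : k ^+ 3 = 1;
    rel_yk : commute y k;
    rel_y3 : y ^+ 3 = tpow k (pp P) * tpow z (pq P);
    rel_tk : t * k = k * tpow z (pl P) * t;
    rel_ty : t * y = y * tpow k (pr P) * tpow z (ps P) * t;
    rel_t3 : t ^+ 3 = tpow y (pu P) * tpow k (pv P) * tpow z (pw P) }.

Lemma tpowD x a b : x ^+ 3 = 1 -> tpow x a * tpow x b = tpow x (tadd a b).
Proof. by move=> x3; rewrite /tpow -expgD; case: a; case: b; rewrite //= expgS x3 mulg1. Qed.

Lemma tpowM x a b : x ^+ 3 = 1 -> tpow (tpow x a) b = tpow x (tmul b a).
Proof. by move=> x3; rewrite /tpow -expgM; case: a; case: b; rewrite //= expgS x3 mulg1. Qed.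

Lemma tpowC x y a b : commute x y -> commute (tpow x a) (tpow y b).
Proof. by move=> xy; apply: commuteX; apply/commute_sym/commuteX/commute_sym. Qed.

Variables (z t y k : gT) (P : par).
Hypothesis rel : relations z t y k P.

Let z3 := rel_z3 rel.
Let k3 := rel_k3 rel.

Lemma tpow_zC a x : commute (tpow z a) x.
Proof. by apply/commute_sym/commuteX/commute_sym; apply: (rel_zc rel). Qed.

Lemma tpow_y a b :
  tpow y a * tpow y b =
  tpow y (tadd a b) * match car a b with t0 => 1 | _ => tpow k (pp P) * tpow z (pq P) end.
Proof.
rewrite -(rel_y3 rel) /tpow -expgD.
by case: a; case: b; rewrite //= ?mulg1 // -?expgD.
Qed.

Lemma tpow_kz i d i' d' :
  tpow k i * tpow z d * (tpow k i' * tpow z d') = tpow k (tadd i i') * tpow z (tadd d d').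
Proof.
rewrite -!tpowD // -!mulgA; congr (_ * _).
by rewrite !mulgA (tpow_zC d (tpow k i')).
Qed.

Lemma tpow_ykz e i d :
  tpow k i * tpow z d * tpow y e = tpow y e * (tpow k i * tpow z d).
Proof.
rewrite -mulgA (tpow_zC d (tpow y e)) !mulgA; congr (_ * _).
exact: tpowC (commute_sym (rel_yk rel)).
Qed.

Lemma eva_mul a b : eva z y k a * eva z y k b = eva z y k (amul P a b).
Proof.
case: a => [[e i] d]; case: b => [[e' i'] d']; rewrite /eva -(mulgA (tpow y e)) -(mulgA (tpow y e')).
rewrite -mulgA (mulgA (tpow k i * tpow z d)) tpow_ykz -mulgA tpow_kz mulgA tpow_y /amul.
by case: (car e e'); rewrite ?mulg1 -!mulgA // (mulgA (tpow k (pp P))) tpow_kz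
  [tadd (pp P) _]taddC [tadd (pq P) _]taddC mulgA.
Qed.

Lemma twist1 a : t * eva z y k a = eva z y k (atwist1 P a) * t.
Proof.
case: a => [[e i] d]; apply: (mulIg t^-1); rewrite mulgK.
have conjK x : t * x * t^-1 = x ^ t^-1 by rewrite conjgE invgK mulgA.
rewrite conjK /eva !conjMg /tpow !conjXg -!conjK (rel_tk rel) (rel_ty rel) !mulgK.
rewrite -(rel_zc rel t) mulgK.
rewrite -(mulgA y).
have zX n x : commute x (z ^+ n) by apply/commuteX/commute_sym/(rel_zc rel).
have yX n : commute y (k ^+ n) by apply/commuteX/(rel_yk rel).
rewrite (expgMn _ (zX _ k)) (expgMn (nat_of_trit e) (commuteM (yX _) (zX _ y))) (expgMn (nat_of_trit e) (zX _ _)).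
rewrite -!/(tpow _ _) !tpowM // -[LHS]mulgA -[LHS]mulgA -[RHS]mulgA; congr (_ * _).
rewrite mulgA tpow_kz -mulgA tpowD //.
congr (tpow _ _ * tpow _ _); first exact: taddC.
by case: (tmul e _); case: (tmul i _); case: (d).
Qed.

Lemma twist n a : tpow t n * eva z y k a = eva z y k (atwist P n a) * tpow t n.
Proof.
case: n; rewrite /tpow ?mul1g ?mulg1 //=; first exact: twist1.
by rewrite expgS expg1 -mulgA twist1 mulgA twist1 -!mulgA.
Qed.

Lemma tpow_t a b :
  tpow t a * tpow t b =
  match car a b with t0 => 1 | _ => eva z y k (pu P, pv P, pw P) end * tpow t (tadd a b).
Proof.
rewrite /eva -(rel_t3 rel) /tpow -expgD.
by case: a; case: b; rewrite //= ?mul1g // -?expgD.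
Qed.

Lemma ev_mul a b : ev z t y k a * ev z t y k b = ev z t y k (gmul P a b).
Proof.
case: a => [[[n e] i] d]; case: b => [[[n' e'] i'] d']; rewrite /ev /gmul.
rewrite -mulgA (mulgA (tpow t n)) twist.
rewrite -(mulgA _ (tpow t n)) (mulgA (eva _ _ _ _)) eva_mul tpow_t.
case: (amul P (e, i, d) _) => [[e1 i1] d1].
case: (car n n'); first by rewrite mul1g.
all: by rewrite (mulgA (eva _ _ _ _)) eva_mul; case: (amul P _ _) => [[e2 i2] d2].
Qed.

End NormalForms.

(** * Presentations, changes of generators and instances of a function *)

Definition presents (gT : finGroupType) (z t y k : gT) (P : par) : Prop :=
  relations z t y k P /\ injective (ev z t y k).

Definition gone : idx * trit := (t0, t0, t0, t0).
Definition gz (d : trit) : idx * trit := (t0, t0, t0, d).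

Definition geqb (x y : idx * trit) : bool :=
  if xeqb x.1 y.1 then teqb x.2 y.2 else false.

Lemma geqbE x y : geqb x y = (x == y).
Proof. by case: x y => [x d] [y d']; rewrite /geqb xpair_eqE xeqbE; case: ifP. Qed.

Definition gpow (P : par) (x : idx * trit) (a : trit) : idx * trit :=
  match a with t0 => gone | t1 => x | t2 => gmul P x x end.

(** A change of generators combined with a left translation: the new t, y, k and the translating
    element, all written as normal forms in the old generators. *)
Record move := Move
  { mv_t : idx * trit; mv_y : idx * trit; mv_k : idx * trit; mv_g : idx * trit }.

Definition new_nf (P : par) (m : move) (x : idx) : idx * trit :=
  let: (n, e, i) := x in
  gmul P (gmul P (gpow P (mv_y m) e) (gpow P (mv_k m) i)) (gpow P (mv_t m) n).

(* The elements [mv_t m], [mv_y m], [mv_k m] of the group with parameters [P]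
   satisfy the relations with parameters [Q]. *)
Definition move_relations (P Q : par) (m : move) : bool :=
  let: Move T Y K _ := m in let mu := gmul P in let pow := gpow P in
  [&& geqb (mu K (mu K K)) gone,
      geqb (mu Y K) (mu K Y),
      geqb (mu Y (mu Y Y)) (mu (pow K (pp Q)) (gz (pq Q))),
      geqb (mu T K) (mu (mu K (gz (pl Q))) T),
      geqb (mu T Y) (mu (mu (mu Y (pow K (pr Q))) (gz (ps Q))) T) &
      geqb (mu T (mu T T)) (mu (mu (pow Y (pu Q)) (pow K (pv Q))) (gz (pw Q)))].

Definition move_onto (P : par) (m : move) : bool :=
  all (fun y => has (fun x => xeqb (new_nf P m x).1 y) idxs) idxs.

Definition move_ok (P Q : par) (m : move) : bool :=
  if move_relations P Q m then move_onto P m else false.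

Definition block := tri (tri trit).
Definition func := tri block.

Definition fev (f : func) (x : idx * trit) : trit := tadd (get27 f x.1) x.2.

Definition move_table (P : par) (m : move) : tri (tri (tri (idx * trit))) :=
  tab27 (fun x => gmul P (mv_g m) (new_nf P m x)).

Definition move_func (P : par) (m : move) (f : func) : func :=
  tab27 (fun x => fev f (get27 (move_table P m) x)).

Definition gdev (P : par) (f : func) : tmat :=
  fun x y => fev f (gmul P (x, t0) (y, t0)).

Section Instances.

Variables (gT : finGroupType) (z : gT) (Phi : gT -> trit).
Hypothesis card81 : #|gT| = 81%N.
Hypothesis PhiZ : forall x d, Phi (x * tpow z d) = tadd (Phi x) d.

(* [f] is the restriction of a left translate of [Phi] to the normal forms of
   some presentation with parameters [P]. *)
Definition instance (P : par) (f : func) : Prop :=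
  exists t y k g, presents z t y k P /\
    forall x, fev f x = Phi (g * ev z t y k x).

Lemma ev_z t y k P x d d' : relations z t y k P ->
  ev z t y k (x, d) * tpow z d' = ev z t y k (x, tadd d d').
Proof.
case: x => [[n e] i] rel; rewrite /ev /eva -mulgA.
rewrite -(tpow_zC rel d' (tpow t n)) mulgA -(mulgA _ (tpow z d)) tpowD //.
exact: rel_z3 rel.
Qed.

Lemma ev_gone t y k : ev z t y k gone = 1.
Proof. by rewrite /ev /eva /tpow /= !mulg1. Qed.

Lemma ev_gz t y k d : ev z t y k (gz d) = tpow z d.
Proof. by rewrite /ev /eva /tpow /= !mulg1 !mul1g. Qed.

Lemma ev_gpow t y k P x a : relations z t y k P ->
  ev z t y k (gpow P x a) = tpow (ev z t y k x) a.
Proof.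
move=> rel; case: a; rewrite /tpow ?expg1 //; first exact: ev_gone.
by rewrite -[gpow _ _ _]/(gmul P x x) -(ev_mul rel).
Qed.

Lemma ev_new_nf t y k P m x d : relations z t y k P ->
  let E := ev z t y k in
  ev z (E (mv_t m)) (E (mv_y m)) (E (mv_k m)) (x, d) =
  E (new_nf P m x) * tpow z d.
Proof.
case: x => [[n e] i] rel /=.
rewrite -!(ev_mul rel) !(ev_gpow _ _ rel) -!mulgA; congr (_ * (_ * _)).
exact: tpow_zC rel _ _.
Qed.

Lemma move_relationsP t y k P Q m : relations z t y k P ->
  let E := ev z t y k in move_relations P Q m ->
  relations z (E (mv_t m)) (E (mv_y m)) (E (mv_k m)) Q.
Proof.
case: m => T Y K G rel E; rewrite /move_relations !geqbE.
case/and5P=> /eqP eK /eqP eYK /eqP eY /eqP eTK /andP[/eqP eTY /eqP eT].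
have EM a b : E a * E b = E (gmul P a b) by rewrite /E (ev_mul rel).
have EX a b : tpow (E a) b = E (gpow P a b) by rewrite /E (ev_gpow _ _ rel).
have EZ d : tpow z d = E (gz d) by rewrite /E ev_gz.
have E3 a : E a ^+ 3 = E (gmul P a (gmul P a a)) by rewrite !expgS expg0 mulg1 !EM.
split=> /=; rewrite ?E3 ?EX ?EZ ?EM.
- exact: rel_zc rel.
- exact: rel_z3 rel.
- by rewrite eK /E ev_gone.
- by rewrite /commute !EM eYK.
- by rewrite eY.
- by rewrite eTK.
- by rewrite eTY.
- by rewrite eT.
Qed.

(** Reaching all 27 cosets of <z> makes the map of indices injective by counting; the exponent of z
    is then recovered by cancellation. *)
Lemma move_onto_inj t y k P m : presents z t y k P -> move_onto P m ->
  let E := ev z t y k in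
  injective (ev z (E (mv_t m)) (E (mv_y m)) (E (mv_k m))).
Proof.
case=> rel Einj /allP onto E.
pose h x := (new_nf P m x).1.
have hinj : injective h.
  move=> x x'.
  have /image_injP hi : #|image h predT| == #|@predT idx|.
    apply/eqP/eq_card => v; have /hasP[x0 _] := onto v (mem_idxs v).
    by rewrite xeqbE => /eqP <-; rewrite [RHS]inE; apply/imageP; exists x0.
  exact: hi.
case=> [x d] [x' d']; rewrite !(ev_new_nf m _ _ rel) -/E.
case e: (new_nf P m x) => [u c]; case e': (new_nf P m x') => [u' c'].
rewrite /E !(ev_z _ _ _ rel) => /Einj[uu' cd].
have xx' : x = x' by apply: hinj; rewrite /h e e'.
move: e'; rewrite -xx' e => -[_ cc']; congr (_, _).
by move: cd; rewrite cc'; case: (c'); case: (d); case: (d').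
Qed.

Lemma instance_move P Q m f :
  instance P f -> move_ok P Q m -> instance Q (move_func P m f).
Proof.
case=> t [y] [k] [g] [pres fE]; rewrite /move_ok; case: ifP => // mrel onto.
have rel := pres.1.
exists (ev z t y k (mv_t m)), (ev z t y k (mv_y m)), (ev z t y k (mv_k m)).
exists (g * ev z t y k (mv_g m)); split.
  by split; [exact: move_relationsP mrel | exact: move_onto_inj onto].
case=> x d; rewrite (ev_new_nf m _ _ rel) [fev]lock /= -lock /fev /= /move_func tab27K.
rewrite /move_table tab27K fE -(ev_mul rel) !mulgA; exact/esym/PhiZ.
Qed.

(** Both matrices list the products Phi(x y) of one function. An element of the second listing is an
    element of the first times a power of z, which only adds a constant to its row or column, and
    the left translates permute the rows. So neither the presentation nor the translate affects the
    class. *)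
Lemma instance_teq P f P' f' :
  instance P f -> instance P' f' -> teq (gdev P f) (gdev P' f').
Proof.
case=> t [y] [k] [g] [[rel Einj] fE] [t'] [y'] [k'] [g'] [[rel' Einj'] fE'].
set E := ev z t y k in Einj fE; set E' := ev z t' y' k' in Einj' fE'.
have cE : #|{: idx * trit}| = #|gT|.
  by rewrite card_prod card_idx card_trit card81.
have [D ED DE] := inj_card_bij Einj (eq_leq (esym cE)).
pose S x := D (g^-1 * g' * E' (x, t0)); pose U x := D (E' (x, t0)).
have ES x : g * E (S x) = g' * E' (x, t0) by rewrite /S DE !mulgA mulgV mul1g.
have EU x : E (U x) = E' (x, t0) by rewrite /U DE.
(* Equal first components mean that the two elements differ by a power of z, so that injectivity of
   [E'] identifies the indices. *)
have fstI (F : idx -> idx * trit) (h : gT) :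
    (forall x, E (F x) = h * E' (x, t0)) -> injective (fun x => (F x).1).
  move=> FE x x' /=; case eF: (F x) => [a d]; case eF': (F x') => [a' d'] /= aa'.
  have: h * E' (x, t0) * tpow z (tadd d' (topp d)) = h * E' (x', t0).
    rewrite -!FE eF eF' -aa' /E (ev_z _ _ _ rel); congr (ev _ _ _ _ (_, _)).
    by case: (d); case: (d').
  by rewrite -mulgA (ev_z _ _ _ rel') => /mulgI/Einj' [].
exists (fun x => (S x).1), (fun x => (U x).1), (fun x => (S x).2), (fun x => (U x).2).
split; first by apply: (fstI S (g^-1 * g')) => x; rewrite /S DE.
  by apply: (fstI U 1) => x; rewrite EU mul1g.
move=> x x'; rewrite /gdev fE fE' /E /E' -(ev_mul rel) -(ev_mul rel') -/E -/E' !mulgA.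
rewrite -ES -EU.
case: (S x) (U x') => [a d] [a' d']; cbn [fst snd].
have Ez b c : E (b, c) = E (b, t0) * tpow z c by rewrite /E (ev_z _ _ _ rel).
rewrite (Ez a d) (Ez a' d') !mulgA PhiZ -(mulgA _ (tpow z d)) (tpow_zC rel) !mulgA PhiZ.
congr (tadd _ d'); exact: taddC.
Qed.

End Instances.

Local Close Scope group_scope.

From mathcomp Require Import ring.
Import Order.TTheory GRing.Theory Num.Theory.

(** * Search for balanced functions *)

Variant apos := Place (e i d : trit).

Definition pos9 : seq (trit * trit) :=
  flatten [seq [seq (e, i) | i <- trits] | e <- trits].

Definition blist (b : block) : seq trit := [seq get9 b x | x <- pos9].

Definition flist (f : func) : seq trit :=
  blist (tri0 f) ++ blist (tri1 f) ++ blist (tri2 f).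

Definition tcmp (a b : trit) : comparison :=
  match a, b with
  | t0, t0 | t1, t1 | t2, t2 => Eq
  | t0, _ | t1, t2 => Lt
  | _, _ => Gt
  end.

Fixpoint lexcmp (s s' : seq trit) : comparison :=
  match s, s' with
  | a :: s1, b :: s1' => match tcmp a b with Eq => lexcmp s1 s1' | c => c end
  | _, _ => Eq
  end.

Definition look (b : block) (x : apos) : trit :=
  let: Place e i d := x in tadd (sel (sel b e) i) d.

Fixpoint act_cmp (l : seq apos) (b : block) (s : seq trit) : comparison :=
  match l, s with
  | x :: l', v :: s' =>
      match tcmp (look b x) v with Eq => act_cmp l' b s' | c => c end
  | _, _ => Eq
  end.

Lemma act_cmpE l b s : act_cmp l b s = lexcmp [seq look b x | x <- l] s.
Proof. by elim: l s => [|x l IH] [|v s] //=; rewrite IH. Qed.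

Lemma lexcmp_cat s1 s2 r1 r2 : size s1 = size r1 ->
  lexcmp (s1 ++ s2) (r1 ++ r2) =
  match lexcmp s1 r1 with Eq => lexcmp s2 r2 | c => c end.
Proof.
elim: s1 r1 => [|a s1 IH] [|b r1] //= [sz]; rewrite IH //.
by case: (tcmp a b).
Qed.

(** The base 3 value, most significant digit first. It embeds the lexicographic order of words of
    one length into the natural numbers and is the measure behind [minimal_instance]. *)
Fixpoint code3 (s : seq trit) : nat :=
  if s is a :: s' then nat_of_trit a * 3 ^ size s' + code3 s' else 0.

Lemma code3_lt s : code3 s < 3 ^ size s.
Proof.
elim: s => // a s IH /=; rewrite expnS.
by case: a => /=; rewrite ?mul0n ?mul1n; lia.
Qed.

Lemma lexcmp_code s r : size s = size r -> lexcmp s r = Lt -> code3 s < code3 r.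
Proof.
elim: s r => [|a s IH] [|b r] //= [sz]; have := code3_lt s; have := code3_lt r.
rewrite sz; case: a; case: b => //=; rewrite ?mul0n ?mul1n => hr hs;
  try (by move=> h; have := IH _ sz h; lia); move=> _; lia.
Qed.

(* Where a move takes the three blocks: entry [x] of block [n] of the new
   function is read off the old one at the listed place. *)
Definition entries (tb : tri (tri (tri (idx * trit)))) (n : trit) : seq (idx * trit) :=
  [seq get27 tb (n, x.1, x.2) | x <- pos9].

Definition source (s : seq (idx * trit)) : trit :=
  if s is x :: _ then x.1.1.1 else t0.

Definition one_source (s : seq (idx * trit)) : bool :=
  all (fun x => teqb x.1.1.1 (source s)) s.

Definition strip (s : seq (idx * trit)) : seq apos :=
  [seq Place x.1.1.2 x.1.2 x.2 | x <- s].

(** When all nine places come from one old block, the new block is known as soon as that old block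
    is, which allows pruning before the function is complete. *)
Lemma blist_move P m f n :
  one_source (entries (move_table P m) n) ->
  blist (sel (move_func P m f) n) =
  [seq look (sel f (source (entries (move_table P m) n))) x
     | x <- strip (entries (move_table P m) n)].
Proof.
move=> /allP; set src := source _ => os; rewrite /strip -map_comp /entries -map_comp.
apply/eq_in_map => -[e i] ei /=.
have := os (get27 (move_table P m) (n, e, i)) (map_f (fun x => get27 _ (n, x.1, x.2)) ei).
rewrite -[teqb _ _]/(_ == _) => /eqP <-.
rewrite -[LHS]/(get27 (move_func P m f) (n, e, i)) /move_func tab27K.
by case: (get27 _ _) => [[[a b] c] d].
Qed.

Record mdata := Mdata
  { md_ok0 : bool; md_src0 : trit; md_l0 : seq apos;
    md_ok1 : bool; md_src1 : trit; md_l1 : seq apos }.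

Definition mdata_of (P : par) (m : move) : mdata :=
  let tb := move_table P m in
  let s0 := entries tb t0 in let s1 := entries tb t1 in
  Mdata (one_source s0) (source s0) (strip s0) (one_source s1) (source s1) (strip s1).

Definition is_lt (c : comparison) : bool := if c is Lt then true else false.
Definition is_eq (c : comparison) : bool := if c is Eq then true else false.

Definition from_block (n : trit) (ms : seq mdata) : seq (seq apos) :=
  [seq md_l0 m | m <- ms & md_ok0 m && teqb (md_src0 m) n].

(** The moves that reproduce block 0 and read the new block 1 off block [n]. For them the
    lexicographic comparison is passed on to block 1. *)
Definition fixers (n : trit) (b0 : block) (s0 : seq trit) (ms : seq mdata) : seq (seq apos) :=
  [seq md_l1 m | m <- ms &
     if md_ok0 m && teqb (md_src0 m) t0 && (md_ok1 m && teqb (md_src1 m) n)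
     then is_eq (act_cmp (md_l0 m) b0 s0) else false].

Definition beaten (ls : seq (seq apos)) (b : block) (s : seq trit) : bool :=
  has (fun l => is_lt (act_cmp l b s)) ls.

Lemma has_map_filter (T U V : Type) (h : T -> U) (p : pred U) (g : U -> V) (a : pred V) s :
  has a [seq g u | u <- [seq h x | x <- s] & p u] ->
  exists x, [/\ List.In x s, p (h x) & a (g (h x))].
Proof.
elim: s => //= x s IH; case: ifP => [px /=|_ /IH[y [ys py ay]]]; last first.
  by exists y; split=> //; right.
case/orP => [ax|/IH[y [ys py ay]]]; first by exists x; split=> //; left.
by exists y; split=> //; right.
Qed.

Section Minimal.

Variables (P : par) (ms : seq move) (f : func).
Let md := [seq mdata_of P m | m <- ms].
Hypothesis fmin : forall m, List.In m ms -> lexcmp (flist (move_func P m f)) (flist f) <> Lt.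
Let F0 := blist (tri0 f).
Let F1 := blist (tri1 f).

(** Block 0 leads the comparison, so a move that makes it smaller contradicts minimality whatever it
    does to the other blocks. *)
Lemma not_beaten0 n : beaten (from_block n md) (sel f n) F0 = false.
Proof.
apply/negP => /has_map_filter[m [mms]].
cbn [md_ok0 md_src0 md_l0 md_ok1 md_src1 md_l1 mdata_of] => /andP[ok /eqP src].
rewrite act_cmpE -src -blist_move // => lt; apply: (fmin mms).
rewrite /flist lexcmp_cat // -[tri0 (move_func _ _ _)]/(sel (move_func P m f) t0).
by case: (lexcmp _ _) lt.
Qed.

Lemma not_beaten1 n : beaten (fixers n (tri0 f) F0 md) (sel f n) F1 = false.
Proof.
apply/negP => /has_map_filter[m [mms]].
cbn [md_ok0 md_src0 md_l0 md_ok1 md_src1 md_l1 mdata_of].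
case: ifP => // /andP[/andP[ok0 /eqP src0] /andP[ok1 /eqP src1]] eq0.
rewrite act_cmpE -src1 -blist_move // => lt; apply: (fmin mms).
move: eq0; rewrite act_cmpE -[tri0 f]/(sel f t0) -{1}src0 -blist_move // => eq0.
rewrite /flist lexcmp_cat // -[tri0 (move_func _ _ _)]/(sel (move_func P m f) t0).
rewrite -/F0; case: (lexcmp _ F0) eq0 => // _; rewrite lexcmp_cat //.
rewrite -[tri1 (move_func _ _ _)]/(sel (move_func P m f) t1) -/F1.
by case: (lexcmp _ F1) lt.
Qed.

End Minimal.

(** * Row differences on the three cosets *)

Definition row_entries (P : par) (h : idx) (n : trit) : seq (idx * trit) :=
  [seq gmul P (h, t0) (n, x.1, x.2, t0) | x <- pos9].

Definition diffs (l : seq apos) (b : block) (s : seq trit) : seq trit :=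
  [seq tadd (look b p.1) (topp p.2) | p <- zip l s].

Fixpoint diff_counts (l : seq apos) (b : block) (s : seq trit) : nat * nat :=
  match l, s with
  | x :: l', v :: s' =>
      let c := diff_counts l' b s' in
      match tadd (look b x) (topp v) with
      | t0 => (S c.1, c.2) | t1 => (c.1, S c.2) | t2 => c
      end
  | _, _ => (0, 0)
  end.

Lemma diff_countsE l b s :
  diff_counts l b s = (count_mem t0 (diffs l b s), count_mem t1 (diffs l b s)).
Proof.
elim: l s => [|x l IH] [|v s] //=; rewrite IH.
by case: (tadd (look b x) (topp v)) => /=; rewrite ?add0n ?add1n.
Qed.

(** [consume] fused with the computation of the differences. The continuation receives the remaining
    budgets, so the three cosets of a row are tested in turn without building a list. *)
Fixpoint consume_diffs (l : seq apos) (b : block) (s : seq trit) (c0 c1 c2 : nat)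
    (k : nat -> nat -> nat -> bool) : bool :=
  match l, s with
  | x :: l', v :: s' =>
      match tadd (look b x) (topp v) with
      | t0 => match c0 with O => false | S c => consume_diffs l' b s' c c1 c2 k end
      | t1 => match c1 with O => false | S c => consume_diffs l' b s' c0 c c2 k end
      | t2 => match c2 with O => false | S c => consume_diffs l' b s' c0 c1 c k end
      end
  | _, _ => k c0 c1 c2
  end.

Lemma consume_diffsE l b s c0 c1 c2 k r :
  (forall a b c, k a b c = consume r a b c) ->
  consume_diffs l b s c0 c1 c2 k = consume (diffs l b s ++ r) c0 c1 c2.
Proof.
move=> kE; elim: l s c0 c1 c2 => [|x l IH] [|v s] c0 c1 c2 //=.
by case: (tadd _ _); [case: c0 | case: c1 | case: c2].
Qed.

Fixpoint allw (T : Type) (p : T -> bool) (s : seq T) : bool :=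
  if s is x :: s' then if p x then allw p s' else false else true.

Lemma allwE (T : Type) (p : T -> bool) s : allw p s = all p s.
Proof. by elim: s => //= x s ->; case: (p x). Qed.

Lemma gmul_row1 P n e i n' e' i' d d' :
  (gmul P (n, e, i, d) (n', e', i', d')).1.1.1 = tadd n n'.
Proof.
rewrite /gmul; case: (amul _ _ _) => [[a b] c].
by case: (car n n') => //; case: (amul _ _ _) => [[a' b'] c'].
Qed.

Lemma gmul0 P x : gmul P (t0, t0, t0, t0) x = x.
Proof. by case: x => [[[n e] i] d]; rewrite /gmul /amul /atwist /=; case: n; case: e. Qed.

Lemma map_idxs (A : Type) (F : idx -> A) :
  [seq F x | x <- idxs] =
  [seq F x | x <- [seq (t0, x.1, x.2) | x <- pos9]] ++
  [seq F x | x <- [seq (t1, x.1, x.2) | x <- pos9]] ++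
  [seq F x | x <- [seq (t2, x.1, x.2) | x <- pos9]].
Proof. by []. Qed.

Definition row_diffs (P : par) (f : func) (h : idx) (n : trit) : seq trit :=
  diffs (strip (row_entries P h n)) (sel f (tadd h.1.1 n)) (blist (sel f n)).

(** Left multiplication by h shifts the cosets of <y, k, z> by the t-exponent of h; hence on each
    coset the difference with the first row involves just two blocks. *)
Lemma row_diffsE P f h n :
  [seq (gdev P f h x - gdev P f (t0, t0, t0) x)%R | x <- [seq (n, x.1, x.2) | x <- pos9]] =
  row_diffs P f h n.
Proof.
rewrite /row_diffs /diffs /strip /row_entries /blist -!map_comp zip_map -!map_comp.
apply: eq_map => -[e i]; rewrite /comp /gdev gmul0; case: h => [[a b] c].
cbn [fst snd].
have := gmul_row1 P a b c n e i t0 t0.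
by case: (gmul _ _ _) => [[[n' e'] i'] d]; cbn [fst snd] => ->; rewrite /fev /= [tadd (get27 f (n, e, i)) t0]taddC.
Qed.

Section Rows.

Variables (P : par) (f : func).
Hypothesis bh : is_tBH (gdev P f).

Lemma row_balanced h : h != (t0, t0, t0) ->
  balanced (fun x => gdev P f h x - gdev P f (t0, t0, t0) x)%R.
Proof. exact: bh. Qed.

Lemma row_consume h : h != (t0, t0, t0) ->
  consume (row_diffs P f h t0 ++ row_diffs P f h t1 ++ row_diffs P f h t2) 9 9 9.
Proof.
move=> /row_balanced /balancedP; rewrite /balancedb map_idxs.
by rewrite !row_diffsE.
Qed.

Lemma row_count h v : h != (t0, t0, t0) ->
  count_mem v (row_diffs P f h t0) + count_mem v (row_diffs P f h t1) +
  count_mem v (row_diffs P f h t2) = 9.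
Proof.
move=> /row_balanced /(_ v); rewrite -count_idxs map_idxs !row_diffsE.
by rewrite !count_cat addnA.
Qed.

End Rows.

(** One element from each pair of inverses among the eight nontrivial elements of <y, k, z> modulo
    z, whatever [pp] is. An inverse only negates the differences, up to a constant. *)
Definition shifts : seq idx :=
  [:: (t0, t0, t1); (t0, t1, t0); (t0, t1, t1); (t0, t1, t2)].

Definition shift_rows (P : par) : seq (seq apos) :=
  [seq strip (row_entries P h t0) | h <- shifts].

(** The number of values 2 is left out, being determined by the total 9. *)
Definition keyf (rows : seq (seq apos)) (b : block) : seq nat :=
  flatten [seq let c := diff_counts l b (blist b) in [:: c.1; c.2] | l <- rows].

Definition rest (k k' : seq nat) : seq nat := [seq 9 - p.1 - p.2 | p <- zip k k'].

Lemma strip_shift P e i n :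
  strip (row_entries P (t0, e, i) n) = strip (row_entries P (t0, e, i) t0).
Proof.
rewrite /strip -!map_comp; apply: eq_map => -[e' i']; rewrite /comp /gmul.
by case: (amul _ _ _) => [[a b] c]; case: n.
Qed.

Lemma rest_pairs (T : eqType) (a b c : T -> nat * nat) (hs : seq T) :
  {in hs, forall h, c h = (9 - (a h).1 - (b h).1, 9 - (a h).2 - (b h).2)} ->
  flatten [seq [:: (c h).1; (c h).2] | h <- hs] =
  rest (flatten [seq [:: (a h).1; (a h).2] | h <- hs])
       (flatten [seq [:: (b h).1; (b h).2] | h <- hs]).
Proof.
elim: hs => //= h hs IH ch; rewrite /rest /= ch ?mem_head //=.
by rewrite IH // => h' hs'; rewrite ch // inE hs' orbT.
Qed.

(** For h in <y, k, z> the differences stay inside a block and are formed by the same rule in all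
    three ([strip_shift]). Their counts add up to 9, so two blocks determine the key of the
    third. *)
Lemma key_rest P f : is_tBH (gdev P f) ->
  let key := keyf (shift_rows P) in key (tri2 f) = rest (key (tri0 f)) (key (tri1 f)).
Proof.
move=> bh; rewrite /keyf /shift_rows -!map_comp /comp.
pose c b h := diff_counts (strip (row_entries P h t0)) b (blist b).
apply: (@rest_pairs _ (c (tri0 f)) (c (tri1 f)) (c (tri2 f))) => h hS.
have [h0 hn] : h.1.1 = t0 /\ h != (t0, t0, t0).
  by move: hS; rewrite !inE => /or4P[] /eqP ->.
case: h h0 hn {hS} => [[n e] i] /= -> hn; rewrite /c !diff_countsE; congr (_, _).
  have := row_count bh t0 hn; rewrite /row_diffs (strip_shift _ _ _ t1) (strip_shift _ _ _ t2).
  by move=> <-; rewrite -addnA !addKn.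
have := row_count bh t1 hn; rewrite /row_diffs (strip_shift _ _ _ t1) (strip_shift _ _ _ t2).
by move=> <-; rewrite -addnA !addKn.
Qed.

(** * A condition modulo 3 on sums over cosets of <k> *)

Definition sq (a : trit) : trit := tmul a a.

(** Each value is taken nine times, and 9 = 0 among trits. *)
Lemma sum_balanced (F : idx -> trit) (g : trit -> trit) :
  balanced F -> (\sum_x g (F x) = 0)%R.
Proof.
move=> bF; rewrite (partition_big F predT) //= big1 // => v _.
rewrite (eq_bigr (fun=> g v)) => [|x /eqP -> //].
by rewrite sumr_const bF; case: (g v).
Qed.

Lemma big_trit (F : trit -> trit) : (\sum_a F a = F t0 + F t1 + F t2)%R.
Proof.
rewrite (bigD1 t0) //= (bigD1 t1) //= (bigD1 t2) //= big1 ?addr0 ?addrA //.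
by case.
Qed.

(* The quadratic terms vanish in characteristic 3, being repeated three times. *)
Lemma sum_sq_diff (x0 x1 x2 y0 y1 y2 : trit) :
  let s a b := sq (tadd a (topp b)) in
  (s x0 y0 + s x1 y0 + s x2 y0 + (s x0 y1 + s x1 y1 + s x2 y1) +
   (s x0 y2 + s x1 y2 + s x2 y2) = (x0 + x1 + x2) * (y0 + y1 + y2))%R.
Proof. by move: x0 x1 x2 y0 y1 y2; do 6!case. Qed.

Ltac tring := rewrite ?taddE ?tmulE ?toppE; change t0 with (0%R : trit); ring.

(** In the product of y^e k^j t and y^e' k^i t^m the exponent of k is i + j up to a constant, and
    that of z is affine in i and independent of j. So with j and i free, the differences run over
    all pairs of points of two cosets of <k>, up to corrections that depend on i only. *)
Lemma gmul_coset P e m e' : exists a b l : trit, forall j i,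
  gmul P (t1, e, j, t0) (m, e', i, t0) =
  (tadd t1 m, (gmul P (t1, e, t0, t0) (m, e', t0, t0)).1.1.2,
   tadd j (tadd i a), tadd b (tmul i l)).
Proof.
have [a [b h]] : exists a b : trit, forall j i,
    amul P (e, j, t0) (atwist1 P (e', i, t0)) =
    (tadd e e', tadd j (tadd i a), tadd b (tmul i (pl P))).
  rewrite /atwist1 /amul; case: (car e e').
  - exists (tmul e' (pr P)), (tmul e' (ps P)) => j i.
    by congr (_, _, _); tring.
  - exists (tadd (tmul e' (pr P)) (pp P)), (tadd (tmul e' (ps P)) (pq P)) => j i.
    by congr (_, _, _); tring.
  - exists (tadd (tmul e' (pr P)) (pp P)), (tadd (tmul e' (ps P)) (pq P)) => j i.
    by congr (_, _, _); tring.
case cm: (car t1 m).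
- by exists a, b, (pl P) => j i; rewrite /gmul cm -![atwist P t1 _]/(atwist1 P _) !h.
all: exists (tadd (tadd a (pv P)) (if car (tadd e e') (pu P) is t0 then t0 else pp P)),
  (tadd (tadd b (pw P)) (if car (tadd e e') (pu P) is t0 then t0 else pq P)), (pl P) => j i.
all: rewrite /gmul cm -![atwist P t1 _]/(atwist1 P _) !h /amul.
all: by case: (car _ _); congr (_, _, _, _); tring.
Qed.

Definition line_sum (f : func) (x : trit * trit) : trit :=
  let b := sel f x.1 in
  tadd (tadd (get9 b (x.2, t0)) (get9 b (x.2, t1))) (get9 b (x.2, t2)).

Definition row_coset (P : par) (e : trit) (x : trit * trit) : trit * trit :=
  (gmul P (t1, e, t0, t0) (x.1, x.2, t0, t0)).1.1.

Lemma sum_coset P f e m e' :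
  (\sum_j \sum_i sq (gdev P f (t1, e, j) (m, e', i) - get27 f (m, e', i)) =
   line_sum f (row_coset P e (m, e')) * line_sum f (m, e'))%R.
Proof.
have [a [b [l cosetE]]] := gmul_coset P e m e'.
rewrite exchange_big /=.
set c := row_coset P e (m, e').
have cE : c = (tadd t1 m, (gmul P (t1, e, t0, t0) (m, e', t0, t0)).1.1.2).
  by rewrite /c /row_coset cosetE.
pose X v := get27 f (c, v); pose Y i := (get27 f (m, e', i) - (b + i * l))%R.
transitivity (\sum_i \sum_j sq (X j - Y i))%R.
  (* For fixed i the place of the first entry is translated by i + a, which lets j run freely. *)
  apply: eq_bigr => i _; rewrite [RHS](reindex_inj (addIr (i + a)%R)) /=.
  apply: eq_bigr => j _; congr sq.
  by rewrite /gdev cosetE -cE /fev /Y /X opprB addrA addrAC.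
rewrite !big_trit; have := sum_sq_diff (X t0) (X t1) (X t2) (Y t0) (Y t1) (Y t2).
rewrite /= => ->; congr (_ * _)%R; rewrite /line_sum /Y /get27 /= !taddE.
(* Summed over i, the corrections b + i l amount to 3 b + 3 l, which is 0. *)
by case: (b); case: (l); rewrite /=; do 3!case: (get9 _ _).
Qed.

Lemma gdev0 P f x : gdev P f (t0, t0, t0) x = get27 f x.
Proof. by rewrite /gdev gmul0 /fev [tadd _ _]taddC. Qed.

(** The squared differences of the rows t y^e k^j sum to 0 by balance; adding over j turns them into
    products of sums over cosets of <k>. Each e thus gives a quadratic condition on nine trits. *)
Lemma line_sum_orthogonal P f e : is_tBH (gdev P f) ->
  (\sum_x line_sum f (row_coset P e x) * line_sum f x = 0)%R.
Proof.
move=> bh.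
have Z : (\sum_j \sum_x sq (gdev P f (t1, e, j) x - gdev P f (t0, t0, t0) x) = 0)%R.
  by apply: big1 => j _; apply: sum_balanced; apply: row_balanced.
rewrite -[RHS]Z; transitivity (\sum_x \sum_j \sum_i
    sq (gdev P f (t1, e, j) (x, i) - gdev P f (t0, t0, t0) (x, i)))%R.
  apply: eq_bigr => -[m e'] _; rewrite -sum_coset.
  by apply: eq_bigr => j _; apply: eq_bigr => i _; rewrite gdev0.
rewrite exchange_big; apply: eq_bigr => j _ /=; rewrite pair_bigA /=.
by apply: eq_bigr => -[x i].
Qed.

(** * Dictionary of blocks and joined search *)

Fixpoint hasw (T : Type) (p : T -> bool) (s : seq T) : bool :=
  if s is x :: s' then if p x then true else hasw p s' else false.

Lemma haswE (T : Type) (p : T -> bool) s : hasw p s = has p s.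
Proof. by elim: s => //= x s ->; case: (p x). Qed.

Definition upd A (v : tri A) (a : trit) (g : A -> A) : tri A :=
  match a with
  | t0 => Tri (g (tri0 v)) (tri1 v) (tri2 v)
  | t1 => Tri (tri0 v) (g (tri1 v)) (tri2 v)
  | t2 => Tri (tri0 v) (tri1 v) (g (tri2 v))
  end.

Lemma updE A (v : tri A) a g b : sel (upd v a g) b = if a == b then g (sel v b) else sel v b.
Proof. by case: a; case: b. Qed.

Definition upd27 A (v : tri (tri (tri A))) (x : idx) (g : A -> A) :=
  upd v x.1.1 (fun w => upd w x.1.2 (fun u => upd u x.2 g)).

Lemma upd27E A (v : tri (tri (tri A))) x g y :
  get27 (upd27 v x g) y = if x == y then g (get27 v y) else get27 v y.
Proof.
case: x y => [[a b] c] [[a' b'] c']; rewrite /get27 /get9 /upd27 /= updE !xpair_eqE.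
case: eqP => // _; rewrite updE; case: eqP => // _; rewrite updE //.
Qed.

(** A self-delimiting code: n ones closed by a zero. It makes [enc] injective and turns the keys
    into indices of a [PositiveMap]. *)
Fixpoint enc_nat (n : nat) (p : positive) : positive :=
  if n is S n' then xI (enc_nat n' p) else xO p.

Fixpoint enc (s : seq nat) : positive :=
  if s is n :: s' then enc_nat n (enc s') else xH.

Lemma enc_inj : injective enc.
Proof.
elim=> [|n s IH] [|m r] //=; rewrite ?[xH]/(enc [::]).
- by case: m.
- by case: n.
elim: n m => [|n IHn] [|m] //= [].
  by move=> /IH ->.
by move=> /IHn [-> ->].
Qed.

Definition block_csums (b : block) : idx :=
  let s e := tadd (tadd (get9 b (e, t0)) (get9 b (e, t1))) (get9 b (e, t2)) in
  (s t0, s t1, s t2).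

(** The blocks with one key, sorted by their sums over the cosets of <k>, which are all that [ctest]
    looks at. *)
Definition bucket := (seq nat * tri (tri (tri (seq block))))%type.
Definition dict := PositiveMap.t bucket.

Definition insert (rows : seq (seq apos)) (b : block) (D : dict) : dict :=
  let k := keyf rows b in let p := enc k in
  let T := match PositiveMap.find p D with
           | Some kT => kT.2
           | None => tab27 (fun _ => [::])
           end in
  PositiveMap.add p (k, upd27 T (block_csums b) (cons b)) D.

Definition dict_of (rows : seq (seq apos)) (bs : seq block) : dict :=
  foldr (insert rows) (PositiveMap.empty bucket) bs.

Lemma dict_ofP rows bs b : List.In b bs ->
  exists T, PositiveMap.find (enc (keyf rows b)) (dict_of rows bs) = Some (keyf rows b, T)
            /\ List.In b (get27 T (block_csums b)).
Proof.
elim: bs => //= c bs IH [->|/IH [T [fT bT]]].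
  rewrite /insert PositiveMap.gss; eexists; split; first by [].
  by rewrite upd27E eqxx; left.
rewrite {1}/insert; case: (boolP (keyf rows c == keyf rows b)) => [/eqP e|ne].
  rewrite e PositiveMap.gss fT; eexists; split; first by [].
  by rewrite upd27E; case: eqP => //= _; right.
rewrite PositiveMap.gso; first by exists T.
by move=> /enc_inj e; rewrite e eqxx in ne.
Qed.

Definition all_tri A (s : seq A) : seq (tri A) :=
  List.flat_map (fun a => List.flat_map (fun b => List.map (Tri a b) s) s) s.

Lemma in_all_tri A (s : seq A) (v : tri A) :
  (forall a, List.In (sel v a) s) -> List.In v (all_tri s).
Proof.
move=> h; apply/List.in_flat_map; exists (tri0 v); split; first exact: (h t0).
apply/List.in_flat_map; exists (tri1 v); split; first exact: (h t1).
by apply/List.in_map_iff; exists (tri2 v); split; [case: (v) | exact: (h t2)].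
Qed.

Definition all_blocks : seq block := all_tri (all_tri trits).

Lemma in_all_blocks b : List.In b all_blocks.
Proof.
apply: in_all_tri => e; apply: in_all_tri => i.
by case: (sel _ _) => /=; auto.
Qed.

Definition coset_pairs (P : par) : seq (seq ((trit * trit) * (trit * trit))) :=
  [seq [seq (row_coset P e x, x) | x <- pos9] | e <- trits].

Definition tri_of (c : idx) : tri trit := Tri c.1.1 c.1.2 c.2.

Definition ctest (cp : seq (seq ((trit * trit) * (trit * trit)))) (C : block) : bool :=
  allw (fun l => teqb (foldr (fun p a => tadd (tmul (get9 C p.1) (get9 C p.2)) a) t0 l) t0) cp.

(** The rows of t<y, k, z>. Those of t^2<y, k, z> belong to the inverses modulo z and have negated
    differences up to a constant; those of <y, k, z> are dealt with by the keys. *)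
Definition crows (P : par) : seq (seq apos * seq apos * seq apos) :=
  [seq (strip (row_entries P (t1, x.1, x.2) t0), strip (row_entries P (t1, x.1, x.2) t1),
        strip (row_entries P (t1, x.1, x.2) t2)) | x <- pos9].

Definition rows_ok (rows : seq (seq apos * seq apos * seq apos)) (f : func)
    (s0 s1 s2 : seq trit) : bool :=
  allw (fun r =>
    consume_diffs r.1.1 (tri1 f) s0 9 9 9 (fun a b c =>
    consume_diffs r.1.2 (tri2 f) s1 a b c (fun a b c =>
    consume_diffs r.2 (tri0 f) s2 a b c (fun _ _ _ => true)))) rows.

Lemma in_idxs x : List.In x idxs.
Proof. by case: x => [[[] []] []]; rewrite /idxs /=; tauto. Qed.


Definition groups (T : tri (tri (tri (seq block)))) : seq (idx * seq block) :=
  List.flat_map (fun x => match get27 T x with [::] => [::] | l => [:: (x, l)] end) idxs.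

Definition grouped := PositiveMap.t (seq nat * seq (idx * seq block)).

Definition group_dict (D : dict) : grouped :=
  PositiveMap.map (fun kT => (kT.1, groups kT.2)) D.

Definition ctests (P : par) : tri (tri (tri (tri (tri (tri (tri (tri (tri bool)))))))) :=
  let cp := coset_pairs P in
  tab27 (fun x0 => tab27 (fun x1 => tab27 (fun x2 =>
    ctest cp (Tri (tri_of x0) (tri_of x1) (tri_of x2))))).

(** Blocks 0 and 1 determine the key under which block 2 is looked up. The quadratic test, which
    sees only the coset sums, precedes the choice of individual blocks. Every filter is necessary
    for a balanced function not improved by the moves [ms], so the list may contain too much but
    misses none. *)
Definition search (P : par) (ms : seq move) (krows : seq (seq apos)) (D : grouped) : seq func :=
  let md := [seq mdata_of P m | m <- ms] in
  let A0 := from_block t0 md in let A1 := from_block t1 md in let A2 := from_block t2 md in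
  let rows := crows P in let ct := ctests P in let els := PositiveMap.elements D in
  List.flat_map (fun f0 =>
    let s0 := blist f0 in
    if hasw (fun l => is_lt (act_cmp l f0 s0)) A0 then [::] else
    let k0 := keyf krows f0 in let ct0 := get27 ct (block_csums f0) in
    let B1 := fixers t1 f0 s0 md in let B2 := fixers t2 f0 s0 md in
    List.flat_map (fun el =>
      match PositiveMap.find (enc (rest k0 el.2.1)) D with
      | None => [::]
      | Some kT =>
        List.flat_map (fun g1 =>
          match List.filter (fun f1 =>
            if hasw (fun l => is_lt (act_cmp l f1 s0)) A1 then false else
            let s1 := blist f1 in ~~ hasw (fun l => is_lt (act_cmp l f1 s1)) B1) g1.2 with
          | [::] => [::]
          | l1 =>
            let ct1 := get27 ct0 g1.1 in
            List.flat_map (fun g2 =>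
              if get27 ct1 g2.1 then
                List.flat_map (fun f1 => let s1 := blist f1 in
                  List.filter (fun f =>
                    let f2 := tri2 f in let s2 := blist f2 in
                    if rows_ok rows f s0 s1 s2 then
                      if hasw (fun l => is_lt (act_cmp l f2 s0)) A2 then false else
                      ~~ hasw (fun l => is_lt (act_cmp l f2 s1)) B2
                    else false) (List.map (Tri f0 f1) g2.2)) l1
              else [::]) kT.2
          end) el.2.2
      end) els) all_blocks.

Lemma in_groups T x b : List.In b (get27 T x) -> List.In (x, get27 T x) (groups T).
Proof.
move=> bT; apply/List.in_flat_map; exists x; split; first exact: in_idxs.
by case: (get27 T x) bT => // c l _; left.
Qed.

Lemma ctest_sound P f : is_tBH (gdev P f) ->
  ctest (coset_pairs P) (Tri (tri_of (block_csums (tri0 f)))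
    (tri_of (block_csums (tri1 f))) (tri_of (block_csums (tri2 f)))).
Proof.
move=> bh; rewrite /ctest allwE; apply/allP => l /mapP[e _ ->].
have CE x : get9 (Tri (tri_of (block_csums (tri0 f)))
    (tri_of (block_csums (tri1 f))) (tri_of (block_csums (tri2 f)))) x = line_sum f x.
  by case: x => [[] []].
set C := Tri _ _ _ in CE *; rewrite -[teqb _ _]/(_ == _); apply/eqP.
have: (\sum_m \sum_e' line_sum f (row_coset P e (m, e')) * line_sum f (m, e') = 0)%R.
  by rewrite pair_bigA -[RHS](line_sum_orthogonal e bh); apply: eq_bigr => -[].
by rewrite !big_trit => h; apply: (etrans _ h); rewrite /= !CE; tring.
Qed.

Lemma rows_ok_sound P f : is_tBH (gdev P f) ->
  rows_ok (crows P) f (blist (tri0 f)) (blist (tri1 f)) (blist (tri2 f)).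
Proof.
move=> bh; rewrite /rows_ok allwE /crows all_map; apply/allP => -[e i] _.
have := row_consume bh (isT : (t1, e, i) != (t0, t0, t0)).
rewrite -{1}[row_diffs P f (t1, e, i) t2]cats0 => h; apply: etrans h.
by apply: consume_diffsE => *; apply: consume_diffsE => *; apply: consume_diffsE.
Qed.

Theorem search_complete P ms f :
  is_tBH (gdev P f) ->
  (forall m, List.In m ms -> lexcmp (flist (move_func P m f)) (flist f) <> Lt) ->
  let rows := shift_rows P in
  List.In f (search P ms rows (group_dict (dict_of rows all_blocks))).
Proof.
move=> bh fmin rows; rewrite /search.
apply/List.in_flat_map; exists (tri0 f); split; first exact: in_all_blocks.
have nb0 := not_beaten0 fmin t0; rewrite /beaten -haswE in nb0; rewrite nb0.
have [T1 [fT1 inT1]] := dict_ofP rows (in_all_blocks (tri1 f)).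
have [T2 [fT2 inT2]] := dict_ofP rows (in_all_blocks (tri2 f)).
move: (dict_of rows all_blocks) fT1 fT2 => D fT1 fT2.
have key2 : keyf rows (tri2 f) = rest (keyf rows (tri0 f)) (keyf rows (tri1 f)) := key_rest bh.
have gE k T : PositiveMap.find (enc k) D = Some (k, T) ->
    PositiveMap.find (enc k) (group_dict D) = Some (k, groups T).
  by move=> fT; rewrite /group_dict PositiveMap.gmapi fT.
have gT1 := gE _ _ fT1; have gT2 := gE _ _ fT2.
move: (group_dict D) gT1 gT2 => G gT1 gT2 {gE fT1 fT2 D}.
apply/List.in_flat_map; exists (enc (keyf rows (tri1 f)), (keyf rows (tri1 f), groups T1)).
split; first exact: PositiveMap.elements_correct gT1.
cbn [fst snd]; rewrite -key2 gT2; cbn [fst snd].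
apply/List.in_flat_map; exists (block_csums (tri1 f), get27 T1 (block_csums (tri1 f))).
split; first exact: in_groups inT1.
cbn [fst snd].
have in1 : List.In (tri1 f) (List.filter (fun f1 =>
    if hasw (fun l => is_lt (act_cmp l f1 (blist (tri0 f))))
      (from_block t1 [seq mdata_of P m | m <- ms]) then false
    else ~~ hasw (fun l => is_lt (act_cmp l f1 (blist f1)))
      (fixers t1 (tri0 f) (blist (tri0 f)) [seq mdata_of P m | m <- ms]))
    (get27 T1 (block_csums (tri1 f)))).
  apply/List.filter_In; split=> //.
  have nb := not_beaten0 fmin t1; rewrite /beaten -haswE in nb; rewrite nb.
  by have nb' := not_beaten1 fmin t1; rewrite /beaten -haswE in nb'; rewrite nb'.
move: in1; case: (List.filter _ _) => [//|b1 l1] in1.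
apply/List.in_flat_map; exists (block_csums (tri2 f), get27 T2 (block_csums (tri2 f))).
split; first exact: in_groups inT2.
cbn [fst snd]; rewrite /ctests !tab27K ctest_sound //.
apply/List.in_flat_map; exists (tri1 f); split; first exact: in1.
apply/List.filter_In; split.
  by apply/List.in_map_iff; exists (tri2 f); case: (f) inT2.
rewrite rows_ok_sound //.
have nb := not_beaten0 fmin t2; rewrite /beaten -haswE in nb; rewrite nb.
by have nb' := not_beaten1 fmin t2; rewrite /beaten -haswE in nb'; rewrite nb'.
Qed.

From mathcomp Require Import boolp.
Import Order.TTheory GRing.Theory Num.Theory.

(** * Matching against class representatives *)

Local Open Scope ring_scope.

Inductive trie := Tip | Node (a b c : trie).

Fixpoint tmem (s : seq trit) (t : trie) : bool :=
  match t with
  | Tip => false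
  | Node a b c =>
    match s with
    | [::] => true
    | x :: s' => tmem s' (match x with t0 => a | t1 => b | t2 => c end)
    end
  end.

Fixpoint tins (s : seq trit) (t : trie) : trie :=
  let: (a, b, c) := match t with Tip => (Tip, Tip, Tip) | Node a b c => (a, b, c) end in
  match s with
  | [::] => Node a b c
  | t0 :: s' => Node (tins s' a) b c
  | t1 :: s' => Node a (tins s' b) c
  | t2 :: s' => Node a b (tins s' c)
  end.

Lemma tmem_ins s r t : size s = size r -> tmem r (tins s t) -> r = s \/ tmem r t.
Proof.
elim: s r t => [|x s IH] [|y r] t //=; first by left.
case=> sz; have tipE q : tmem q Tip = false by case: q.
by case: x; case: y; case: t => [|a b c] /=; rewrite ?tipE; try (by right);
  case/(IH _ _ sz) => [->|]; rewrite ?tipE; auto.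
Qed.

Lemma tmem_trie r ss :
  all (fun s => size s == size r) ss -> tmem r (foldr tins Tip ss) -> r \in ss.
Proof.
elim: ss => [|s ss IH] /=; first by case: r.
case/andP=> /eqP sz /IH {}IH /(tmem_ins sz)[->|/IH]; rewrite inE ?eqxx // => ->.
by rewrite orbT.
Qed.

(* Normalization of a matrix at row [0] and column [d]. *)
Definition nrm (M : tmat) (d x c : idx) : trit :=
  tadd (tadd (M x c) (topp (M x d))) (tadd (topp (M (t0, t0, t0) c)) (M (t0, t0, t0) d)).

(** Three normalized rows give each column one of 27 labels; when these are distinct, they leave a
    single possible correspondence with the columns of another matrix. *)
Definition label (M : tmat) (d : idx) (y : idx * idx * idx) (c : idx) : idx :=
  (nrm M d y.1.1 c, nrm M d y.1.2 c, nrm M d y.2 c).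

Definition column_of (M : tmat) (d : idx) (y : idx * idx * idx) : tri (tri (tri idx)) :=
  foldr (fun c T => upd27 T (label M d y c) (fun _ => c)) (tab27 (fun _ => d)) idxs.

Definition labels_ok (M : tmat) (d : idx) (y : idx * idx * idx) (T : tri (tri (tri idx))) :=
  allw (fun c => xeqb (get27 T (label M d y c)) c) idxs.

Definition column_list (M : tmat) (d : idx) (T : tri (tri (tri idx))) : seq (idx * trit) :=
  [seq let c := get27 T v in (c, tadd (topp (M (t0, t0, t0) c)) (M (t0, t0, t0) d)) | v <- idxs].

Definition row_list (M : tmat) (d : idx) (cols : seq (idx * trit)) (x : idx) : seq trit :=
  let r := M x in let k := topp (r d) in
  [seq tadd (tadd (r q.1) k) q.2 | q <- cols].

Definition row_trie (M : tmat) (d : idx) (y : idx * idx * idx) : trie :=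
  let cols := column_list M d (column_of M d y) in
  foldr tins Tip [seq row_list M d cols x | x <- idxs].

Definition matches (tr : trie) (M : tmat) (d : idx) (y : idx * idx * idx) : bool :=
  let T := column_of M d y in
  if labels_ok M d y T then
    let cols := column_list M d T in allw (fun x => tmem (row_list M d cols x) tr) idxs
  else false.

Lemma row_listE M d T x :
  row_list M d (column_list M d T) x = [seq nrm M d x (get27 T v) | v <- idxs].
Proof. by rewrite /row_list /column_list -map_comp. Qed.

(** Columns with equal labels correspond. Given this, it is enough that each normalized row of [M],
    read in the order of the labels, occurs among those of [N]; the normalizations become the row
    and column constants. *)
Lemma matches_teq (N M : tmat) (e d : idx) (x y : idx * idx * idx) :
  is_tBH M -> labels_ok N e x (column_of N e x) ->
  matches (row_trie N e x) M d y -> teq N M.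
Proof.
move=> bhM okN; rewrite /matches; case: ifP => // okM.
move: okN okM; rewrite /labels_ok /row_trie !allwE.
move: (column_of N e x) (column_of M d y) => U T /allP okN /allP okM /allP rows.
have UK : cancel (label N e x) (get27 U) by move=> c; apply/eqP; rewrite -xeqbE okN ?mem_idxs.
have TK : cancel (label M d y) (get27 T) by move=> c; apply/eqP; rewrite -xeqbE okM ?mem_idxs.
have [U' U'K KU'] := injF_bij (can_inj UK).
have Uinj : injective (get27 U).
  by move=> v w; rewrite -(KU' v) -(KU' w) !UK => ->.
pose u c := get27 U (label M d y c).
have rowE z : exists z', forall c, nrm M d z c = nrm N e z' (u c).
  have := rows z (mem_idxs z); rewrite row_listE => /tmem_trie mem.
  have /mem/mapP[z' _] : all (fun s => size s == size [seq nrm M d z (get27 T v) | v <- idxs])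
      [seq row_list N e (column_list N e U) z' | z' <- idxs].
    by apply/allP => _ /mapP[w _ ->]; rewrite row_listE !size_map.
  rewrite row_listE => /eq_in_map E; exists z' => c.
  by have := E _ (mem_idxs (label M d y c)); rewrite TK.
have [s sE] := fin_all_exists rowE.
have ME z c : M z c = (M z d - N (s z) e) + N (s z) (u c) +
    (M (t0, t0, t0) c - M (t0, t0, t0) d - (N (t0, t0, t0) (u c) - N (t0, t0, t0) e)).
  have := sE z c; rewrite /nrm !taddE !toppE => h.
  have -> : M z c = M z c - M z d + (- M (t0, t0, t0) c + M (t0, t0, t0) d) +
      (M z d + M (t0, t0, t0) c - M (t0, t0, t0) d) by ring.
  by rewrite h; ring.
exists s, u, (fun z => M z d - N (s z) e), (fun c => M (t0, t0, t0) c - M (t0, t0, t0) d -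
  (N (t0, t0, t0) (u c) - N (t0, t0, t0) e)).
split=> [z w szw||//]; last by apply: inj_comp Uinj (can_inj TK).
(* Two rows of [M] matched with one row of [N] would differ by a constant, against balance. *)
apply: contraTeq isT => /bhM bal.
have := bal (M z d - M w d); rewrite (@eq_card _ _ predT) ?card_idx // => c.
rewrite !inE; apply/eqP; rewrite (ME z c) (ME w c) szw.
by ring.
Qed.

(* Sequences of trits as base 4 numerals, least significant digit first. *)
Fixpoint dec (p : positive) : seq trit :=
  match p with
  | xO (xO q) => t0 :: dec q
  | xI (xO q) => t1 :: dec q
  | xO (xI q) => t2 :: dec q
  | _ => [::]
  end.

Definition dec_elt (s : seq trit) (i : nat) : idx * trit :=
  (nth t0 s i, nth t0 s i.+1, nth t0 s i.+2, nth t0 s i.+3).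

Definition dec_idx (s : seq trit) (i : nat) : idx :=
  (nth t0 s i, nth t0 s i.+1, nth t0 s i.+2).

Definition dec_anchor (s : seq trit) (i : nat) : idx * idx * idx :=
  (dec_idx s i, dec_idx s (3 + i), dec_idx s (6 + i)).

Definition dec_move (p : positive) : move :=
  let s := dec p in Move (dec_elt s 0) (dec_elt s 4) (dec_elt s 8) (dec_elt s 12).

Definition nat_of_idx (x : idx) : nat :=
  (9 * nat_of_trit x.1.1 + 3 * nat_of_trit x.1.2 + nat_of_trit x.2)%N.

Definition dec_par (s : seq trit) : par :=
  Par (nth t0 s 0) (nth t0 s 1) (nth t0 s 2) (nth t0 s 3)
      (nth t0 s 4) (nth t0 s 5) (nth t0 s 6) (nth t0 s 7).

Definition dec_func (s : seq trit) : func := tab27 (fun x => nth t0 s (nat_of_idx x)).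

(** The anchor rows start at digit 35 = 8 + 27, after the parameters and the values. *)
Definition dec_class (p : positive) : par * func * (idx * idx * idx) :=
  let s := dec p in (dec_par s, dec_func (drop 8 s), dec_anchor s 35).

Definition origin : idx := (t0, t0, t0).

Definition class_data := (par * func * (idx * idx * idx))%type.

Definition class_ok (d : class_data) : bool :=
  let: (P, f, y) := d in let M := gdev P f in
  if is_tBHb M then labels_ok M origin y (column_of M origin y) else false.

Definition trie_of_class (d : class_data) : trie :=
  let: (P, f, y) := d in row_trie (gdev P f) origin y.

Definition mat_of_class (d : class_data) : tmat := gdev d.1.1 d.1.2.

Definition gtable (P : par) : tri (tri (tri (tri (tri (tri (idx * trit)))))) :=
  tab27 (fun x => tab27 (fun y => gmul P (x, t0) (y, t0))).

Definition tabdev (gt : tri (tri (tri (tri (tri (tri (idx * trit))))))) (f : func) : tmat :=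
  fun x => let r := get27 gt x in fun y => fev f (get27 r y).

Lemma tabdevE P f x y : tabdev (gtable P) f x y = gdev P f x y.
Proof. by rewrite /tabdev /gtable !tab27K. Qed.

(** Three digits of the certificate give the class, nine the anchor rows and three the base column.
    A class number out of range selects [Tip], which matches nothing. *)
Definition matched (tries : seq trie) (M : tmat) (h : positive) : bool :=
  let s := dec h in let k := nat_of_idx (dec_idx s 0) in
  matches (nth Tip tries k) M (dec_idx s 12) (dec_anchor s 3).

Fixpoint all2w (S T : Type) (r : S -> T -> bool) (s : seq S) (t : seq T) : bool :=
  match s, t with
  | x :: s', y :: t' => if r x y then all2w r s' t' else false
  | [::], [::] => true
  | _, _ => false
  end.

Lemma all2w_in (S T : Type) (r : S -> T -> bool) s t x :
  all2w r s t -> List.In x s -> exists2 y, List.In y t & r x y.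
Proof.
elim: s t => //= a s IH [|b t] //; case: ifP => // ab h [<-|xs].
  by exists b; first by left.
by have [y yt xy] := IH _ h xs; exists y; first by right.
Qed.

Lemma matches_tip M d y : matches Tip M d y = false.
Proof. by rewrite /matches; case: ifP. Qed.

Lemma class_matches d M e y : class_ok d -> is_tBH M ->
  matches (trie_of_class d) M e y -> teq (mat_of_class d) M.
Proof.
case: d => [[P f] x]; rewrite /class_ok /trie_of_class /mat_of_class; cbn [fst snd].
case: ifP => // _ lab bhM mt.
exact: (@matches_teq (gdev P f) M origin e x y bhM lab mt).
Qed.

Lemma matched_teq (cs : seq class_data) d0 M h : allw class_ok cs -> is_tBH M ->
  matched [seq trie_of_class d | d <- cs] M h ->
  exists2 k, (k < size cs)%N & teq (mat_of_class (nth d0 cs k)) M.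
Proof.
rewrite allwE /matched => /(all_nthP d0) ok bhM; move: (nat_of_idx _) => k.
have [kcs|kcs] := ltnP k (size cs); last first.
  by rewrite nth_default ?size_map // matches_tip.
by rewrite (nth_map d0) // => /class_matches; exists k => //; auto.
Qed.

(** * Checking a tuple of parameters *)

Definition rep_data := (par * (seq positive * seq positive))%type.

Definition check_rep (tries : seq trie) (krows : seq (seq apos)) (D : grouped)
    (d : rep_data) : bool :=
  let: (P, (mc, lc)) := d in let ms := [seq dec_move p | p <- mc] in
  if allw (move_ok P P) ms then
    let gt := gtable P in
    all2w (fun f h => matched tries (tabdev gt f) h) (search P ms krows D) lc
  else false.

Definition check_reps (cs : seq class_data) (p q : trit) (ds : seq rep_data) : bool :=
  let krows := shift_rows (Par p q t0 t0 t0 t0 t0 t0) in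
  let D := group_dict (dict_of krows all_blocks) in
  let tries := [seq trie_of_class c | c <- cs] in
  allw (fun d => if teqb (pp d.1) p then if teqb (pq d.1) q then check_rep tries krows D d
                 else false else false) ds.

(** Products inside <y, k, z> involve no other parameters, so one dictionary serves all tuples that
    share [pp] and [pq]. *)
Lemma shift_rowsE P : shift_rows P = shift_rows (Par (pp P) (pq P) t0 t0 t0 t0 t0 t0).
Proof. by case: P. Qed.

Lemma in_allw (T : Type) (p : T -> bool) s x : allw p s -> List.In x s -> p x.
Proof. by elim: s => //= y s IH; case: ifP => // py h [<- //|]; apply: IH. Qed.

Section Classification.

Variables (gT : finGroupType) (z : gT) (Phi : gT -> trit).
Hypothesis card81 : #|gT| = 81%N.
Hypothesis PhiZ : forall x d, Phi (x * tpow z d)%g = tadd (Phi x) d.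

(** The minimum is taken over all presentations with parameters [P] and all translates; the listed
    moves stay among these, so none of them improves it. *)
Lemma minimal_instance P f : instance z Phi P f ->
  exists2 f', instance z Phi P f' &
    forall f'', instance z Phi P f'' -> lexcmp (flist f'') (flist f') <> Lt.
Proof.
move: {2}(code3 (flist f)) (leqnn (code3 (flist f))) => n.
elim: n f => [|n IH] f lef inf.
  exists f => // f'' _ /lexcmp_code; rewrite !size_cat => /(_ erefl).
  by move: lef; case: (code3 _).
have [[f' [inf' lt]]|none] := EM (exists f', instance z Phi P f' /\
    lexcmp (flist f') (flist f) = Lt).
  apply: (IH f') => //.
  by have := lexcmp_code (erefl : size (flist f') = size (flist f)) lt; lia.
by exists f => // f'' inf'' lt; apply: none; exists f''.
Qed.

(** The first conclusion makes an empty list of certificates a proof of nonexistence. *)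
Lemma rep_classified (cs : seq class_data) d0 p q ds P mc lc f :
  allw class_ok cs -> check_reps cs p q ds -> List.In (P, (mc, lc)) ds ->
  instance z Phi P f -> is_tBH (gdev P f) ->
  lc <> [::] /\
  exists2 k, (k < size cs)%N & teq (mat_of_class (nth d0 cs k)) (gdev P f).
Proof.
move=> okc okd inP inf bhf.
have := in_allw okd inP; case: ifP => // /eqP pP; case: ifP => // /eqP qP.
rewrite -[shift_rows _](_ : shift_rows P = _); last by rewrite shift_rowsE pP qP.
rewrite /check_rep; case: ifP => // okm srch.
have [g ing gmin] := minimal_instance inf.
have eqfg : teq (gdev P f) (gdev P g) := instance_teq card81 PhiZ inf ing.
have bhg : is_tBH (gdev P g) := teq_tBH eqfg bhf.
have gmoves m : List.In m [seq dec_move p | p <- mc] ->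
    lexcmp (flist (move_func P m g)) (flist g) <> Lt.
  by move=> /(in_allw okm) mok; apply: gmin; apply: (instance_move PhiZ) mok.
have [h hlc mh] := all2w_in srch (search_complete bhg gmoves).
split; first by move=> l0; rewrite l0 in hlc.
have tabg : teq (gdev P g) (tabdev (gtable P) g).
  by apply: teq_ext => x y; rewrite tabdevE.
have [k ks kg] := matched_teq d0 okc (teq_tBH tabg bhg) mh.
by exists k => //; apply: teq_trans kg (teq_sym (teq_trans eqfg tabg)).
Qed.

End Classification.

(** * Consistent parameters and their reduction *)

Definition consistent (P : par) : bool :=
  let T := (t1, t0, t0, t0) in let T2 := (t2, t0, t0, t0) in
  let Y := (t0, t1, t0, t0) in let Y2 := (t0, t2, t0, t0) in
  let mu := gmul P in
  if geqb (mu (mu T T) T2) (mu T (mu T T2)) then geqb (mu (mu T Y) Y2) (mu T (mu Y Y2))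
  else false.

(** The two tests say that t commutes with t^3 and that conjugation by t respects the relation for
    y^3. *)
Lemma presents_consistent (gT : finGroupType) (z t y k : gT) P :
  presents z t y k P -> consistent P.
Proof.
case=> rel inj.
have A a b c : gmul P (gmul P a b) c = gmul P a (gmul P b c).
  by apply: inj; rewrite -!(ev_mul rel) mulgA.
by rewrite /consistent !A !geqbE !eqxx.
Qed.

Definition all_pars : seq par :=
  List.flat_map (fun p => List.flat_map (fun q => List.flat_map (fun l =>
  List.flat_map (fun r => List.flat_map (fun s => List.flat_map (fun u =>
  List.flat_map (fun v => List.map (fun w => Par p q l r s u v w) trits)
  trits) trits) trits) trits) trits) trits) trits.

Lemma in_trits a : List.In a trits.
Proof. by case: a => /=; tauto. Qed.

Lemma in_all_pars P : List.In P all_pars.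
Proof.
case: P => p q l r s u v w.
have F (A : Type) (G : trit -> seq A) a x : List.In x (G a) -> List.In x (List.flat_map G trits).
  by move=> h; apply/List.in_flat_map; exists a; split; first exact: in_trits.
apply: (F _ _ p); apply: (F _ _ q); apply: (F _ _ l); apply: (F _ _ r).
apply: (F _ _ s); apply: (F _ _ u); apply: (F _ _ v).
by apply/List.in_map_iff; exists w; split; last exact: in_trits.
Qed.

Definition reduces (rs : seq par) (P : par) (h : positive) : bool :=
  let s := dec h in
  let m := Move (dec_elt s 3) (dec_elt s 7) (dec_elt s 11) gone in
  let k := nat_of_idx (dec_idx s 0) in
  if (k < size rs)%N then move_ok P (nth P rs k) m else false.

Lemma reduction (gT : finGroupType) (z : gT) (Phi : gT -> trit) rs hs P f :
  (forall x d, Phi (x * tpow z d)%g = tadd (Phi x) d) ->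
  all2w (reduces rs) (List.filter consistent all_pars) hs ->
  instance z Phi P f -> exists Q f', List.In Q rs /\ instance z Phi Q f'.
Proof.
move=> PhiZ ok inf.
have cP : consistent P by have [t [y [k [g [/presents_consistent]]]]] := inf.
have /(all2w_in ok)[h _] : List.In P (List.filter consistent all_pars).
  by apply/List.filter_In; split=> //; apply: in_all_pars.
rewrite /reduces; case: ifP => // krs mok.
exists (nth P rs (nat_of_idx (dec_idx (dec h) 0))).
exists (move_func P (Move (dec_elt (dec h) 3) (dec_elt (dec h) 7) (dec_elt (dec h) 11) gone) f).
split; last exact: (instance_move PhiZ) mok.
elim: rs (nat_of_idx _) krs {ok mok} => // R rs IH [|k] /=; first by left.
by move=> krs; right; apply: IH.
Qed.

(* Parameters and function of a representative, then three rows whose entries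
   distinguish its columns. *)
Definition class_codes : seq positive := [::
  495256439476555983305572352; 495255941414465993147678720; 495256276049932705285013504;
  495255941415099311845277696; 490420795219445899715411968; 316033182291425577884712960;
  489211537768265785811140608; 335677737314362547341623296; 495256442071262693005721600;
  495256166289878036573589504; 495256166287978080480792576; 495255941414465993147682816;
  495255941415099311845281792; 495256509192349338385256448; 495255923580282592144920576;
  495255923581373582557581312]%positive.

(* For each consistent tuple of parameters: the position of the tuple in [reps]
   to which it is reduced, and the new generators that do so. *)
Definition reduction_codes : seq positive := [::
  1140916288; 1140916304; 1140916368; 1140916320; 1409351776; 1677787232; 1140916384; 1677787296;
  1409351840; 1090781280; 1359216736; 1627652192; 1157890144; 1426325600; 1694761056; 1224999008;
  1493434464; 1761869920; 1090781344; 1627652256; 1359216800; 1224999072; 1761869984; 1493434528;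
  1157890208; 1694761120; 1426325664; 1140916292; 1140916308; 1140981908; 1140916324; 1409351780;
  1677787236; 1140981924; 1677852836; 1409417380; 1140916356; 1140981844; 1140916372; 1140981860;
  1409417316; 1677852772; 1140916388; 1677787300; 1409351844; 1140916296; 1140916312; 1140981912;
  1140916328; 1140916289; 1208025217; 1140981928; 1208090689; 1140981889; 1409351752; 1409351768;
  1409417368; 1744896129; 1409351784; 1409351745; 1744961601; 1409417345; 1409417384; 1677787208;
  1677787224; 1677852824; 1677787201; 1476460673; 1677787240; 1677852801; 1677852840; 1476526145;
  1140916360; 1140981848; 1140916376; 1140981864; 1140981825; 1208090753; 1140916392; 1208025153;
  1140916353; 1677787272; 1677852760; 1677787288; 1677852737; 1476526209; 1677852776; 1677787265;
  1677787304; 1476460609; 1409351816; 1409417304; 1409351832; 1744961665; 1409417320; 1409417281;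
  1744896065; 1409351809; 1409351848; 1090781252; 1090781268; 1091043476; 1090781284; 1359216740;
  1627652196; 1091043492; 1627914404; 1359478948; 1224998980; 1224998996; 1225261204; 1224999012;
  1493434468; 1761869924; 1225261220; 1762132132; 1493696676; 1157890116; 1157890132; 1158152340;
  1157890148; 1426325604; 1694761060; 1158152356; 1695023268; 1426587812; 1140916305; 1140916817;
  1140916561; 1141440593; 1141441105; 1141440849; 1141178449; 1141178961; 1141178705; 1140981841;
  1140982097; 1140982353; 1141243985; 1141244241; 1141244497; 1141506129; 1141506385; 1141506641;
  1090781316; 1091043412; 1090781332; 1091043428; 1359478884; 1627914340; 1090781348; 1627652260;
  1359216804; 1157890180; 1158152276; 1157890196; 1158152292; 1426587748; 1695023204; 1157890212;
  1694761124; 1426325668; 1224999044; 1225261140; 1224999060; 1225261156; 1493696612; 1762132068;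
  1224999076; 1761869988; 1493434532; 1141506193; 1141506705; 1141506449; 1141244049; 1141244561;
  1141244305; 1140981905; 1140982417; 1140982161; 1141440657; 1141440913; 1141441169; 1140916369;
  1140916625; 1140916881; 1141178513; 1141178769; 1141179025; 1140867344; 1140998416; 1140932880;
  1140916321; 1140916833; 1140916577; 1140916385; 1140916641; 1140916897; 1140916293; 1140916805;
  1140916549; 1141178437; 1141178949; 1141178693; 1141440581; 1141441093; 1141440837; 1140916869;
  1140916357; 1140916613; 1141441157; 1141440645; 1141440901; 1141179013; 1141178501; 1141178757;
  1140883732; 1140949268; 1141014804; 1140916309; 1140916821; 1140916565; 1208025173; 1208025685;
  1208025429; 1140867348; 1140998420; 1140932884; 1208025237; 1208025493; 1208025749; 1140916373;
  1140916629; 1140916885; 1140883736; 1140949272; 1141014808; 1140916325; 1140916837; 1140916581;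
  1140916297; 1140916809; 1140916553; 1409319192; 1409384728; 1409450264; 1409352037; 1409351781;
  1409352293; 1409352265; 1409352009; 1409351753; 1677754648; 1677820184; 1677885720; 1677787749;
  1677787493; 1677787237; 1677787465; 1677787209; 1677787721; 1140867352; 1140998424; 1140932888;
  1140916361; 1140916617; 1140916873; 1140916389; 1140916645; 1140916901; 1677738264; 1677869336;
  1677803800; 1677787529; 1677787785; 1677787273; 1677787813; 1677787301; 1677787557; 1409302808;
  1409433880; 1409368344; 1409352329; 1409351817; 1409352073; 1409352101; 1409352357; 1409351845;
  1140916313; 1140916825; 1140916569; 1140916329; 1140916841; 1140916585; 1208025769; 1208025257;
  1208025513; 1141440601; 1141441113; 1141440857; 1141440617; 1141441129; 1141440873; 1208550057;
  1208549545; 1208549801; 1141178457; 1141178969; 1141178713; 1141178473; 1141178985; 1141178729;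
  1208287913; 1208287401; 1208287657; 1140916290; 1140916546; 1140916802; 1141440578; 1141440834;
  1141441090; 1141178434; 1141178690; 1141178946; 1140916306; 1140916322; 1208549538; 1141440594;
  1141440610; 1208287394; 1141178450; 1141178466; 1208025250; 1140916377; 1140916633; 1140916889;
  1208025193; 1208025705; 1208025449; 1140916905; 1140916393; 1140916649; 1141178521; 1141178777;
  1141179033; 1208287337; 1208287849; 1208287593; 1141179049; 1141178537; 1141178793; 1141440665;
  1141440921; 1141441177; 1208549481; 1208549993; 1208549737; 1141441193; 1141440681; 1141440937;
  1141178514; 1208025186; 1141178530; 1141440658; 1208287330; 1141440674; 1140916370; 1208549474;
  1140916386; 1141440642; 1141441154; 1141440898; 1140916354; 1140916866; 1140916610; 1141178498;
  1141179010; 1141178754; 1140867600; 1140933136; 1140998672; 1140981857; 1140982113; 1140982369;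
  1140981921; 1140982433; 1140982177; 1140981893; 1140982405; 1140982149; 1141506181; 1141506693;
  1141506437; 1141244037; 1141244549; 1141244293; 1140981829; 1140982085; 1140982341; 1141243973;
  1141244229; 1141244485; 1141506117; 1141506373; 1141506629; 1140867604; 1140933140; 1140998676;
  1208090773; 1208091285; 1208091029; 1140981909; 1140982421; 1140982165; 1140883988; 1141015060;
  1140949524; 1140981845; 1140982101; 1140982357; 1208090709; 1208090965; 1208091221; 1140867608;
  1140933144; 1140998680; 1140981897; 1140982409; 1140982153; 1140981925; 1140982437; 1140982181;
  1409303064; 1409368600; 1409434136; 1409417609; 1409417353; 1409417865; 1409417893; 1409417637;
  1409417381; 1677738520; 1677804056; 1677869592; 1677853321; 1677853065; 1677852809; 1677853093;
  1677852837; 1677853349; 1140883992; 1141015064; 1140949528; 1140981861; 1140982117; 1140982373;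
  1140981833; 1140982089; 1140982345; 1677754904; 1677885976; 1677820440; 1677853029; 1677853285;
  1677852773; 1677853257; 1677852745; 1677853001; 1409319448; 1409450520; 1409384984; 1409417829;
  1409417317; 1409417573; 1409417545; 1409417801; 1409417289; 1140981849; 1140982105; 1140982361;
  1208090793; 1208091305; 1208091049; 1140981865; 1140982121; 1140982377; 1141243993; 1141244249;
  1141244505; 1208352937; 1208353449; 1208353193; 1141244009; 1141244265; 1141244521; 1141506137;
  1141506393; 1141506649; 1208615081; 1208615593; 1208615337; 1141506153; 1141506409; 1141506665;
  1140981842; 1140981858; 1208615074; 1141243986; 1141244002; 1208090786; 1141506130; 1141506146;
  1208352930; 1140981826; 1140982338; 1140982082; 1141243970; 1141244482; 1141244226; 1141506114;
  1141506626; 1141506370; 1140981913; 1140982425; 1140982169; 1140981929; 1140982441; 1140982185;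
  1208090729; 1208090985; 1208091241; 1141506201; 1141506713; 1141506457; 1141506217; 1141506729;
  1141506473; 1208615017; 1208615273; 1208615529; 1141244057; 1141244569; 1141244313; 1141244073;
  1141244585; 1141244329; 1208352873; 1208353129; 1208353385; 1141506178; 1141506434; 1141506690;
  1141244034; 1141244290; 1141244546; 1140981890; 1140982146; 1140982402; 1141244050; 1208090722;
  1141244066; 1140981906; 1208615010; 1140981922; 1141506194; 1208352866; 1141506210; 1140867360;
  1140867361; 1140883745; 1140998432; 1140998433; 1140949281; 1140932896; 1140932897; 1141014817;
  1140916294; 1141964870; 1143013446; 1140916806; 1141965382; 1143013958; 1140916550; 1141965126;
  1143013702; 1140916870; 1143014022; 1141965446; 1140916358; 1143013510; 1141964934; 1140916614;
  1143013766; 1141965190; 1140883748; 1207976469; 1140883733; 1140949284; 1208107541; 1140949269;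
  1141014820; 1208042005; 1141014805; 1140867364; 1140867349; 1207992853; 1140998436; 1140998421;
  1208058389; 1140932900; 1140932885; 1208123925; 1140883752; 1140867593; 1140883749; 1140949288;
  1140998665; 1140949285; 1141014824; 1140933129; 1141014821; 1744863745; 1409303177; 1409319333;
  1744929281; 1409433737; 1409385125; 1744994817; 1409368457; 1409450149; 1677754625; 1677738569;
  1677754725; 1677820161; 1677869385; 1677820005; 1677885697; 1677803593; 1677886053; 1140867368;
  1140867365; 1140883977; 1140998440; 1140998437; 1140949513; 1140932904; 1140932901; 1141015049;
  1677738241; 1677738405; 1677755017; 1677869313; 1677869733; 1677820041; 1677803777; 1677803685;
  1677885833; 1744847361; 1409302885; 1409319497; 1744978433; 1409433701; 1409384777; 1744912897;
  1409368677; 1409450057; 1409302816; 1140867489; 1140883809; 1140949089; 1409433888; 1140998817;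
  1140932769; 1141015137; 1409368352; 1409351750; 1410400326; 1411448902; 1411449414; 1409352262;
  1410400838; 1410400582; 1411449158; 1409352006; 1409352326; 1411449478; 1410400902; 1410400390;
  1409351814; 1411448966; 1411449222; 1410400646; 1409352070; 1409319204; 1207976533; 1140883797;
  1140949077; 1409384740; 1208107349; 1208041557; 1141015125; 1409450276; 1409302820; 1140867477;
  1207992981; 1208058005; 1409433892; 1140998805; 1140932757; 1208123797; 1409368356; 1140883713;
  1140867657; 1140883813; 1140949093; 1140949249; 1140998473; 1140932681; 1141015141; 1141014785;
  1409319208; 1409303049; 1409319205; 1409384741; 1409384744; 1409434121; 1409368585; 1409450277;
  1409450280; 1476428289; 1677738633; 1677754789; 1677820581; 1476493825; 1677869193; 1677803913;
  1677885605; 1476559361; 1140867329; 1140867493; 1140884105; 1140949129; 1140998401; 1140998821;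
  1140932773; 1141014921; 1140932865; 1476411905; 1677738341; 1677754953; 1677820233; 1476542977;
  1677869157; 1677804133; 1677885513; 1476477441; 1409302824; 1409302821; 1409319433; 1409384969;
  1409433896; 1409433893; 1409368357; 1409450505; 1409368360; 1677738272; 1140867425; 1140883873;
  1140998241; 1140949665; 1677869344; 1141014689; 1677803808; 1140933217; 1677787206; 1678835782;
  1679884358; 1678836294; 1679884870; 1677787718; 1679884614; 1677787462; 1678836038; 1677787782;
  1679884934; 1678836358; 1679884422; 1678835846; 1677787270; 1678836102; 1677787526; 1679884678;
  1677754660; 1207976597; 1140883861; 1208107157; 1140949653; 1677820196; 1141014677; 1677885732;
  1208041877; 1677738276; 1140867413; 1207992917; 1140998229; 1208058197; 1677869348; 1208123477;
  1677803812; 1140933205; 1207992833; 1140867721; 1140883877; 1140998281; 1140949669; 1208058369;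
  1141014693; 1208123905; 1140933001; 1409319169; 1409303113; 1409319269; 1409433929; 1409384549;
  1409384705; 1409450597; 1409450241; 1409368137; 1677754664; 1677738505; 1677754661; 1677869577;
  1677820197; 1677820200; 1677885733; 1677885736; 1677804041; 1207976449; 1140867429; 1140884041;
  1140998245; 1140949321; 1208107521; 1141014601; 1208041985; 1140933221; 1677738280; 1677738277;
  1677754889; 1677869349; 1677820425; 1677869352; 1677885961; 1677803816; 1677803813; 1409302785;
  1409302949; 1409319561; 1409434277; 1409384585; 1409433857; 1409450377; 1409368321; 1409368229;
  1140867616; 1140867617; 1140884001; 1140933152; 1140933153; 1141015073; 1140998688; 1140998689;
  1140949537; 1140981894; 1143079046; 1142030470; 1140982406; 1143079558; 1142030982; 1140982150;
  1143079302; 1142030726; 1140981830; 1142030406; 1143078982; 1140982086; 1142030662; 1143079238;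
  1140982342; 1142030918; 1143079494; 1140867620; 1140867605; 1207992597; 1140933156; 1140933141;
  1208123669; 1140998692; 1140998677; 1208058133; 1140884004; 1207976213; 1140883989; 1141015076;
  1208041749; 1141015061; 1140949540; 1208107285; 1140949525; 1140867624; 1140867621; 1140883721;
  1140933160; 1140933157; 1141014793; 1140998696; 1140998693; 1140949257; 1744847105; 1409303141;
  1409319241; 1744912641; 1409368165; 1409450569; 1744978177; 1409433957; 1409384521; 1677738497;
  1677738661; 1677754761; 1677804033; 1677803941; 1677885577; 1677869569; 1677869221; 1677820553;
  1140884008; 1140867337; 1140884005; 1141015080; 1140932873; 1141015077; 1140949544; 1140998409;
  1140949541; 1677754881; 1677738313; 1677754981; 1677885953; 1677804105; 1677885541; 1677820417;
  1677869129; 1677820261; 1744863489; 1409302921; 1409319589; 1744994561; 1409368201; 1409450405;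
  1744929025; 1409434249; 1409384613; 1677738528; 1140867681; 1140884129; 1140932705; 1141014945;
  1677804064; 1140949153; 1677869600; 1140998497; 1677852806; 1679949958; 1678901382; 1679950470;
  1678901894; 1677853318; 1678901638; 1677853062; 1679950214; 1677852742; 1678901318; 1679949894;
  1678901574; 1679950150; 1677852998; 1679950406; 1677853254; 1678901830; 1677738532; 1140867669;
  1207992661; 1140932693; 1208123989; 1677804068; 1208057941; 1677869604; 1140998485; 1677754916;
  1207976341; 1140884117; 1208041621; 1141014933; 1677885988; 1140949141; 1677820452; 1208107669;
  1207976193; 1140867685; 1140883785; 1140932709; 1141015113; 1208041729; 1140949065; 1208107265;
  1140998501; 1409303041; 1409303205; 1409319305; 1409368485; 1409450121; 1409368577; 1409385097;
  1409434113; 1409433765; 1677738536; 1677738533; 1677754633; 1677804069; 1677885705; 1677804072;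
  1677820169; 1677869608; 1677869605; 1207992577; 1140867465; 1140884133; 1140932745; 1141014949;
  1208123649; 1140949157; 1208058113; 1140998793; 1677754920; 1677738249; 1677754917; 1677803785;
  1677885989; 1677885992; 1677820453; 1677820456; 1677869321; 1409319425; 1409302857; 1409319525;
  1409368649; 1409450085; 1409450497; 1409384805; 1409384961; 1409433673; 1409303072; 1140867745;
  1140884065; 1141014625; 1409368608; 1140933025; 1140998305; 1140949345; 1409434144; 1409417350;
  1411514502; 1410465926; 1410466438; 1409417862; 1411515014; 1411514758; 1410466182; 1409417606;
  1409417286; 1410465862; 1411514438; 1411514694; 1409417542; 1410466118; 1410466374; 1411514950;
  1409417798; 1409303076; 1140867733; 1207992725; 1208123541; 1409368612; 1140933013; 1140998293;
  1208058517; 1409434148; 1409319460; 1207976277; 1140884053; 1141014613; 1409450532; 1208042069;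
  1208107093; 1140949333; 1409384996; 1140867585; 1140867749; 1140883849; 1141014665; 1140933121;
  1140933029; 1140998309; 1140949641; 1140998657; 1409303080; 1409303077; 1409319177; 1409450249;
  1409368616; 1409368613; 1409434149; 1409384713; 1409434152; 1476411649; 1677738597; 1677754697;
  1677886025; 1476477185; 1677803621; 1677869413; 1677819977; 1476542721; 1140883969; 1140867401;
  1140884069; 1141014629; 1141015041; 1140933193; 1140998217; 1140949349; 1140949505; 1476428033;
  1677738377; 1677755045; 1677885861; 1476559105; 1677803657; 1677869705; 1677820069; 1476493569;
  1409319464; 1409302793; 1409319461; 1409450533; 1409450536; 1409368329; 1409433865; 1409384997;
  1409385000]%positive.

(** In these names and those of the lists of leaves, the digits are the parameters p, q, l, r, s, u,
    v, w. *)
Definition moves_00000000 : seq positive := [::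
  6444814374; 4304413782; 4565522450; 4565506154; 4362608645; 4565501089; 4565538817; 4565509162;
  5983737993; 4304670805; 4574417061; 4833944710; 5782407266; 4295233609; 4832928837; 4967629970;
  4363146265; 4296016977; 4297073825; 5461544981; 6582196325; 4833944705; 4296017045; 4984161345;
  4632614953; 7055102101; 4833953809; 4833944617; 4295499781; 4565500961; 4565500933; 5462071449;
  4918124645; 6871883942; 4296016969; 4565501097; 6046107657; 5931816993; 6784305185; 5461517402;
  7055102085; 4585984081; 4364175365; 5726570522; 6056874154; 6736613537; 7055102017; 4297066497;
  5931833442; 6046107813; 4389341265]%positive.

Definition leaves_00000000 : seq positive := [::
  1074021376; 1230311504; 1075122272; 1163202640; 1096093776; 1075122272; 1075122272; 1096093776;
  1230311504; 1074021376; 1075122272; 1163202640; 1163202640; 1075122272; 1075122272; 1096093776;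
  1074021376; 1230311504; 1213534288; 1150619716; 1150619728; 1213534276; 1075122244; 1075122256;
  1075122256; 1075122244; 1150619716; 1213534288; 1150619728; 1213534276; 1213534276; 1075122256;
  1075122244; 1150619716; 1075122272; 1075122272; 1091899472; 1226117200; 1074021376; 1074021376;
  1226117200; 1159008336; 1075122272; 1075122272; 1091899472; 1074021376; 1226117200; 1159008336;
  1146425424; 1083510852; 1146425412; 1209339984; 1146425412; 1209339972; 1146425424; 1083510864;
  1083510852; 1209339984; 1146425412; 1209339972; 1079316560; 1142231108; 1142231120; 1217728580;
  1079316548; 1079316560; 1217728592; 1142231108; 1142231120; 1217728580; 1079316548; 1477092368;
  1349145940; 1684690260; 1416254804; 1481286672; 1617581396; 1080710484; 1147819348; 1485480976;
  1076270116; 1079268388; 1149572132; 1146377252; 1250497556; 1177048084; 1168466964; 1091871764;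
  1229333524; 1225008148; 1091871764; 1113232404; 1108907028; 1177048084; 1686443044; 1683248164;
  1168466964; 1160012820; 1091871764; 1113232404; 1117361172; 1177048084; 1091871764; 1250497556;
  1177048084; 1613141028; 1616139300; 1233462292; 1229333524; 1091871764; 1113232404; 1177048084;
  1242043412; 1250497556; 1177048084; 1168466964; 1164338196; 1091871764; 1344705572; 1353028644;
  1347703844; 1418007588; 1409684516; 1414812708; 1414139988; 1347031124; 1477710864; 1477776400;
  1678251092; 1074271316; 1682575444; 1078595668; 1486099472; 1619597396; 1477841936; 1149835348;
  1145704532; 1615466580; 1481905168; 1142462036; 1612224084; 1485149200; 1616548436; 1480889360;
  1146786388; 1480954896; 1410897492; 1343788628; 1352243796; 1485214736; 1419352660; 1621711188;
  1151949140; 1481004048; 1485198352; 1353275732; 1420384596; 1688820052; 1476809744; 1084840276;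
  1080579400; 1416123720; 1342546948; 1619371012; 1349014856; 1147688264; 1684559176; 1078305796;
  1617450312; 1091982360; 1168479256; 1164219416; 1091982360; 1343906824; 1352229896; 1353294856;
  1611011080; 1615074312; 1612076040; 1688572936; 1684313096; 1679184904; 1420403720; 1168479256;
  1164219416; 1091982360; 1075205128; 1141515272; 1151968264; 1147442184; 1142313992; 1083794440;
  1084859400; 1229198360; 1225135128; 1091982360; 1411814408; 1410749448; 1682449416; 1686709256;
  1688839176; 1620665352; 1621730312; 1350898696; 1343640584; 1233458200; 1091982360; 1160156184;
  1091982360; 1078530120; 1419383812; 1682509896; 1678382152; 1074402376; 1415058436; 1687753732;
  1149769800; 1619531848; 1683591752; 1079611976; 1615500292; 1620613704; 1342804996; 1078563844;
  1419287112; 1352178248; 1351259140; 1146720840; 1616482888; 1346933764; 1142593096; 1411028552;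
  1343919688; 1082692612; 1074435076; 1415156296; 1617514824; 1147752776; 1682592772; 1141527556;
  1349079368; 1416188232; 1684623688; 1418351620; 1080643912; 1184174148; 1074021376; 1251283012;
  1075122280; 1075122280; 1117065284; 1117065284; 1075122280; 1074021376; 1184174148; 1251283012;
  1075122280; 1075122280; 1117065284; 1075122280; 1074021376; 1247088708; 1075122280; 1074021376;
  1179979844; 1074021376; 1075122280; 1247088708; 1112870980; 1075122280; 1179979844; 1075122280;
  1108676676; 1074021376; 1242894404; 1075122280; 1075122280; 1108676676; 1175785540; 1074021376;
  1242894404; 1075122280; 1485931092; 1679836500; 1083277652; 1150370840; 1485915160; 1150370840;
  1083279700; 1612727380; 1485915160; 1679835476; 1083278676; 1150370840; 1612726356; 1616152136;
  1076249928; 1620132888; 1620132888; 1611956808; 1620132888; 1214579272; 1749157460; 1212286548;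
  1083216928; 1083348000; 1212285524; 1749156436; 1210387016; 1083282464; 1212287572; 1620132888;
  1079396424; 1212287316; 1083266080; 1217725768; 1749158228; 1150370840; 1083278420; 1485915160;
  1612726868; 1679837268; 1485931860; 1484849236; 1208353864; 1216741448; 1484851284; 1684162132;
  1745912916; 1745913940; 1684163156; 1745911892; 1684161108; 1080393800; 1615087176; 1084589128;
  1619282504; 1610891848; 1076201544; 1150370840; 1611695444; 1080180820; 1485915160; 1684160852;
  1485915160; 1150370840; 1611694420; 1745913428; 1684161876; 1620132888; 1612988744; 1075153480;
  1617184072; 1083348000; 1216416340; 1484851796; 1218839112; 1216415316; 1083282464; 1210451528;
  1611939912; 1074104648; 1083331616; 1216416084; 1484851540; 1217790280; 1150370840; 1611695188;
  1485915160; 1080181332; 1684160596; 1745912148; 1346638884; 1149834260; 1243898900; 1348768804;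
  1142461460; 1344705572; 1146786836; 1252353044; 1745359956; 1754896980; 1746441812; 1619597396;
  1620679252; 1612224084; 1143084048; 1143018512; 1143116816; 1143051280; 1753814356; 1749686612;
  1747472980; 1755928148; 1078203416; 1082463256; 1083528216; 1212557908; 1216684628; 1213638740;
  1621451860; 1615208788; 1619338580; 1611967060; 1436914712; 1090917400; 1363416088; 1628853272;
  1082725972; 1084838996; 1359483156; 1342447892; 1145312292; 1346773268; 1636372756; 1149572132;
  1638486292; 1150637092; 1347854612; 1353273620; 1653973268; 1344819476; 1652891924; 1351160084;
  1158026276; 1093047332; 1352241428; 1348112660; 1210602068; 1214929492; 1212815700; 1216943444;
  1212815700; 1687507992; 1683248152; 1678119960; 1684313112; 1209312340; 1217765460; 1216684628;
  1212557908; 1218797908; 1616290388; 1610885460; 1612998740; 1617322068; 1767134232; 1494635544;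
  1767134232; 1698960408; 1426461720; 1361482776; 1621709908; 1613254740; 1621709908; 1611141716;
  1612222804; 1620677972; 1143120912; 1143055376; 1142989840; 1143104528; 1142973456; 1076386132;
  1084838228; 1080710484; 1079678548; 1083806292; 1219055956; 1214928212; 1210603860; 1213896276;
  1213896276; 1235833876; 1486181412; 1146528788; 1142203412; 1227379732; 1481921572; 1477858340;
  1150657556; 1231705108; 1149576212; 1476793380; 1162482708; 1482986532; 1143235604; 1092129812;
  1096455188; 1478923300; 1151689748; 1143235604; 1092129812; 1482986532; 1612206152; 1621694024;
  1621383432; 1082697992; 1683248152; 1078634760; 1687507992; 1079650568; 1686443032; 1611995400;
  1080333348; 1076270116; 1082463268; 1621661768; 1613403208; 1616449864; 1083528228; 1082463268;
  1082822984; 1074370888; 1076435528; 1083774280; 1415877656; 1074041096; 1613259016; 1411814424;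
  1079316744; 1418007576; 1620713736; 1682220036; 1686545412; 1212572676; 1145087304; 1145071176;
  1145203272; 1212260680; 1212196168; 1212312136; 1216358472; 1216422984; 1216456008; 1216439880;
  1216375368; 1149314120; 1149411656; 1149347144; 1149266504; 1213862916; 1217991684; 1216959492;
  1212830724; 1686803460; 1620447496; 1619334168; 1611011096; 1078567176; 1620399128; 1080647944;
  1610912008; 1621464088; 1080695368; 1079662664; 1082758472; 1075451208; 1082677832; 1084790856;
  1418007588; 1414812708; 1411814436; 1617434184; 1620725832; 1619693896; 1149572132; 1141249060;
  1150637092; 1612261640; 1619334168; 1620584712; 1611245832; 1616139288; 1617586440; 1613141016;
  1612190024; 1620645192; 1619613256; 1613271112; 1092624968; 1361076552; 1431589924; 1363416100;
  1360159816; 1091576136; 1360143688; 1143120900; 1178641736; 1111648840; 1111664968; 1245734472;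
  1229105480; 1094739528; 1161980488; 1209181188; 1209164804; 1209078788; 1209160708; 1209177092;
  1182837064; 1115776584; 1115792712; 1249929800; 1098934856; 1233264712; 1098950984; 1166108232;
  1143100420; 1143116804; 1646340680; 1377853768; 1646405192; 1646437448; 1109418312; 1615074340;
  1613141028; 1615074340; 1612076068; 1621464100; 1645291848; 1376821832; 1645307976; 1645356360;
  1645372488; 1754366036; 1344291412; 1217479716; 1745241672; 1344569416; 1687241764; 1485080904;
  1351697444; 1343636552; 1351697444; 1347831880; 1480722004; 1483014728; 1751450184; 1083216936;
  1083282472; 1351697444; 1346783816; 1687241764; 1083266088; 1754596680; 1217479716; 1753285716;
  1749420104; 1753284692; 1745224776; 1348618324; 1348617300; 1477476692; 1350927688; 1346732360;
  1477722184; 1217479716; 1477478484; 1348616788; 1217479716; 1687241764; 1745193288; 1347699784;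
  1351697444; 1485064776; 1344637000; 1687241764; 1753580872; 1343504456; 1487274568; 1083348008;
  1753287252; 1755710024; 1483082312; 1083282472; 1682319700; 1687507992; 1686443032; 1212555860;
  1683401300; 1414812696; 1418007576; 1076128340; 1351984468; 1353016916; 1079092240; 1079010320;
  1347854676; 1344563796; 1084335120; 1084253200; 1084232720; 1084298256; 1084380176; 1084265488;
  1351983444; 1348889172; 1610884180; 1612998228; 1079137296; 1079022608; 1617324628; 1342448724;
  1346775124; 1344562772; 1620399128; 1348888660; 1351983700; 1344563540; 1343531092; 1350903380;
  1353015380; 1351983700; 1342448980; 1613141016; 1616139288; 1619334168; 1344563540; 1347854420;
  1342450260; 1074021376; 1179992336; 1112883472; 1100300548; 1247101200; 1167409412; 1234518276;
  1074021376; 1075134752; 1163215120; 1100300560; 1112883460; 1226129680; 1175798020; 1251295492;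
  1075134760; 1146437904; 1075134752; 1075134724; 1075134736; 1146437892; 1217741072; 1075134760;
  1217741060; 1117077764; 1091911952; 1167409424; 1075134752; 1075134760; 1242906884; 1179992324;
  1230323984; 1074086176; 1233469712; 1157972240; 1116029188; 1095057680; 1178943748; 1241858308;
  1074086184; 1074086176; 1078280464; 1208303888; 1208303876; 1149583632; 1078280452; 1149583620;
  1074086184; 1145389328; 1074086148; 1145389316; 1074086184; 1074086176; 1074086160; 1216692496;
  1216692484; 1250246928; 1225081092; 1090863364; 1074021376; 1074021376; 1183138064; 1116029200;
  1157972228; 1381319696; 1112884240; 1649755152; 1365393684; 1096958228; 1633829140; 1352747284;
  1084311828; 1621182740; 1243628564; 1183941652; 1368474660; 1100039204; 1243628564; 1183941652;
  1183941652; 1636910116; 1243628564; 1096958228; 1633829140; 1365393684; 1183941652; 1636910116;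
  1243628564; 1243628564; 1183941652; 1368474660; 1100039204; 1243628564; 1183941652; 1633829140;
  1096958228; 1365393684; 1621182740; 1084311828; 1352747284; 1084311828; 1621182740; 1352747284;
  1652900880; 1384465424; 1116029968; 1097155588; 1365591044; 1634026500; 1361200392; 1629635848;
  1092764936; 1348550920; 1616986376; 1080115464; 1620132872; 1175602200; 1096844296; 1633715208;
  1083261960; 1175602200; 1175602200; 1365279752; 1351697416; 1175602200; 1096844296; 1620132872;
  1083261960; 1175602200; 1633715208; 1365279752; 1351697416; 1175602200; 1092764936; 1361200392;
  1629635848; 1092764936; 1629635848; 1361200392; 1080115464; 1616986376; 1348550920; 1080115464;
  1348550920; 1616986376; 1100301316; 1368736772; 1637172228; 1108493336; 1633715208; 1351697416;
  1620132872; 1108493336; 1365279752; 1096844296; 1083261960; 1108493336; 1621182740; 1159742484;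
  1092633620; 1352747284; 1226851348; 1084311828; 1621182740; 1092633620; 1226851348; 1352747284;
  1159742484; 1084311828; 1627735056; 1234273300; 1360348176; 1167164436; 1100055572; 1092961296;
  1101349904; 1100055572; 1636123664; 1234273300; 1167164436; 1368736784; 1621182740; 1226851348;
  1352747284; 1159742484; 1092633620; 1084311828; 1182893320; 1250002184; 1115784456; 1250002184;
  1182893320; 1115784456; 1107641348; 1233224968; 1099007240; 1378173956; 1166116104; 1645560836;
  1118127108; 1099007240; 1166116104; 1385513988; 1233224968; 1652900868; 1115784456; 1250002184;
  1182893320; 1653735688; 1385300232; 1116864776; 1385300232; 1653735688; 1116864776; 1074086944;
  1074086952; 1082475552; 1082475560; 1116864776; 1653735688; 1385300232; 1080115464; 1091716120;
  1225933848; 1348550920; 1616986376; 1158824984; 1612006404; 1351697416; 1620132872; 1342522372;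
  1083261960; 1076184068; 1619346436; 1083261960; 1620132872; 1083524100; 1353008132; 1351697416;
  1616986376; 1225933848; 1091716120; 1348550920; 1158824984; 1080115464; 1100087560; 1636958472;
  1368523016; 1074086944; 1074086952; 1082475560; 1082475552; 1368523016; 1636958472; 1100087560;
  1612006416; 1616021780; 1076184080; 1347586324; 1079150868; 1342522384; 1079150868; 1083524112;
  1619346448; 1347586324; 1616021780; 1353008144; 1074021376; 1074021376; 1615921432; 1347485976;
  1079050520; 1079050520; 1347485976; 1615921432; 1615921432; 1347485976; 1079050520; 1079050520;
  1347485976; 1615921432; 1079050520; 1615921432; 1347485976; 1636910116; 1100039204; 1368474660;
  1343374372; 1611809828; 1074938916; 1611809828; 1343374372; 1074938916; 1368474660; 1100039204;
  1636910116; 1368474660; 1636910116; 1100039204; 1116816420; 1653687332; 1385251876; 1611809828;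
  1343374372; 1074938916; 1611809828; 1074938916; 1343374372; 1653687332; 1385251876; 1116816420;
  1213219864; 1079002136; 1146111000; 1079002136; 1213219864; 1146111000; 1079002136; 1213219864;
  1146111000; 1146111000; 1079002136; 1213219864]%positive.

Definition moves_00000001 : seq positive := [::
  6452942945; 4304426025; 4296037409; 4362606745; 4296049729; 4565509141; 4564460697; 5512898689;
  5782373445; 4565501089; 4296053785; 4565805193; 4297091081; 7114605633; 4901054489; 4568946709;
  4429715457; 5776627857; 4833978465; 4296016977; 4296016969; 4833953945; 4363126949; 4296038485;
  4836595881; 6062379073; 4631566473; 4363135125; 6044540969; 6044541081; 4296017045; 5781866601;
  4656205889; 4564456465; 4446261385; 4564456485; 6044536865; 4318336129; 4836595849; 4991787161;
  4651751445; 6871336005; 4652570705; 5731559561]%positive.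

Definition leaves_00000001 : seq positive := [::
  1074021376; 1230311504; 1075122272; 1163202640; 1096093776; 1075122272; 1075122272; 1096093776;
  1230311504; 1074021376; 1075122272; 1163202640; 1163202640; 1075122272; 1075122272; 1096093776;
  1074021376; 1230311504; 1213534288; 1150619716; 1150619728; 1213534276; 1075122244; 1075122256;
  1075122256; 1075122244; 1150619716; 1213534288; 1150619728; 1213534276; 1213534276; 1150619728;
  1075122256; 1075122244; 1213534288; 1150619716; 1247088720; 1167396932; 1175785552; 1226117188;
  1096093764; 1117065296; 1117065296; 1096093764; 1167396932; 1247088720; 1175785552; 1226117188;
  1226117188; 1175785552; 1117065296; 1096093764; 1247088720; 1167396932; 1184174148; 1074021376;
  1251283012; 1075122280; 1075122280; 1117065284; 1117065284; 1075122280; 1074021376; 1184174148;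
  1251283012; 1075122280; 1075122280; 1251283012; 1117065284; 1075122280; 1184174148; 1074021376;
  1247088708; 1075122280; 1112870980; 1075122280; 1074021376; 1179979844; 1179979844; 1074021376;
  1075122280; 1247088708; 1112870980; 1075122280; 1075122280; 1112870980; 1179979844; 1074021376;
  1247088708; 1075122280]%positive.

Definition moves_00000010 : seq positive := [::
  6443526309; 4296049749; 4363125801; 4297065626; 4296026281; 4296038401; 4296037413; 4296053909;
  4564460617; 4296050769; 4565501026; 4296018021; 6711953481; 4565509126; 4296058881; 4833944726;
  5773501474; 4565518470; 4968179786; 4296016929; 4312810629; 4379927625; 4296016993; 4296017049;
  4296016937; 4296016985; 4296016965; 4832896017; 6795847809; 4296017045; 5504010373; 4296017065;
  4296016917; 4312819713; 4296054785; 4296016921; 4296016933; 4363126793; 4296034305; 4296016969;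
  4296016905; 4296017061; 4296026113; 4296050689; 4296016901; 4363126885; 4296054857; 4582316050;
  4296016913; 4363126865; 4312802385; 4296016981; 5722122249; 4582310950; 4296038553; 4582315114;
  4900005913; 4296016997; 4296050833; 4296026217; 4296017041; 4296026197; 4312803337; 4363126945]%positive.

Definition leaves_00000010 : seq positive := [::
  1075122272; 1234505793; 1075122280; 1167396929; 1100288065; 1075122280; 1075122280; 1100288065;
  1234505793; 1075122272; 1075122280; 1167396929; 1167396929; 1075122280; 1075122280; 1100288065;
  1075122272; 1234505793; 1217728577; 1146425425; 1217728593; 1075122257; 1075122241; 1075122241;
  1075122257; 1146425425; 1146425409; 1217728593; 1217728593; 1146425409; 1075122241; 1075122257;
  1146425425; 1075122280; 1230311521; 1074021376; 1163202657; 1096093793; 1074021376; 1074021376;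
  1096093793; 1230311521; 1075122280; 1074021376; 1163202657; 1163202657; 1074021376; 1074021376;
  1096093793; 1075122280; 1230311521; 1213534305; 1150619717; 1213534277; 1075122245; 1075122273;
  1075122273; 1075122245; 1150619717; 1213534305; 1150619745; 1213534277; 1213534277; 1075122273;
  1075122245; 1150619717; 1251283009; 1163202641; 1175785537; 1226117201; 1100288081; 1112870977;
  1112870977; 1100288081; 1163202641; 1251283009; 1175785537; 1226117201; 1226117201; 1175785537;
  1112870977; 1100288081; 1251283009; 1163202641; 1179979857; 1075122272; 1074021376; 1074021376;
  1112870993; 1112870993; 1074021376; 1075122272; 1247088721; 1074021376; 1074021376; 1112870993;
  1074021376; 1075122272; 1247088737; 1167396933; 1175785569; 1226117189; 1096093765; 1117065313;
  1117065313; 1096093765; 1167396933; 1247088737; 1175785569; 1226117189; 1226117189; 1175785569;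
  1117065313; 1096093765; 1247088737; 1167396933; 1184174149; 1075122280; 1075122272; 1075122272;
  1117065285; 1117065285; 1075122272; 1075122280; 1184174149; 1075122272; 1075122272; 1117065285;
  1075122272; 1075122280; 1108676693; 1091899477; 1091899477; 1091899477; 1108676693; 1091899477;
  1091899477; 1091899477; 1108676693; 1091899493; 1628770405; 1360334949; 1360334949; 1091899493;
  1628770405; 1628770405; 1360334949; 1091899493; 1620318309; 1075122277; 1347818597; 1347818597;
  1620318309; 1075122277; 1347818597; 1620318309; 1075122249; 1347818569; 1620318281; 1620318281;
  1075122249; 1347818569; 1347818569; 1620318281; 1075122249; 1377112137; 1645547593; 1108676681;
  1108676681; 1377112137; 1645547593; 1108676681; 1377112137; 1076236373; 1109790805; 1109790805;
  1109790805; 1076236373; 1109790805; 1109790805; 1109790805; 1076236373; 1075122280; 1230311521;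
  1074021376; 1163202657; 1096093793; 1074021376; 1074021376; 1096093793; 1230311521; 1075122280;
  1074021376; 1163202657; 1163202657; 1074021376; 1074021376; 1096093793; 1075122280; 1230311521;
  1213534305; 1150619717; 1150619745; 1213534277; 1075122245; 1075122273; 1075122273; 1075122245;
  1150619717; 1213534305; 1150619745; 1213534277; 1213534277; 1150619745; 1075122273; 1075122245;
  1213534305; 1150619717; 1247088737; 1167396933; 1175785569; 1226117189; 1096093765; 1117065313;
  1117065313; 1096093765; 1167396933; 1247088737; 1175785569; 1226117189; 1226117189; 1175785569;
  1117065313; 1096093765; 1247088737; 1167396933; 1184174149; 1075122280; 1251283013; 1075122272;
  1075122272; 1117065285; 1117065285; 1075122272; 1075122280; 1184174149; 1251283013; 1075122272;
  1075122272; 1251283013; 1117065285; 1075122272; 1184174149; 1075122280]%positive.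

Definition moves_00001000 : seq positive := [::
  4304442449; 4564493377; 4296049825; 4565509141; 4368393221; 4363146305; 4296053925; 4832892033;
  4565510294; 6984566866; 4565500937; 4564460545; 4565522474; 4572861505; 4296050838; 5777696850;
  4301269062; 4296017962; 6046115990; 4372564002; 4833944581; 5781874730; 4565500961; 4296016997;
  4296016905; 4296016969; 4312810569; 4296017033; 4296017045; 4296017061; 4833944609; 4321216534;
  4833944645; 4565501097; 4564456485; 7118799905; 4451231826; 4297073681; 4833944649; 6872410258;
  4565500929; 4832896161; 4296017001; 4565501073; 4565501081; 4992312345; 7140807713; 4564456465;
  4833944585; 5982143573; 4582279334; 5994752038; 4318070922; 6805297250; 6868182161; 6067082241;
  4452279457; 5526004825; 4916795522; 6602884261; 6985634817; 7072684166; 5773493273; 4993356953;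
  4388309002; 6531613857; 6846178405]%positive.

Definition leaves_00001000 : seq positive := [::
  1074021376; 1230311504; 1075122272; 1163202640; 1096093776; 1075122272; 1075122272; 1096093776;
  1230311504; 1074021376; 1075122272; 1163202640; 1163202640; 1075122272; 1075122272; 1096093776;
  1074021376; 1230311504; 1213534288; 1150619716; 1150619728; 1213534276; 1075122244; 1075122256;
  1075122256; 1075122244; 1150619716; 1213534288; 1150619728; 1213534276; 1213534276; 1150619728;
  1075122256; 1075122244; 1213534288; 1150619716; 1184174148; 1074021376; 1251283012; 1075122280;
  1075122280; 1117065284; 1075122280; 1074021376; 1184174148; 1251283012; 1075122280; 1075122280;
  1251283012; 1117065284; 1075122280; 1184174148; 1074021376; 1074021376; 1175798032; 1108689168;
  1096106244; 1242906896; 1163215108; 1230323972; 1074021376; 1075134752; 1159020816; 1096106256;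
  1108689156; 1234518288; 1184186628; 1247101188; 1075134760; 1142243600; 1075134752; 1083523332;
  1083523344; 1142243588; 1213546768; 1075134760; 1213546756; 1075134752; 1167409424; 1091911952;
  1117077764; 1230323984; 1179992324; 1242906884; 1075134760; 1075134752; 1150632208; 1079329040;
  1079329028; 1209352464; 1150632196; 1209352452; 1075134760; 1075134736; 1075134724; 1075134752;
  1146437904; 1217741060; 1075134760; 1217741072; 1146437892; 1112883472; 1100300548; 1074021376;
  1179992336; 1234518276; 1074021376; 1247101200; 1167409412; 1074021376; 1078218848; 1078218848;
  1078218848; 1074021376; 1078218848; 1078218848; 1078218848; 1074021376; 1632915536; 1364480080;
  1096044624; 1096044624; 1632915536; 1364480080; 1364480080; 1096044624; 1632915536; 1616138320;
  1350848592; 1078218832; 1616138320; 1078218832; 1616138320; 1348751428; 1350848580; 1078218820;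
  1078218820; 1348751428; 1350848580; 1350848580; 1078218820; 1348751428; 1683513616; 1684578576;
  1079005472; 1079050520; 1347485976; 1615921432; 1347485976; 1079050520; 1615921432; 1079054624;
  1146642704; 1147707664; 1683513616; 1074021376; 1074021376; 1347485976; 1079050520; 1615921432;
  1347485976; 1079050520; 1615921432; 1615921432; 1347485976; 1079050520; 1074021376; 1074021376;
  1615921432; 1079050520; 1347485976; 1074021376; 1074021376; 1347707140; 1351639300; 1351688452;
  1351786756; 1079009540; 1382305860; 1650741316; 1113870404; 1113870404; 1382305860; 1650741316;
  1113870404; 1382305860; 1074021376; 1078218856; 1078218856; 1078218856; 1074021376; 1078218856;
  1078218856; 1078218856; 1074021376; 1079152936; 1481703716; 1750139172; 1213268260; 1079005480;
  1750139172; 1481703716; 1213268260; 1079054632; 1750139172; 1481703716; 1213268260; 1074021376;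
  1074021376; 1649475876; 1649475876; 1649475876; 1095827748; 1364263204; 1632698660; 1074021376;
  1074021376; 1112604964; 1381040420; 1649475876; 1632698660; 1095827748; 1364263204; 1074021376;
  1074021376]%positive.

Definition moves_00001001 : seq positive := [::
  6448780329; 4296049749; 4304446465; 4565509285; 4632642597; 4368401577; 4565500965; 4296053857;
  4368368649; 4833944597; 5773493393; 6578787497; 4565517417; 4431287365; 4368409609; 5781890133;
  5777695881; 6046106793; 6984565761; 4972352545; 4572861525; 7119832085; 4296017033; 4296017025;
  4296016929; 4296016965; 4296017001; 4833944705; 4296017041; 4582319145; 4296016921; 4296017061;
  6532637701; 6737122441; 4565500929; 4296016981; 5994710113; 4384134305; 4833944609; 5793387673;
  4296017045; 6061818921; 4296016917; 4296017065; 5530207369; 4564456481; 4297073681; 4305478657;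
  4833944741; 7136642053; 4296016985; 4312802373; 6602888321; 4296016937; 4296016997; 4305454081;
  4296017029; 4589622417; 4565501093; 4296016905; 4296017049; 5524956249; 4582298757; 4565501017;
  6800020521; 4305454117; 4296016969]%positive.

Definition leaves_00001001 : seq positive := [::
  1074021376; 1230311504; 1075122272; 1163202640; 1096093776; 1075122272; 1075122272; 1096093776;
  1230311504; 1074021376; 1075122272; 1163202640; 1163202640; 1075122272; 1075122272; 1096093776;
  1074021376; 1230311504; 1213534288; 1150619716; 1150619728; 1213534276; 1075122244; 1075122256;
  1075122256; 1075122244; 1150619716; 1213534288; 1150619728; 1213534276; 1213534276; 1150619728;
  1075122256; 1075122244; 1213534288; 1150619716; 1184174148; 1074021376; 1251283012; 1075122280;
  1075122280; 1117065284; 1117065284; 1075122280; 1074021376; 1184174148; 1251283012; 1075122280;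
  1075122280; 1251283012; 1117065284; 1075122280; 1184174148; 1074021376; 1385300232; 1653735688;
  1116864776; 1074086944; 1074086952; 1115750676; 1115750676; 1115750676; 1074021376; 1078218848;
  1078218848; 1078218848; 1074021376; 1078218848; 1078218848; 1078218848; 1074021376; 1632915536;
  1364480080; 1096044624; 1096044624; 1632915536; 1364480080; 1364480080; 1096044624; 1632915536;
  1616138320; 1350848592; 1078218832; 1078218832; 1616138320; 1350848592; 1350848592; 1078218832;
  1616138320; 1348751428; 1350848580; 1078218820; 1078218820; 1348751428; 1350848580; 1350848580;
  1078218820; 1348751428; 1363281172; 1364263176; 1632698632; 1082410024; 1082410016; 1094845716;
  1631716628; 1095827720; 1382305860; 1650741316; 1113870404; 1113870404; 1382305860; 1650741316;
  1650741316; 1113870404; 1382305860; 1074021376; 1078218856; 1078218856; 1078218856; 1074021376;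
  1078218856; 1078218856; 1078218856; 1074021376]%positive.

Definition moves_00001010 : seq positive := [::
  6444574886; 4296049749; 4363133993; 4297087010; 4296053929; 4296037505; 4565538854; 4296025125;
  4565506114; 6711936129; 4632610970; 4565510246; 4564460645; 4565522578; 4430271649; 4364175498;
  4565542950; 4565534758; 4565526594; 4832892053; 5504009381; 4699736162; 6040847377; 4565502090;
  4379935833; 4313860098; 4296016981; 6795830369; 6057645217; 4296017061; 4296017045; 4296016917;
  4296016937; 4296017049; 4296017029; 4296017001; 4296016969; 4296016921; 4582320266; 4582279338;
  4296016929; 4296016901; 4296017041; 4296016965; 4296016905; 4312802373; 4296017065; 4312814613;
  4312798297; 4296016997; 4312818689; 4296016933; 4582316118; 4582295634; 4296016985; 4832896017;
  4296041473]%positive.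

Definition leaves_00001010 : seq positive := [::
  1075122272; 1234505793; 1075122280; 1167396929; 1100288065; 1075122280; 1075122280; 1100288065;
  1234505793; 1075122272; 1075122280; 1167396929; 1167396929; 1075122280; 1075122280; 1100288065;
  1075122272; 1234505793; 1146425425; 1146425409; 1217728593; 1075122257; 1075122241; 1075122257;
  1146425425; 1217728577; 1217728593; 1217728593; 1075122241; 1075122257; 1217728577; 1146425425;
  1075122280; 1230311521; 1074021376; 1163202657; 1096093793; 1074021376; 1074021376; 1096093793;
  1230311521; 1075122280; 1074021376; 1163202657; 1163202657; 1074021376; 1074021376; 1096093793;
  1075122280; 1230311521; 1150619717; 1213534277; 1075122245; 1075122273; 1075122245; 1150619717;
  1213534305; 1213534277; 1213534277; 1075122273; 1075122245; 1213534305; 1150619717; 1251283009;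
  1163202641; 1175785537; 1226117201; 1100288081; 1112870977; 1112870977; 1100288081; 1163202641;
  1251283009; 1175785537; 1226117201; 1226117201; 1175785537; 1112870977; 1100288081; 1251283009;
  1163202641; 1179979857; 1075122272; 1247088721; 1074021376; 1074021376; 1112870993; 1112870993;
  1074021376; 1075122272; 1074021376; 1074021376; 1112870993; 1074021376; 1075122272; 1247088737;
  1167396933; 1175785569; 1226117189; 1096093765; 1117065313; 1117065313; 1096093765; 1167396933;
  1247088737; 1175785569; 1226117189; 1226117189; 1175785569; 1117065313; 1096093765; 1247088737;
  1167396933; 1075122280; 1075122272; 1075122272; 1117065285; 1117065285; 1075122272; 1075122280;
  1184174149; 1075122272; 1075122272; 1117065285; 1075122272; 1184174149; 1075122280; 1108676693;
  1091899477; 1091899477; 1091899477; 1108676693; 1091899477; 1091899477; 1091899477; 1108676693;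
  1091899493; 1628770405; 1360334949; 1360334949; 1091899493; 1628770405; 1628770405; 1360334949;
  1091899493; 1075122277; 1347818597; 1347818597; 1620318309; 1075122277; 1075122277; 1620318309;
  1075122249; 1347818569; 1620318281; 1620318281; 1075122249; 1347818569; 1347818569; 1620318281;
  1075122249; 1645547593; 1108676681; 1108676681; 1377112137; 1645547593; 1645547593; 1377112137;
  1076236373; 1109790805; 1109790805; 1109790805; 1076236373; 1109790805; 1109790805; 1109790805;
  1076236373; 1075122280; 1230311521; 1074021376; 1163202657; 1096093793; 1074021376; 1074021376;
  1096093793; 1230311521; 1075122280; 1074021376; 1163202657; 1163202657; 1074021376; 1074021376;
  1096093793; 1075122280; 1230311521; 1213534305; 1150619717; 1150619745; 1213534277; 1075122245;
  1075122273; 1075122273; 1075122245; 1150619717; 1213534305; 1150619745; 1213534277; 1213534277;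
  1150619745; 1075122273; 1075122245; 1213534305; 1150619717; 1247088737; 1167396933; 1175785569;
  1226117189; 1096093765; 1117065313; 1117065313; 1096093765; 1167396933; 1247088737; 1175785569;
  1226117189; 1226117189; 1175785569; 1117065313; 1096093765; 1247088737; 1167396933; 1184174149;
  1075122280; 1251283013; 1075122272; 1075122272; 1117065285; 1117065285; 1075122272; 1075122280;
  1184174149; 1251283013; 1075122272; 1075122272; 1251283013; 1117065285; 1075122272; 1184174149;
  1075122280]%positive.

Definition moves_00010000 : seq positive := [::
  6443526310; 4296049749; 4363125801; 4297065626; 4296026282; 4296038402; 4296037413; 4296053909;
  4564460617; 4296050770; 4565501026; 4296018022; 6711953482; 4565509126; 4296058882; 4833944726;
  5773501474; 4565518469; 4968179785; 4312811606; 4296017025; 4296016985; 4296016921; 4296016901;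
  7065323657; 4296017041; 4296016929; 6594521170; 4296017065; 4833953825; 4296016905; 4296017061;
  4296016981; 4296017033; 4296017049; 4296016933; 6862951525; 4832896017; 4296016965; 4296017029;
  4833970209; 4296017001; 5520794665; 4296016937; 4296017045; 4296016997; 4632610825; 4582278186;
  4632610885; 4833953941; 4296016917; 4565534721; 4296016969; 4312799366; 4833953961; 4632614921;
  4312832082; 4312803482; 4312819786; 4312835161; 4565518501; 4833970281; 4296016913; 4565534761]%positive.

Definition leaves_00010000 : seq positive := [::
  1230377057; 1075122280; 1074021376; 1163268193; 1074021376; 1096159329; 1146425425; 1209405537;
  1150685281; 1217728593; 1075122257; 1074021376; 1159008353; 1074021376; 1091899489; 1226117217;
  1075122280; 1075122280; 1226117217; 1159008353; 1074021376; 1074021376; 1091899489; 1091899489;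
  1074021376; 1075122280; 1226117217; 1074021376; 1159008353; 1142231137; 1213599825; 1075187793;
  1150685265; 1217728609; 1217728609; 1150685265; 1213599825; 1142231137; 1079316577; 1075187793;
  1075187793; 1217728609; 1150685265; 1213599825; 1175851105; 1230311505; 1091899473; 1112936545;
  1251348577; 1167396945; 1167396945; 1251348577; 1175851105; 1230311505; 1112936545; 1091899473;
  1175785569; 1230377041; 1117065313; 1100353617; 1159073873; 1247088737; 1247088737; 1159073873;
  1230377041; 1175785569; 1117065313; 1100353617; 1100353617; 1117065313; 1247088737; 1159073873;
  1175785569; 1230377041; 1247154257; 1074021376; 1074021376; 1075122272; 1180045393; 1180045393;
  1075122272; 1074021376; 1247154257; 1112936529; 1074021376; 1074021376; 1180045393; 1075122272;
  1074021376; 1074021376; 1167409441; 1096106273; 1112949009; 1226129697; 1184252177; 1242972433;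
  1074021376; 1075856384; 1150632225; 1083523361; 1075200273; 1217741089; 1142309137; 1209418001;
  1075856384; 1184186657; 1075134760; 1100366097; 1108689185; 1163280657; 1247101217; 1075134752;
  1226195217; 1615921432; 1079071008; 1347485976; 1079050520; 1615921432; 1078989088; 1347485976;
  1079050520; 1347485976; 1615921432; 1078989088; 1079050520; 1078218848; 1078218848; 1615921432;
  1079050520; 1347485976; 1079152928; 1079152928; 1347485976; 1079050520; 1079021856; 1615921432;
  1078218848; 1078218848; 1615921432; 1347485976; 1079050520; 1078989088; 1078989088; 1481703716;
  1078989096; 1213268260; 1750139172; 1683030308; 1146159396; 1079071016; 1414594852; 1414594852;
  1146159396; 1683030308; 1079071016; 1078218856; 1078218856; 1078989096; 1078989096; 1632698660;
  1095827748; 1364263204; 1213268260; 1750139172; 1079071016; 1481703716; 1078218856; 1078218856;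
  1079152936; 1079152936; 1364263204; 1095827748; 1632698660; 1075122280; 1159008353; 1074021376;
  1091899489; 1217728609; 1213599825; 1142231137; 1075187793; 1159073873; 1175785569; 1117065313;
  1100353617; 1117065313; 1247088737; 1159073873; 1230377041; 1075122272; 1247154257; 1112936529;
  1074021376; 1112936529; 1180045393; 1075122272; 1074021376]%positive.

Definition moves_00010001 : seq positive := [::
  6444574885; 4296049749; 4363133993; 4297087009; 4296053929; 4296037505; 4565538853; 4296025125;
  4565506113; 6711936129; 4632610969; 4565510245; 4564460645; 4565522577; 4430271649; 4364175497;
  4565542949; 4565534757; 4565526593; 4832892053; 5504009381; 4699736161; 6040847377; 4565502089;
  4296016997; 4296017061; 4296016977; 4582295573; 4296016929; 4296017049; 4296017041; 4296016921;
  4312818721; 5789226121; 4296016917; 4565501953; 4296016937; 4833953825; 4296017001; 4312798377;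
  4632610825; 4296017033; 4565518337; 4296016965; 4564456481; 4649392229; 4833970209; 4296016905;
  4296016913; 4312831001; 4296016969; 4296017029; 4582316161; 4296017065; 4312826881; 4296016985;
  4582320273; 4296017045; 4312835097; 4296016933; 4833970265; 5991598161; 4296041473; 4565534721;
  4296016981; 4833970281; 4632614921; 4312794149; 4565534761]%positive.

Definition leaves_00010001 : seq positive := [::
  1074021376; 1159008353; 1074021376; 1091899489; 1226117217; 1075122280; 1075122280; 1226117217;
  1159008353; 1074021376; 1074021376; 1091899489; 1091899489; 1074021376; 1075122280; 1226117217;
  1074021376; 1159008353; 1142231137; 1213599825; 1079316577; 1075187793; 1150685265; 1217728609;
  1217728609; 1150685265; 1213599825; 1142231137; 1079316577; 1075187793; 1075187793; 1079316577;
  1217728609; 1150685265; 1142231137; 1213599825; 1175785569; 1230377041; 1117065313; 1100353617;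
  1159073873; 1247088737; 1247088737; 1159073873; 1230377041; 1175785569; 1117065313; 1100353617;
  1100353617; 1117065313; 1247088737; 1159073873; 1175785569; 1230377041; 1247154257; 1074021376;
  1112936529; 1074021376; 1075122272; 1180045393; 1180045393; 1075122272; 1074021376; 1247154257;
  1112936529; 1074021376; 1074021376; 1112936529; 1180045393; 1075122272; 1247154257; 1074021376;
  1074021376; 1159008353; 1074021376; 1091899489; 1226117217; 1075122280; 1075122280; 1226117217;
  1159008353; 1074021376; 1074021376; 1091899489; 1091899489; 1074021376; 1075122280; 1226117217;
  1074021376; 1159008353; 1142231137; 1213599825; 1079316577; 1075187793; 1150685265; 1217728609;
  1217728609; 1150685265; 1213599825; 1142231137; 1079316577; 1075187793; 1075187793; 1079316577;
  1217728609; 1150685265; 1142231137; 1213599825; 1175785569; 1230377041; 1117065313; 1100353617;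
  1159073873; 1247088737; 1247088737; 1159073873; 1230377041; 1175785569; 1117065313; 1100353617;
  1100353617; 1117065313; 1247088737; 1159073873; 1175785569; 1230377041; 1247154257; 1074021376;
  1112936529; 1074021376; 1075122272; 1180045393; 1180045393; 1075122272; 1074021376; 1247154257;
  1112936529; 1074021376; 1074021376; 1112936529; 1180045393; 1075122272; 1247154257; 1074021376]%positive.

Definition moves_00010010 : seq positive := [::
  6444573862; 4296049749; 4363125801; 4297065482; 4564460581; 4296041545; 6577759365; 4565509286;
  4296053845; 6711968921; 4430234721; 4565501058; 5772452933; 7114609801; 4833944602; 4968158214;
  4431287322; 4564472905; 6847218790; 5504009297; 7115658250; 4296017025; 4296016977; 4296017045;
  4296016997; 4296016933; 4296017049; 4296016981; 4296016929; 4296016917; 4312794281; 4582310930;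
  4296016969; 4296017061; 4296016985; 4296017041; 4296017001; 4296016965; 4296016937; 4296016913;
  4582315142; 4832896017; 6527390849; 5772453029; 4296016901; 4582294634; 4582286442; 4564456481;
  4296017065; 4296016921; 4582278306; 6862951553; 6057657349; 4296016905; 4296017029; 4296017033]%positive.

Definition leaves_00010010 : seq positive := [::
  1075122272; 1096159312; 1074021376; 1230377040; 1163268176; 1075122272; 1075122272; 1163268176;
  1096159312; 1075122272; 1074021376; 1230377040; 1230377040; 1074021376; 1075122272; 1163268176;
  1075122272; 1096159312; 1075187781; 1146490949; 1217794117; 1217794117; 1075187781; 1209405520;
  1146490949; 1146490949; 1209405520; 1150685264; 1217794117; 1075187781; 1075122280; 1159073857;
  1075122280; 1091964993; 1226182721; 1075122272; 1075122272; 1226182721; 1159073857; 1075122280;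
  1075122280; 1091964993; 1091964993; 1075122280; 1075122272; 1226182721; 1075122280; 1159073857;
  1142296641; 1213534276; 1075122244; 1150619716; 1150619716; 1213534276; 1142296641; 1079382081;
  1075122244; 1075122244; 1079382081; 1217794113; 1150619716; 1213534276; 1112936528; 1091964997;
  1251348560; 1167462469; 1230377029; 1175851088; 1175851088; 1230377029; 1091964997; 1112936528;
  1251348560; 1167462469; 1167462469; 1251348560; 1175851088; 1230377029; 1112936528; 1091964997;
  1075122272; 1075122280; 1075122272; 1242959941; 1075122272; 1075122272; 1175851077; 1075122280;
  1075122280; 1175851077; 1242959941; 1075122272; 1108742213; 1075122272; 1175851073; 1230311492;
  1117130817; 1100288068; 1159008324; 1247154241; 1247154241; 1159008324; 1230311492; 1175851073;
  1117130817; 1100288068; 1100288068; 1117130817; 1247154241; 1159008324; 1175851073; 1230311492;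
  1247088708; 1075122280; 1075122280; 1074021376; 1179979844; 1179979844; 1074021376; 1075122280;
  1247088708; 1112870980; 1075122280; 1075122280; 1112870980; 1179979844; 1074021376; 1075122280;
  1075122280; 1159073857; 1075122280; 1091964993; 1226182721; 1075122272; 1075122272; 1226182721;
  1159073857; 1075122280; 1075122280; 1091964993; 1091964993; 1075122280; 1075122272; 1226182721;
  1075122280; 1159073857; 1142296641; 1213534276; 1079382081; 1075122244; 1150619716; 1217794113;
  1217794113; 1150619716; 1213534276; 1142296641; 1079382081; 1075122244; 1075122244; 1079382081;
  1217794113; 1150619716; 1142296641; 1213534276; 1175851073; 1230311492; 1117130817; 1100288068;
  1159008324; 1247154241; 1247154241; 1159008324; 1230311492; 1175851073; 1117130817; 1100288068;
  1100288068; 1117130817; 1247154241; 1159008324; 1175851073; 1230311492; 1247088708; 1075122280;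
  1112870980; 1075122280; 1074021376; 1179979844; 1179979844; 1074021376; 1075122280; 1247088708;
  1112870980; 1075122280; 1075122280; 1112870980; 1179979844; 1074021376; 1247088708; 1075122280]%positive.

Definition moves_00010011 : seq positive := [::
  6443525285; 4296049793; 4363125841; 4832891921; 4296037505; 4296053861; 4430234777; 4296025257;
  7114609733; 5772444821; 4296058025; 4967109801; 4698678409; 4296041505; 4564460609; 6577734825;
  6711940233; 5504013441; 6846174249; 6846178373; 5504009385; 4564468777; 6040884357; 5772452897;
  4296017025; 4296016977; 4849665041; 6527419561; 5453669529; 4296017041; 4296016985; 4296017065;
  4296017033; 4296016929; 4296016965; 4296016933; 4983882773; 4363146385; 4296016921; 4312827017;
  4312835173; 4296017061; 4312794241; 4296016969; 4296017049; 4296016997; 4296017029; 4312798361;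
  4296017001; 4296016937; 4296016901; 4296016917; 4312810661; 4312802437; 6862951425; 4296016981;
  4564456481; 4312831009; 4296016913; 6594520073; 4296017045; 4312814757]%positive.

Definition leaves_00010011 : seq positive := [::
  1075122272; 1096159312; 1074021376; 1230377040; 1163268176; 1075122272; 1075122272; 1163268176;
  1096159312; 1075122272; 1074021376; 1230377040; 1230377040; 1074021376; 1075122272; 1163268176;
  1075122272; 1096159312; 1079382096; 1075187781; 1209405520; 1146490949; 1217794117; 1150685264;
  1150685264; 1217794117; 1075187781; 1079382096; 1209405520; 1146490949; 1146490949; 1209405520;
  1150685264; 1217794117; 1079382096; 1075187781; 1075122280; 1159073857; 1075122280; 1091964993;
  1226182721; 1075122272; 1075122272; 1226182721; 1159073857; 1075122280; 1075122280; 1091964993;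
  1091964993; 1075122280; 1075122272; 1226182721; 1075122280; 1159073857; 1142296641; 1213534276;
  1079382081; 1075122244; 1150619716; 1217794113; 1217794113; 1150619716; 1213534276; 1142296641;
  1079382081; 1075122244; 1075122244; 1079382081; 1217794113; 1150619716; 1142296641; 1213534276;
  1112936528; 1091964997; 1251348560; 1167462469; 1230377029; 1175851088; 1175851088; 1230377029;
  1091964997; 1112936528; 1251348560; 1167462469; 1167462469; 1251348560; 1175851088; 1230377029;
  1112936528; 1091964997; 1108742213; 1075122272; 1175851077; 1075122280; 1075122272; 1242959941;
  1242959941; 1075122272; 1075122272; 1108742213; 1175851077; 1075122280; 1075122280; 1175851077;
  1242959941; 1075122272; 1108742213; 1075122272; 1175851073; 1230311492; 1117130817; 1100288068;
  1159008324; 1247154241; 1247154241; 1159008324; 1230311492; 1175851073; 1117130817; 1100288068;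
  1100288068; 1117130817; 1247154241; 1159008324; 1175851073; 1230311492; 1247088708; 1075122280;
  1112870980; 1075122280; 1074021376; 1179979844; 1179979844; 1074021376; 1075122280; 1247088708;
  1112870980; 1075122280; 1075122280; 1112870980; 1179979844; 1074021376; 1247088708; 1075122280;
  1075122280; 1159073857; 1075122280; 1091964993; 1226182721; 1075122272; 1075122272; 1226182721;
  1159073857; 1075122280; 1075122280; 1091964993; 1091964993; 1075122280; 1075122272; 1226182721;
  1075122280; 1159073857; 1142296641; 1213534276; 1079382081; 1075122244; 1150619716; 1217794113;
  1217794113; 1150619716; 1213534276; 1142296641; 1079382081; 1075122244; 1075122244; 1079382081;
  1217794113; 1150619716; 1142296641; 1213534276; 1175851073; 1230311492; 1117130817; 1100288068;
  1159008324; 1247154241; 1247154241; 1159008324; 1230311492; 1175851073; 1117130817; 1100288068;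
  1100288068; 1117130817; 1247154241; 1159008324; 1175851073; 1230311492; 1247088708; 1075122280;
  1112870980; 1075122280; 1074021376; 1179979844; 1179979844; 1074021376; 1075122280; 1247088708;
  1112870980; 1075122280; 1075122280; 1112870980; 1179979844; 1074021376; 1247088708; 1075122280]%positive.

Definition moves_00110000 : seq positive := [::
  6447715361; 4296049793; 4304430081; 4572849169; 4833940578; 5916075074; 4363125857; 4565537794;
  4832904257; 4371522593; 4297069698; 6578787490; 5505061970; 7123002497; 4430234721; 4975502497;
  4368368706; 4305478738; 6985614434; 5781890130; 4976583842; 6045078625; 4301259810; 4371555345;
  6854583425; 4565505090; 5512373377; 4431287442; 4296017025; 4296017041; 4296016977; 4296016929;
  4313879698; 5524984977; 5994747025; 4322239634; 7065326626; 6795854945; 5999993858; 4313846946;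
  4316992609; 6531617825; 5990548561; 4312826977]%positive.

Definition leaves_00110000 : seq positive := [::
  1074021376; 1230311504; 1075122272; 1163202640; 1096093776; 1075122272; 1075122272; 1096093776;
  1230311504; 1074021376; 1075122272; 1163202640; 1163202640; 1075122272; 1075122272; 1096093776;
  1074021376; 1230311504; 1213534288; 1150619716; 1213534276; 1075122244; 1075122256; 1075122256;
  1075122244; 1150619716; 1213534288; 1213534276; 1213534276; 1150619728; 1075122256; 1075122244;
  1213534288; 1150619716; 1075122272; 1159008336; 1226117200; 1074021376; 1074021376; 1159008336;
  1075122272; 1091899472; 1075122272; 1074021376; 1226117200; 1075122272; 1159008336; 1146425424;
  1209339972; 1146425412; 1209339972; 1146425424; 1083510852; 1083510864; 1146425412; 1146425424;
  1209339972; 1079316560; 1079316548; 1079316548; 1079316560; 1142231108; 1217728592; 1217728580;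
  1079316560; 1075122272; 1075122272; 1234505808; 1074021376; 1167396944; 1075122272; 1678252116;
  1409882184; 1414009928; 1184174148; 1074021376; 1075122280; 1075122280; 1117065284; 1117065284;
  1075122280; 1074021376; 1075122280; 1075122280; 1251283012; 1117065284; 1075122280; 1184174148;
  1074021376; 1247088708; 1075122280; 1074021376; 1074021376; 1075122280; 1075122280; 1179979844;
  1074021376; 1247088708; 1075122280; 1108676676; 1075122280; 1075122280; 1074021376; 1242894404;
  1108676676; 1075122280; 1078596692; 1082724436; 1611208776; 1074021376; 1074021376; 1076183328;
  1076183336; 1076183328; 1076183336; 1075856384; 1075856384; 1075856384; 1075856384; 1078218848;
  1078218848; 1079005472; 1079005472; 1078218848; 1078218848; 1079005472; 1079005472; 1078218856;
  1078218856; 1079136552; 1079136552; 1078218856; 1078218856; 1079136552; 1079136552]%positive.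

Definition moves_01000010 : seq positive := [::
  6443504737; 4296049825; 4304442537; 4565509122; 4368393254; 4565501010; 4564460625; 4296053857;
  4296041633; 7124030634; 4632617986; 4833944722; 6847202450; 5503992833; 5982168169; 4699751506;
  4632630338; 5780841577; 6984565909; 4572861481; 6851433510; 6049260585; 4296017025; 6733997126;
  4389344362; 4296016977; 4296016929; 4312835217; 6531617893; 5457880165; 7001367637; 6598730789;
  5982164105; 4922016774; 6872376330; 4296017041; 4321186905; 5723161698; 4296016993; 5529162905;
  4716528786; 4582311058; 5664412826; 4656751657; 4988118021; 6066045977; 4832904193; 4451230821;
  7065347074]%positive.

(** The search returns nothing here: no function with these parameters is balanced. The other empty
    lists mean the same. *)
Definition leaves_01000010 : seq positive := [::
]%positive.

Definition moves_01000100 : seq positive := [::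
  6447711269; 4296049833; 4304421893; 6984582229; 4899996673; 4305454113; 4297065553; 4301259793;
  4371514513; 4565500993; 4564485145; 7051707401; 4832904357; 4371530789; 5777671317; 4371547225;
  4364207257; 6847202433; 5503992965; 6784304133; 4699751593; 7118816297; 5982159945; 6581912673;
  6850364581; 4435493973; 6783255621; 4296017025; 4296017041; 4296016913; 4296016929; 4296016977;
  4565500929; 5931795585; 4992271521; 7140820069; 4296016993; 4921000969; 6532629633; 4832904197;
  5991597209; 4582294693; 7001343057; 4384130185; 4716528745; 6062867553; 4296017057; 4922016913;
  6796903529; 5995791369; 7006618649; 4305454081; 5928666149; 4322247829; 4572873753]%positive.

Definition leaves_01000100 : seq positive := [::
]%positive.

Definition moves_01001010 : seq positive := [::
  6443504737; 4296049825; 4304442393; 4296025089; 4367336613; 4363129857; 4296053825; 5982168233;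
  7114593345; 4564460641; 4572841113; 4967142417; 4296037473; 4832892001; 4572861577; 5915018409;
  7051695237; 6049260617; 6577718289; 5503992913; 6984565845; 6586143817; 7118816293; 5982164121;
  6846157825; 4296017025; 4321219657; 7139795993; 4648363009; 4296017041; 4296016993; 7001379861;
  4296016929; 4388316169; 4296016977; 6061851669; 4296017057; 4312802465; 6867145877; 4635763781;
  4317008965; 4447028305; 4723872777; 4312810657; 4296016913; 7001342981; 4648358993; 4920992837;
  6535816217; 5797577753; 4639970329; 7001375781; 5931815961]%positive.

Definition leaves_01001010 : seq positive := [::
]%positive.

Definition moves_01010010 : seq positive := [::
  6443541521; 4296049825; 4363133985; 4297065554; 4296037377; 4296053889; 4565509282; 6577718273;
  4565500946; 7114593281; 4632630290; 4430267393; 6981420034; 4967142433; 6711960673; 4564460689;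
  5773476930; 4296041473; 4832904321; 4632618018; 4698711201; 4833944722; 6041920610; 7048570018;
  7064273921; 4296016929; 4296017057; 4582298706; 4296016977; 4312835233; 4916773889; 4296017041;
  6862935201; 4582302722; 4296016993; 5521826978; 6594503745; 4296016913; 4312798273; 4716512418;
  4582311010]%positive.

Definition leaves_01010010 : seq positive := [::
]%positive.

Definition moves_01010020 : seq positive := [::
  6443541521; 4296049825; 4363133985; 4297065554; 4296037377; 4296053889; 4565509282; 6577718273;
  4565500946; 7114593281; 4632630290; 4430267393; 6981420034; 4967142433; 6711960673; 4564460689;
  5773476930; 4296041473; 4832904321; 4632618018; 4698711201; 4833944722; 6041920610; 7048570018;
  7064273921; 4296016929; 4296017057; 4582298706; 4296016977; 4312835233; 4916773889; 4296017041;
  6862935201; 4582302722; 4296016993; 5521826978; 6594503745; 4296016913; 4312798273; 4716512418;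
  4582311010]%positive.

Definition leaves_01010020 : seq positive := [::
]%positive.

Definition moves_01100000 : seq positive := [::
  6447711265; 4296049825; 4304421889; 6984582225; 4899996673; 4305454114; 4297065554; 4301259794;
  4371514513; 4565500994; 4564485137; 7051707393; 4832904353; 4371530785; 5777671314; 4371547217;
  4364207250; 6847202434; 5503992961; 6784304130; 4699751586; 7118816289; 5982159937; 6581912673;
  6850364577; 4435493970; 6783255617; 4296017057; 4296017025; 4296017041; 4296016929; 4296016993;
  4322264146; 4653614210; 4296016977; 6057624641; 5656052834; 6800032801; 7140836498; 4720723010;
  4296016913; 7065338978; 6998213634; 6867125377; 4922049602; 4648354961; 5794448514; 5521818626;
  5798626434; 7131399201; 5454693394; 4586505346; 4385178706; 4316988577; 4926211218; 5727356050]%positive.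

Definition leaves_01100000 : seq positive := [::
  1074795560; 1083315240; 1083315232; 1074795552; 1074021376; 1074021376; 1076183336; 1076183328;
  1075856384; 1075856384; 1075856384; 1075856384; 1075856384; 1075856384; 1075856384; 1075856384]%positive.

Definition moves_01100100 : seq positive := [::
  6447711397; 4296049833; 4304421893; 6984582165; 4707091561; 4367352921; 4371530917; 6984565841;
  5508187237; 4832887969; 4967138329; 4702897257; 4639982617; 7114589313; 4899996833; 4975510565;
  4832904213; 4367336613; 4371514369; 4564485129; 5915018385; 5982127201; 5503992965; 7051674785;
  6586107009; 6577718369; 4434429073; 4367320145; 6854558821; 5982159897; 4564452385; 4572840993;
  4900029465; 4568646785; 6783255621; 7051707401; 5982143525; 7051691157; 4296017025; 4296017041;
  4296016929; 4296016977; 4296017057; 4316988513; 5927601249; 4384113701; 6862931025; 7131399257;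
  5915034645; 4585440293; 4296016993; 4321215593; 4455433369; 5730501705; 4920984677; 6997165141;
  6057624705; 4916773921; 5793399829; 4925195305; 5927634057; 6527403093; 5994742921; 4321199141;
  5529158805; 6867125377; 4656759817]%positive.

Definition leaves_01100100 : seq positive := [::
]%positive.

Definition moves_01110000 : seq positive := [::
  6447715361; 4296049793; 4304430081; 4572849169; 4833940578; 5916075074; 4632630402; 4565537794;
  4371555425; 5982151777; 4297069570; 4305478690; 4708148226; 5982168129; 5776626833; 6846153889;
  4832887937; 4832904225; 6985614370; 5781873794; 4431320082; 5979014274; 4972364962; 5505045538;
  4565505154; 5513454754; 6046090306; 6787458177; 5509235810; 4301259874; 6578770962; 7119864834;
  6582961282; 4296017025; 4296017041; 4313846882; 4858094657; 4312827009; 4296016993; 4296016929;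
  6862963873; 7140811874; 4926219330; 4993361042; 4296017057; 5726278721; 5727355922; 4296016977;
  6061823073; 5526012994; 5932852354; 4656735329; 6997148737; 5927621649; 6997165153; 4296016913;
  6536848530; 4384117921; 4322239506]%positive.

Definition leaves_01110000 : seq positive := [::
  1074021376; 1074021376; 1076183336; 1076183328; 1075856384; 1075856384]%positive.

Definition moves_01120000 : seq positive := [::
  6443516953; 4296049749; 4304442529; 4565509138; 4368368706; 4832904293; 4572861513; 5916103706;
  4833944618; 4632618118; 6041920538; 4564485285; 4363142273; 6984574057; 6855611538; 4439708698;
  4297073666; 6046090338; 4368401490; 7115646122; 6985614370; 6050321506; 6582961322; 7119864982;
  4968195094; 6787437713; 4632650778; 4438660133; 4296017025; 4296016929; 4296016921; 4296016985;
  4296016965; 4296017045; 4296017049; 4296017041; 7006589994; 4322251846; 4984939526; 4296016997;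
  4296016901; 7132439718; 5723137110; 4296016933; 4296017029; 4586505378; 5457880129; 4296017001;
  6867166377; 4296016937; 4296016905; 4993324138; 4917863574; 4296016913; 4716520458; 6594528265;
  5524988949; 6997165153; 4321203349; 4296017061; 5529146537; 4296016917; 4296016969; 6067098774;
  5723153490; 6581953701; 5530195018; 4296017065; 4585448533; 4296016981; 5726282897; 4384121865;
  7131366545]%positive.

Definition leaves_01120000 : seq positive := [::
  1074021376; 1074021376; 1074021376; 1074021376; 1074021376; 1074021376; 1079120160; 1079120160;
  1079071008; 1079120160; 1079087400; 1079005480; 1079054632; 1079087400]%positive.

Definition moves_01120001 : seq positive := [::
  6443516953; 4296049793; 4304426009; 6984573969; 4832887825; 4832904337; 4363142249; 4367344657;
  4367328425; 4371551317; 6577718273; 4430267433; 5915055113; 4572861545; 4434453585; 4564485189;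
  4438660165; 4564452501; 6040863905; 4367361121; 5780804633; 4572845089; 6581953673; 5508195349;
  5982147681; 4832920609; 7051699209; 5512385665; 6787437633; 6787470485; 4296017049; 4296017025;
  4296016977; 4296017045; 4296016965; 4296016929; 4296016933; 4296016917; 4296016969; 4321203269;
  4296017041; 4296016997; 4296016905; 4296017001; 4296016937; 4447028305; 4296016985; 6598714457;
  4296016913; 4296017061; 4296017029; 5793391749; 4451214425; 7068492953; 5524988997; 4296016981;
  5520753761; 6594528353; 4296016921; 7064290373; 6867166229; 4296017065; 4296016901; 4379919449;
  6997165125; 4585432137; 4585448597; 4296017033; 6527386793; 5994718213; 5726282825; 5994734677;
  4648338441; 5453677589; 5722096649]%positive.

Definition leaves_01120001 : seq positive := [::
  1074086176; 1074086184; 1074086176; 1074086184; 1076183336; 1076183328; 1076183336; 1076183328]%positive.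

Definition moves_10000100 : seq positive := [::
  6443508761; 4296025177; 4296020997; 4297070694; 4363134089; 4632619082; 4565510282; 4565506134;
  6711940133; 4430242921; 4565501970; 4832891941; 5772411921; 5906629633; 6578772006; 6510617737;
  5705311385; 4564460617; 5773469834; 6041901126; 6847203394; 7115647114; 5505026210; 5705303137;
  7114597417; 5503980565; 6779045009; 6040855561; 4296017041; 4582279314; 4296016929; 4296017057;
  4296016993; 4447020105; 6595553322; 4917827686; 4296016977; 4564460697; 4649396234; 5790246922;
  4582283366; 5454698646; 4564456485; 5723130018; 6795826181; 5790238722; 4380952738; 4582287402;
  4312802377; 6863980610; 5521811546; 4312794241; 7132424346; 4564460569; 6795830345]%positive.

(** Here y = t^3 and k = y^3, so t has order 27 and the group is Z/27 x Z/3. That this list is empty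
    is what excludes circulant matrices. *)
Definition leaves_10000100 : seq positive := [::
]%positive.

(* With each tuple: moves preserving it and, for each minimal solution, the index
   of its class and the three rows and the column to be matched with those of
   the class. *)
Definition reps : seq (par * (seq positive * seq positive)) := [::
  (Par t0 t0 t0 t0 t0 t0 t0 t0, (moves_00000000, leaves_00000000));
  (Par t0 t0 t0 t0 t0 t0 t0 t1, (moves_00000001, leaves_00000001));
  (Par t0 t0 t0 t0 t0 t0 t1 t0, (moves_00000010, leaves_00000010));
  (Par t0 t0 t0 t0 t1 t0 t0 t0, (moves_00001000, leaves_00001000));
  (Par t0 t0 t0 t0 t1 t0 t0 t1, (moves_00001001, leaves_00001001));
  (Par t0 t0 t0 t0 t1 t0 t1 t0, (moves_00001010, leaves_00001010));
  (Par t0 t0 t0 t1 t0 t0 t0 t0, (moves_00010000, leaves_00010000));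
  (Par t0 t0 t0 t1 t0 t0 t0 t1, (moves_00010001, leaves_00010001));
  (Par t0 t0 t0 t1 t0 t0 t1 t0, (moves_00010010, leaves_00010010));
  (Par t0 t0 t0 t1 t0 t0 t1 t1, (moves_00010011, leaves_00010011));
  (Par t0 t0 t1 t1 t0 t0 t0 t0, (moves_00110000, leaves_00110000));
  (Par t0 t1 t0 t0 t0 t0 t1 t0, (moves_01000010, leaves_01000010));
  (Par t0 t1 t0 t0 t0 t1 t0 t0, (moves_01000100, leaves_01000100));
  (Par t0 t1 t0 t0 t1 t0 t1 t0, (moves_01001010, leaves_01001010));
  (Par t0 t1 t0 t1 t0 t0 t1 t0, (moves_01010010, leaves_01010010));
  (Par t0 t1 t0 t1 t0 t0 t2 t0, (moves_01010020, leaves_01010020));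
  (Par t0 t1 t1 t0 t0 t0 t0 t0, (moves_01100000, leaves_01100000));
  (Par t0 t1 t1 t0 t0 t1 t0 t0, (moves_01100100, leaves_01100100));
  (Par t0 t1 t1 t1 t0 t0 t0 t0, (moves_01110000, leaves_01110000));
  (Par t0 t1 t1 t2 t0 t0 t0 t0, (moves_01120000, leaves_01120000));
  (Par t0 t1 t1 t2 t0 t0 t0 t1, (moves_01120001, leaves_01120001));
  (Par t1 t0 t0 t0 t0 t1 t0 t0, (moves_10000100, leaves_10000100))].

Definition bh_classes : seq class_data := [seq dec_class p | p <- class_codes].

(** The tuples are split by the two parameters on which the dictionary depends. *)
Definition reps_at (p q : trit) : seq rep_data :=
  List.filter (fun d => teqb (pp d.1) p && teqb (pq d.1) q) reps.

Lemma classes_ok : allw class_ok bh_classes.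
Proof. by vm_cast_no_check (erefl true). Qed.

Lemma reduction_ok :
  all2w (reduces [seq d.1 | d <- reps]) (List.filter consistent all_pars) reduction_codes.
Proof. by vm_cast_no_check (erefl true). Qed.

Lemma check_reps00 : check_reps bh_classes t0 t0 (reps_at t0 t0).
Proof. by vm_cast_no_check (erefl true). Qed.

Lemma check_reps01 : check_reps bh_classes t0 t1 (reps_at t0 t1).
Proof. by vm_cast_no_check (erefl true). Qed.

Lemma check_reps10 : check_reps bh_classes t1 t0 (reps_at t1 t0).
Proof. by vm_cast_no_check (erefl true). Qed.

Local Close Scope ring_scope.

From mathcomp Require Import all_solvable.
Import Order.TTheory GRing.Theory Num.Theory.

(** * Presentations of groups of order 81 *)

Local Open Scope group_scope.

Section Extension3.

Variables (gT : finGroupType) (H : {group gT}) (x : gT).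
Hypotheses (nHx : x \in 'N(H)) (Hx : x \notin H) (Hx3 : x ^+ 3 \in H).

Let K := H <*> <[x]>.

Lemma ext3_quotient : K / H = <[coset H x]>.
Proof. by rewrite quotientYidl ?cycle_subG // quotient_cycle. Qed.

Lemma ext3_order : #[coset H x] = 3.
Proof.
apply: nt_prime_order => //; first by rewrite -morphX //= coset_id.
by apply: contra Hx => /eqP; apply: coset_idr.
Qed.

Lemma ext3_norm : K \subset 'N(H).
Proof. by rewrite join_subG normG cycle_subG. Qed.

Lemma card_ext3 : #|K| = (3 * #|H|)%N.
Proof.
rewrite -(Lagrange (joing_subl H <[x]>)) mulnC -card_quotient ?ext3_norm //.
by rewrite ext3_quotient -orderE ext3_order.
Qed.

Lemma ext3_decomp g : g \in K -> exists n, exists2 h, h \in H & g = h * tpow x n.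
Proof.
move=> Kg; have Ng := subsetP ext3_norm g Kg.
have : coset H g \in <[coset H x]> by rewrite -ext3_quotient mem_quotient.
case/cycleP=> j ej; exists (trit_of_nat (j %% 3)).
exists (g * (tpow x (trit_of_nat (j %% 3)))^-1); last by rewrite mulgKV.
have -> : tpow x (trit_of_nat (j %% 3)) = x ^+ (j %% 3).
  by rewrite /tpow; have := ltn_pmod j (isT : 0 < 3); case: (j %% 3) => [|[|[|]]].
apply: coset_idr; first by rewrite groupM ?groupV ?groupX.
rewrite morphM ?groupV ?groupX // morphV ?groupX // morphX //= ej.
by rewrite -ext3_order expg_mod_order mulgV.
Qed.

End Extension3.

Lemma coset_commute (gT : finGroupType) (H : {group gT}) a b :
  a \in 'N(H) -> b \in 'N(H) -> commute (coset H a) (coset H b) ->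
  exists2 h, h \in H & a * b = b * h * a.
Proof.
move=> Na Nb cab; exists (b^-1 * (a * b * a^-1)); last by rewrite mulKVg mulgKV.
apply: coset_idr; first by rewrite !groupM ?groupV.
rewrite !(morphM, morphV) ?groupM ?groupV //=.
by rewrite cab mulgK mulVg.
Qed.

Lemma in_cycle3 (gT : finGroupType) (z h : gT) : #[z] = 3 -> h \in <[z]> ->
  exists d, h = tpow z d.
Proof.
move=> oz /cycleP[j ->]; exists (trit_of_nat (j %% 3)).
rewrite -(expg_mod_order z j) oz /tpow.
by have := ltn_pmod j (isT : 0 < 3); case: (j %% 3) => [|[|[|]]].
Qed.

(** Builds a chain 1 < <z> < M < A < G with factors of order 3, where M = <z, k> and A = <z, k, y>
    are normal and A is abelian; t is any element outside A. The exponents are then read off the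
    memberships of y^3, t^3 and the commutators. *)
Lemma presentation_exists (gT : finGroupType) (z : gT) :
  #|gT| = 81 -> (forall x, commute z x) -> #[z] = 3 -> ~~ cyclic [set: gT] ->
  exists t y k P, presents z t y k P.
Proof.
move=> card81 zc oz ncG; set G := [set: gT]%G.
have pG : 3.-group G by rewrite /pgroup cardsT card81.
have z3 : z ^+ 3 = 1 by rewrite -oz expg_order.
pose Z := <[z]>%G.
have nZ g : g \in 'N(Z).
  by rewrite inE -cycleJ conjgE (zc g) mulKg.
have ZG : Z <| G by rewrite /normal subsetT; apply/subsetP => g _; apply: nZ.
(* If all abelian normal subgroups were cyclic, G would be cyclic: the remaining cases of
   [normal_rank1_structure] are 2-groups. *)
have [X [nX abX ncX]] : exists X : {group gT}, [/\ X <| G, abelian X & ~~ cyclic X].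
  apply: contrapT => noX.
  case: (normal_rank1_structure pG) => [X nX abX|cG|/andP[]//].
    by apply: contrapT => /negP ncX; apply: noX; exists X.
  by rewrite cG in ncG.
have pX : 3.-group X := pgroupS (normal_sub nX) pG.
pose V := 'Ohm_1(X)%G.
have abV : 3.-abelem V := Ohm1_abelem pX abX.
have nV : V <| G := char_normal_trans (Ohm_char 1 X) nX.
(* [V] has the rank of [X], so it cannot lie in a cyclic group. *)
have VZ : ~~ (V \subset Z).
  apply: contra ncX => /cyclicS/(_ (cycle_cyclic z)).
  by rewrite !abelian_rank1_cyclic ?(abelem_abelian abV) // rank_Ohm1.
have pGZ : 3.-group (G / Z) := quotient_pgroup Z pG.
have VZ1 : (V / Z)%G :!=: 1.
  by rewrite -subG1 quotient_sub1 //; apply: subset_trans (normal_norm ZG); apply: subsetT.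
(* The nontrivial normal subgroup V Z / Z meets the centre of G / Z. A preimage k in [V] has trivial
   cube and is central modulo z. *)
have /trivgPn[kb] := meet_center_nil (pgroup_nil pGZ) (quotient_normal Z nV) VZ1.
case/setIP=> /morphimP[k Nk Vk ->{kb}] /centerP[_ ck] k1.
have kZ : k \notin Z by apply: contra k1 => kZ; rewrite /= coset_id.
have k3 : k ^+ 3 = 1 by have /abelemP[//|_] := abV; apply.
have ck' x : exists2 h, h \in Z & x * k = k * h * x.
  by apply: coset_commute => //; apply/commute_sym/ck/mem_quotient; rewrite inE.
have K3 : k ^+ 3 \in Z by rewrite k3 group1.
pose M := (Z <*> <[k]>)%G.
have cM : #|M| = 9 by rewrite (card_ext3 (nZ k) kZ K3) -orderE oz.
have MG : M <| G.
  rewrite /normal subsetT; apply/subsetP => g _; rewrite inE /M /= conjYg join_subG.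
  rewrite (normP (nZ g)) joing_subl -cycleJ cycle_subG.
  have [h hZ e] := ck' g^-1; rewrite conjgE mulgA e mulgKV groupM //.
    exact: subsetP (joing_subr _ _) _ (cycle_id k).
  exact: subsetP (joing_subl _ _) _ hZ.
have nM g : g \in 'N(M) := subsetP (normal_norm MG) g (in_setT g).
have abGM : abelian (G / M).
  apply: (@card_p2group_abelian _ 3) => //.
  by rewrite card_quotient ?normal_norm // -divgS ?normal_sub // cardsT card81 cM.
have ckM a b : exists2 h, h \in M & a * b = b * h * a.
  apply: coset_commute => //; apply: (centsP abGM); exact: mem_quotient (in_setT _).
pose C := 'C[k]%G.
have MC : M \subset C.
  rewrite join_subG !cycle_subG cent1id andbT.
  by apply/cent1P; rewrite /commute (zc k).
(* The conjugates of k lie in the coset k Z, so there are at most three of them. *)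
have cardC : 27 <= #|C|.
  have : #|k ^: G| <= 3.
    have sub : k ^: G \subset k *: Z.
      apply/subsetP => _ /imsetP[g _ ->]; have [h hZ e] := ck' g^-1.
      by rewrite mem_lcoset conjgE (mulgA g^-1) e mulgKV mulKg.
    by rewrite (leq_trans (subset_leq_card sub)) // card_lcoset -orderE oz.
  have e : (#|'C[k]| * #|k ^: G|)%N = 81.
    rewrite -index_cent1 -{1}[ 'C[k]]setTI -card81 -cardsT.
    by apply: (@Lagrange _ G 'C_G[k]%G); apply: subsetIl.
  move=> le; rewrite leqNgt; apply/negP => lt.
  by have := leq_mul (lt : #|C| <= 26) le; rewrite e.
have dvd3 : 3 %| #|(C / M)%G|.
  rewrite card_quotient -?divgS ?cM //; last by apply/subsetP => g _; apply: nM.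
  have /p_natP[m cC] := pgroupS (subsetT C) pG.
  rewrite cC; move: cardC; rewrite cC; case: m {cC} => [|[|[|m]]] // _.
  rewrite dvdn_divRL; first by rewrite (_ : 3 * 9 = 3 ^ 3)%N // dvdn_exp2l.
  by rewrite (_ : 9 = 3 ^ 2)%N // dvdn_exp2l.
(* Taking y in the centralizer of k is what makes A abelian. *)
have [yb Cyb oyb] := Cauchy (isT : prime 3) dvd3.
case/morphimP: Cyb oyb => y Ny Cy -> oy.
have My : y \notin M.
  by apply/negP => yM; move: oy; rewrite /= coset_id // order1.
have My3 : y ^+ 3 \in M.
  by apply: coset_idr => //; rewrite morphX //= -oy expg_order.
pose A := (M <*> <[y]>)%G.
have cA : #|A| = 27 by rewrite (card_ext3 Ny My My3) cM.
have [t tA] : exists t, t \notin A.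
  apply: contrapT => allA; have : #|G| <= #|A|.
    by apply/subset_leq_card/subsetP => g _; apply: contrapT => /negP gA; apply: allA; exists g.
  by rewrite cA cardsT card81.
have MA : M \subset A := joing_subl _ _.
(* [A] contains [M], and G / M is abelian because its order is 9. *)
have nA g : g \in 'N(A).
  rewrite inE; apply/subsetP => _ /imsetP[a aA ->]; have [h hM e] := ckM a g.
  by rewrite conjgE e -mulgA mulKg groupM // (subsetP MA).
have At3 : t ^+ 3 \in A.
  apply: coset_idr; first exact: nA.
  have cGA : #|G / A| = 3.
    rewrite card_quotient -?divgS ?subsetT // ?cA ?cardsT ?card81 //.
    by apply/subsetP => g _; apply: nA.
  by rewrite morphX ?nA //= -cGA expg_cardG // mem_quotient // in_setT.
have yk : commute y k by apply/cent1P.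
have inM m : m \in M -> exists i d, m = tpow k i * tpow z d.
  case/(ext3_decomp (nZ k) kZ K3) => i [h /(in_cycle3 oz)[d ->] ->].
  by exists i, d; apply/commuteX2/zc.
have inA a : a \in A -> exists e i d, a = tpow y e * tpow k i * tpow z d.
  case/(ext3_decomp Ny My My3) => e [m /inM[i [d ->]] ->]; exists e, i, d.
  have zX b x : commute (tpow z b) x by apply/commute_sym/commuteX/commute_sym/zc.
  by rewrite -mulgA zX mulgA; congr (_ * _); apply/commuteX2/commute_sym.
have inG g : exists n e i d, g = tpow y e * tpow k i * tpow z d * tpow t n.
  have [|n [a /inA[e [i [d ->]]] ->]] := ext3_decomp (nA t) tA At3 (g := g).
    have /eqP eA : (A <*> <[t]>) == [set: gT].
      by rewrite eqEcard subsetT (card_ext3 (nA t) tA At3) cardsT card81 cA.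
    by rewrite eA in_setT.
  by exists n, e, i, d.
have [p [q ey3]] := inM _ My3.
have [h hZ etk] := ck' t; have [l el] := in_cycle3 oz hZ.
have [m mM ety] := ckM t y; have [r [s em]] := inM _ mM.
have [u [v [w et3]]] := inA _ At3.
exists t, y, k, (Par p q l r s u v w); split.
  by split; rewrite /= ?ey3 ?et3 ?etk ?ety ?el ?em // !mulgA.
(* There are 81 normal forms and 81 elements, so injectivity follows from surjectivity. *)
have onto g : exists x, ev z t y k x = g.
  by have [n [e [i [d ->]]]] := inG g; exists (n, e, i, d).
have /fin_all_exists[D ED] := onto.
have [E' EK KE] : bijective D.
  by apply: inj_card_bij (can_inj ED) _; rewrite card_prod card_idx card_trit card81.
by move=> x x'; rewrite -{1}(KE x) -{1}(KE x') !ED => /(congr1 D); rewrite !KE.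
Qed.

Local Close Scope group_scope.

From mathcomp Require Import cyclic.
Import Order.TTheory GRing.Theory Num.Theory.

(** * Cocycles and central extensions *)

Local Open Scope group_scope.

Record tcocycle (gT : finGroupType) := TCocycle
  { tc :> gT -> gT -> trit;
    tcP : forall x y z, tadd (tc x y) (tc (x * y) z) = tadd (tc x (y * z)) (tc y z);
    tc1x : forall x, tc 1 x = t0;
    tcx1 : forall x, tc x 1 = t0 }.

(** An alias that mentions [c], so that each cocycle puts its own group law on the pairs. *)
Definition central_ext (gT : finGroupType) (c : tcocycle gT) : Type := (gT * trit)%type.

Section CentralExtension.

Variables (gT : finGroupType) (c : tcocycle gT).
Let E := central_ext c.

HB.instance Definition _ := Finite.on E.

Definition ext_mul (x y : E) : E := (x.1 * y.1, tadd (tadd x.2 y.2) (c x.1 y.1)).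
Definition ext_one : E := (1, t0).
Definition ext_inv (x : E) : E := (x.1^-1, topp (tadd x.2 (c x.1^-1 x.1))).

Lemma ext_mulA : associative ext_mul.
Proof.
case=> x a [y b] [z d]; congr (_, _); rewrite /= ?mulgA //.
have := tcP c x y z; rewrite !taddE => h.
transitivity (a + b + d + (c x (y * z)%g + c y z))%R; first by ring.
by rewrite -h; ring.
Qed.

Lemma ext_mul1 : left_id ext_one ext_mul.
Proof. by case=> x a; congr (_, _); rewrite /= ?mul1g // tc1x; case: a. Qed.

Lemma ext_mulV : left_inverse ext_one ext_inv ext_mul.
Proof.
case=> x a; congr (_, _); rewrite /= ?mulVg // !taddE toppE; apply/eqP.
by case: (a); case: (c _ _).
Qed.

HB.instance Definition _ := Finite_isGroup.Build E ext_mulA ext_mul1 ext_mulV.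

Definition ext_z : E := (1, t1).

Lemma ext_mulE (x y : E) : x * y = (x.1 * y.1, tadd (tadd x.2 y.2) (c x.1 y.1)).
Proof. by []. Qed.

Lemma ext_zC (x : E) : commute ext_z x.
Proof.
by case: x => x a; rewrite /commute !ext_mulE /= tc1x tcx1 mul1g mulg1 [tadd a t1]taddC.
Qed.

Lemma tpow_ext_z d : tpow ext_z d = (1, d) :> E.
Proof.
have zz : ext_z * ext_z = (1, t2) :> E by rewrite ext_mulE /= mulg1 tc1x.
by case: d.
Qed.

Lemma snd_mul_z (x : E) d : (x * tpow ext_z d).2 = tadd x.2 d.
Proof. by rewrite tpow_ext_z ext_mulE /= tcx1 taddC. Qed.

Lemma card_central_ext : #|{: E}| = (#|gT| * 3)%N.
Proof. by rewrite card_prod card_trit. Qed.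

Lemma order_ext_z : #[ext_z] = 3.
Proof.
apply: nt_prime_order => //; last by apply/eqP => -[].
by rewrite !expgS expg0 mulg1 -[ext_z * ext_z]/(tpow ext_z t2) tpow_ext_z ext_mulE /= mulg1 tc1x.
Qed.

Lemma fst_mul (x y : E) : (x * y).1 = x.1 * y.1. Proof. by []. Qed.

Lemma fst_exp (x : E) n : (x ^+ n).1 = x.1 ^+ n.
Proof. by elim: n => // n IH; rewrite !expgS fst_mul IH. Qed.

Variable b : idx -> gT.
Hypotheses (cardG : #|gT| = 27) (bij_b : bijective b).

Let N : tmat := fun x y => c (b x) (b y).

(* Along the powers of a generator [e] of a cyclic extension, the entries of the row of [e]
   telescope to the nonzero second component of [e ^+ 27]. *)
Lemma cyclic_ext_not_BH : cyclic [set: E] -> ~ is_tBH N.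
Proof.
case/cyclicP => e eE bh; pose x0 := e.1.
have oe : #[e] = 81 by rewrite orderE -eE cardsT card_central_ext cardG.
have gen : [set: gT] = <[x0]>.
  apply/esym/eqP; rewrite eqEsubset subsetT; apply/subsetP => g _.
  have : (g, t0) \in <[e]> by rewrite -eE in_setT.
  by case/cycleP => i ei; rewrite -[g]/(g, t0).1 ei fst_exp mem_cycle.
have ox : #[x0] = 27 by rewrite orderE -gen cardsT cardG.
have [b' bK Kb] := bij_b.
have ne : b' x0 != b' 1.
  rewrite (inj_eq (can_inj Kb)); apply/eqP => x1.
  by move: ox; rewrite x1 order1.
have := sum_balanced id (bh _ _ ne).
rewrite (reindex b') /=; last by exists b => ? _; rewrite ?bK ?Kb.
rewrite /N; under eq_bigr => y _ do rewrite !Kb tc1x subr0.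
have inj_pow : injective (fun j : 'I_27 => x0 ^+ j).
  move=> i j /eqP; rewrite eq_expg_mod_order ox !modn_small // => /eqP ij.
  exact: val_inj.
have [pw powK Kpow] : bijective (fun j : 'I_27 => x0 ^+ j).
  by apply: inj_card_bij inj_pow _; rewrite card_ord cardG.
rewrite (reindex (fun j : 'I_27 => x0 ^+ j)) /=; last by exists pw => ? _.
have cE j : c x0 (x0 ^+ j) = ((e ^+ j.+1)%g.2 - (e ^+ j)%g.2 - e.2)%R.
  rewrite expgS [e * _]ext_mulE /= fst_exp -/x0 !taddE.
  by case: (e.2); case: (e ^+ j).2; case: (c _ _).
under eq_bigr => j _ do rewrite cE.
rewrite sumrB -(big_mkord xpredT (fun j => (e ^+ j.+1)%g.2 - (e ^+ j)%g.2)%R).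
rewrite telescope_sumr // sumr_const card_ord.
have -> : (e.2 *+ 27 = 0)%R by case: (e.2).
rewrite expg0 !subr0 => e2.
have : e ^+ 27 = 1.
  by rewrite [e ^+ 27]surjective_pairing e2 fst_exp -/x0 -ox expg_order.
by move/eqP; rewrite -order_dvdn oe.
Qed.

(** Here Phi is the second projection. As (x y).2 = x.2 + y.2 + c(x.1, y.1), the matrix of the
    cocycle is its development up to row and column constants. *)
Lemma ext_instance : is_tBH N ->
  exists P f, instance (ext_z : E) (fun x : E => x.2) P f /\ teq N (gdev P f).
Proof.
move=> bh.
have [t [y [k [P pres]]]] : exists t y k P, presents (ext_z : E) t y k P.
  apply: presentation_exists.
  - by rewrite card_central_ext cardG.
  - exact: ext_zC.
  - exact: order_ext_z.
  - by apply/negP => /cyclic_ext_not_BH; apply.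
have [b' bK Kb] := bij_b; have [rel inj] := pres.
pose e x := ev (ext_z : E) t y k (x, t0).
pose f := tab27 (fun x => (e x).2).
have fE x : fev f x = (ev (ext_z : E) t y k x).2.
  case: x => x d; rewrite /fev tab27K -snd_mul_z /e (ev_z _ _ _ rel).
  by case: d.
exists P, f; split.
  by exists t, y, k, 1; split=> // x; rewrite fE mul1g.
have e1_inj : injective (fun x => b' (e x).1).
  move=> x x' /(can_inj Kb) xx'.
  have : e x * tpow ext_z (tadd (e x').2 (topp (e x).2)) = e x'.
    rewrite tpow_ext_z ext_mulE tcx1 mulg1 xx' [RHS]surjective_pairing; congr (_, _).
    by rewrite /=; case: (e x).2; case: (e x').2.
  by rewrite /e (ev_z _ _ _ rel) => /inj [].
exists (fun x => b' (e x).1), (fun x => b' (e x).1), (fun x => (e x).2), (fun x => (e x).2).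
split=> // x x'; rewrite /gdev fE -(ev_mul rel) -!/(e _) ext_mulE /N !Kb.
by rewrite [snd _]/= !taddE addrAC.
Qed.

End CentralExtension.

(** The relations do not involve z; in a presented group, t, y and k then generate a complement of
    <z>, of order 27. *)
Definition exact_par (P : par) : bool :=
  [&& pq P == t0, pl P == t0, ps P == t0 & pw P == t0].

Lemma gmul_exact P x y : exact_par P -> (gmul P (x, t0) (y, t0)).2 = t0.
Proof.
case/and4P => /eqP q0 /eqP l0 /eqP s0 /eqP w0.
case: x y => [[n e] i] [[n' e'] i'].
have A a b : a.2 = t0 -> b.2 = t0 -> (amul P a b).2 = t0.
  by case: a b => [[a1 a2] a3] [[b1 b2] b3] /= -> ->; rewrite q0; case: (car _ _).
have T1 a : a.2 = t0 -> (atwist1 P a).2 = t0.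
  by case: a => [[a1 a2] a3] /= ->; rewrite l0 s0; case: (a1); case: (a2).
have T m a : a.2 = t0 -> (atwist P m a).2 = t0.
  by move=> a0; case: m => //; [apply: T1 | apply/T1/T1].
have h := A (e, i, t0) (atwist P n (e', i', t0)) erefl (T n (e', i', t0) erefl).
rewrite /gmul; case: (amul P (e, i, t0) _) h => [[e1 i1] d1] h.
have h' := A (e1, i1, d1) (pu P, pv P, pw P) h w0.
by case: (car n n'); [exact: h | |]; case: (amul _ _ _) h' => [[e2 i2] d2].
Qed.

(** * Groups of order 27 and coboundaries *)

Section ExactGroup.

Variables (gT : finGroupType) (t y k : gT) (P : par).
Hypotheses (cardG : #|gT| = 27) (exP : exact_par P) (rel : relations 1 t y k P).
Hypothesis inj : injective (fun x => ev 1 t y k (x, t0)).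

Let b x := ev 1 t y k (x, t0).

Lemma exact_bij : bijective b.
Proof. by apply: inj_card_bij inj _; rewrite card_idx cardG. Qed.

Lemma exact_mul x x' : b x * b x' = b (gmul P (x, t0) (x', t0)).1.
Proof.
rewrite /b (ev_mul rel); have := gmul_exact x x' exP.
by case: (gmul _ _ _) => [u d] /= ->.
Qed.

Lemma exact_one : b (t0, t0, t0) = 1.
Proof. exact: ev_gone. Qed.

Section Coboundary.

Variable phi : gT -> trit.
Hypothesis phi1 : phi 1 = t0.

Definition coboundary (g h : gT) : trit := (phi (g * h)%g - phi g - phi h)%R.

Lemma coboundaryP x z w :
  tadd (coboundary x z) (coboundary (x * z) w) = tadd (coboundary x (z * w)) (coboundary z w).
Proof. by rewrite /coboundary !taddE mulgA; ring. Qed.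

Lemma coboundary1x x : coboundary 1 x = t0.
Proof. by rewrite /coboundary mul1g phi1; case: (phi x). Qed.

Lemma coboundaryx1 x : coboundary x 1 = t0.
Proof. by rewrite /coboundary mulg1 phi1; case: (phi x). Qed.

Definition coboundary_cocycle := TCocycle coboundaryP coboundary1x coboundaryx1.

End Coboundary.

(** Subtracting phi(x) from the rows and phi(y) from the columns of [phi(x y)] leaves a coboundary,
    which is normalized because phi vanishes at 1. *)
Lemma exact_cocycle f : get27 f (t0, t0, t0) = t0 ->
  exists c : tcocycle gT, teq (gdev P f) (fun x y => c (b x) (b y)).
Proof.
move=> f0; have [b' bK Kb] := exact_bij; pose phi g := get27 f (b' g).
have phi1 : phi 1 = t0 by rewrite /phi -exact_one bK.
exists (coboundary_cocycle phi1), id, id, (fun x => - phi (b x))%R, (fun x => - phi (b x))%R.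
split=> // x x'; rewrite /= /coboundary exact_mul /phi !bK /gdev /fev gmul_exact //.
by rewrite [tadd _ t0]taddC tadd0; ring.
Qed.

Definition trivial_cocycle : tcocycle gT :=
  @coboundary_cocycle (fun _ => t0) erefl.

Let E := central_ext trivial_cocycle.

(** Moves the relations from a group of order 27 to its product with Z/3, where the results for
    order 81 apply. *)
Lemma exact_presents :
  presents (ext_z trivial_cocycle : E) ((t, t0) : E) ((y, t0) : E) ((k, t0) : E) P.
Proof.
have M g h a a' : ((g, a) : E) * ((h, a') : E) = ((g * h, tadd a a') : E).
  by rewrite ext_mulE /= [tadd _ t0]taddC.
have X g n : ((g, t0) : E) ^+ n = ((g ^+ n, t0) : E).
  by elim: n => // n IH; rewrite !expgS IH M.
have TX g a : tpow ((g, t0) : E) a = ((tpow g a, t0) : E) by rewrite /tpow X.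
have T1 a : tpow (1 : gT) a = 1 by rewrite /tpow expg1n.
have TZ a : tpow (ext_z trivial_cocycle : E) a = ((1, a) : E) by apply: tpow_ext_z.
have evE x d : ev (ext_z trivial_cocycle : E) ((t, t0) : E) ((y, t0) : E) ((k, t0) : E) (x, d) =
    (b x, d) :> E.
  case: x => [[n e] i]; rewrite /b /ev /eva !TX TZ !M T1.
  by case: d.
split; last by move=> [x d] [x' d']; rewrite !evE => -[/inj -> ->].
have [q0 l0 s0 w0] : [/\ pq P = t0, pl P = t0, ps P = t0 & pw P = t0].
  by case/and4P: exP => /eqP -> /eqP -> /eqP -> /eqP ->.
split.
- exact: ext_zC.
- by rewrite -(order_ext_z trivial_cocycle) expg_order.
- by rewrite X (rel_k3 rel).
- by rewrite /commute !M (rel_yk rel).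
- by rewrite X (rel_y3 rel) !TX TZ M q0 T1.
- by rewrite TZ !M (rel_tk rel) l0 T1.
- by rewrite TX TZ !M (rel_ty rel) s0 T1.
- by rewrite X (rel_t3 rel) !TX TZ !M w0 T1.
Qed.

End ExactGroup.

Local Close Scope group_scope.

(** * Classification of cocyclic exponent matrices *)

Definition class0 : class_data := (Par t0 t0 t0 t0 t0 t0 t0 t0, tab27 (fun=> t0), (origin, origin, origin)).

Definition class_mat (k : nat) : tmat := mat_of_class (nth class0 bh_classes k).

Lemma size_classes : size bh_classes = 16.
Proof. by vm_compute. Qed.

Lemma class_mat_BH k : k < 16 -> is_tBH (class_mat k).
Proof.
rewrite -size_classes => k16; have := classes_ok; rewrite allwE.
move/(all_nthP class0)/(_ k k16); rewrite /class_mat.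
case: (nth _ _ _) => [[P f] y]; rewrite /class_ok /mat_of_class; cbn [fst snd].
by case: ifP => // /is_tBHP.
Qed.

Lemma reps_cover d : List.In d reps ->
  [\/ List.In d (reps_at t0 t0), List.In d (reps_at t0 t1) | List.In d (reps_at t1 t0)].
Proof.
move=> dr; have : (pp d.1, pq d.1) \in [:: (t0, t0); (t0, t1); (t1, t0)].
  apply: (in_allw (p := fun d : rep_data =>
    (pp d.1, pq d.1) \in [:: (t0, t0); (t0, t1); (t1, t0)]) _ dr).
  by vm_cast_no_check (erefl true).
rewrite !inE => /or3P[] /eqP[pE qE]; [apply: Or31 | apply: Or32 | apply: Or33];
  by apply/List.filter_In; rewrite pE qE.
Qed.

Lemma in_mapP (A B : Type) (F : A -> B) s y :
  List.In y [seq F x | x <- s] -> exists2 x, F x = y & List.In x s.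
Proof.
elim: s => //= x s IH [<-|/IH[x' <- x's]]; first by exists x => //; left.
by exists x' => //; right.
Qed.

Section Classified.

Variables (gT : finGroupType) (z : gT) (Phi : gT -> trit).
Hypothesis card81 : #|gT| = 81.
Hypothesis PhiZ : forall x d, Phi (x * tpow z d)%g = tadd (Phi x) d.

Lemma rep_instance_classified d f : List.In d reps ->
  instance z Phi d.1 f -> is_tBH (gdev d.1 f) ->
  d.2.2 <> [::] /\ exists2 k, k < 16 & teq (class_mat k) (gdev d.1 f).
Proof.
case: d => P [mc lc] /reps_cover dr inf bh; rewrite -size_classes.
case: dr => dr.
- exact: (rep_classified card81 PhiZ class0 classes_ok check_reps00 dr inf bh).
- exact: (rep_classified card81 PhiZ class0 classes_ok check_reps01 dr inf bh).
- exact: (rep_classified card81 PhiZ class0 classes_ok check_reps10 dr inf bh).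
Qed.

Lemma instance_classified P f : instance z Phi P f -> is_tBH (gdev P f) ->
  exists2 k, k < 16 & teq (class_mat k) (gdev P f).
Proof.
move=> inf bh; have [Q [g [Qr ing]]] := reduction PhiZ reduction_ok inf.
have fg : teq (gdev P f) (gdev Q g) := instance_teq card81 PhiZ inf ing.
have [d dQ dr] := in_mapP Qr; rewrite -dQ in ing fg.
have [_ [k k16 kg]] := rep_instance_classified dr ing (teq_tBH fg bh).
by exists k => //; apply: teq_trans kg (teq_sym fg).
Qed.

End Classified.

Lemma cocycle_classified (gT : finGroupType) (c : tcocycle gT) (b : idx -> gT) :
  #|gT| = 27 -> bijective b -> is_tBH (fun x y => c (b x) (b y)) ->
  exists2 k, k < 16 & teq (class_mat k) (fun x y => c (b x) (b y)).
Proof.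
move=> cG bb bh; have [P [f [inf Nf]]] := ext_instance cG bb bh.
have card81 : #|{: central_ext c}| = 81 by rewrite card_central_ext cG.
have [k k16 kf] :=
  instance_classified card81 (@snd_mul_z _ c) inf (teq_tBH Nf bh).
by exists k => //; apply: teq_trans kf (teq_sym Nf).
Qed.

Local Open Scope group_scope.

Definition exact_inj (gT : finGroupType) (t y k : gT) : bool :=
  allw (fun x => allw (fun x' =>
    if ev 1 t y k (x, t0) == ev 1 t y k (x', t0) then xeqb x x' else true) idxs) idxs.

Lemma exact_injP (gT : finGroupType) (t y k : gT) :
  exact_inj t y k -> injective (fun x => ev 1 t y k (x, t0)).
Proof.
rewrite /exact_inj allwE => /allP h x x'; cbv beta => e; have := h x (mem_idxs x).
by rewrite allwE => /allP/(_ x' (mem_idxs x')); rewrite e eqxx xeqbE => /eqP.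
Qed.

(** The parameters of Z/27: y is the cube of t, and k the cube of y. *)
Definition cyclic_par : par := Par t1 t0 t0 t0 t0 t1 t0 t0.

Ltac decide_relations :=
  split; [by move=> ?; apply/commute_sym/commute1 | exact: expg1n | ..];
  by apply/eqP; vm_compute.

Lemma relations_Z27 :
  relations (1 : 'Z_27) (inZp 1 : 'Z_27) (inZp 3 : 'Z_27) (inZp 9 : 'Z_27) cyclic_par.
Proof. by decide_relations. Qed.

Lemma inj_Z27 : exact_inj (inZp 1 : 'Z_27) (inZp 3 : 'Z_27) (inZp 9 : 'Z_27).
Proof. by vm_compute. Qed.

Lemma relations_Z9Z3 :
  relations (1 : 'Z_9 * 'Z_3) (inZp 1 : 'Z_9, 1) (1, inZp 1 : 'Z_3) (inZp 3 : 'Z_9, 1)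
    (Par t0 t0 t0 t0 t0 t0 t1 t0).
Proof. by decide_relations. Qed.

Lemma inj_Z9Z3 :
  @exact_inj ('Z_9 * 'Z_3)%type (inZp 1 : 'Z_9, 1) (1, inZp 1 : 'Z_3) (inZp 3 : 'Z_9, 1).
Proof. by vm_compute. Qed.

Lemma relations_Z3cube :
  relations (1 : 'Z_3 * 'Z_3 * 'Z_3) (inZp 1 : 'Z_3, 1, 1) (1, inZp 1 : 'Z_3, 1)
    (1, 1, inZp 1 : 'Z_3) (Par t0 t0 t0 t0 t0 t0 t0 t0).
Proof. by decide_relations. Qed.

Lemma inj_Z3cube :
  @exact_inj ('Z_3 * 'Z_3 * 'Z_3)%type (inZp 1 : 'Z_3, 1, 1) (1, inZp 1 : 'Z_3, 1)
    (1, 1, inZp 1 : 'Z_3).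
Proof. by vm_compute. Qed.

Lemma presents_instance (gT : finGroupType) (z t y k : gT) P f :
  #|gT| = 81 -> presents z t y k P ->
  exists Phi : gT -> trit,
    (forall x d, Phi (x * tpow z d) = tadd (Phi x) d) /\ instance z Phi P f.
Proof.
move=> c81 pres; have [rel inj] := pres.
have [D ED DE] : bijective (ev z t y k).
  by apply: inj_card_bij inj _; rewrite card_prod card_idx card_trit c81.
exists (fun g => fev f (D g)); split.
  move=> g d; rewrite -(DE g); case: (D g) => u d0.
  by rewrite (ev_z _ _ _ rel) !ED /fev /= taddA.
by exists t, y, k, 1; split=> // x; rewrite mul1g ED.
Qed.

(** Any [f] is an instance on Z/27 x Z/3, and the tuple of this group is the last entry of [reps],
    whose list of solutions is empty. *)
Lemma cyclic_par_not_BH f : ~ is_tBH (gdev cyclic_par f).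
Proof.
have c27 : #|'Z_27| = 27 by rewrite card_ord.
have inj := exact_injP inj_Z27.
have pres := exact_presents (isT : exact_par cyclic_par) relations_Z27 inj.
have c81 : #|{: central_ext (trivial_cocycle 'Z_27)}| = 81 by rewrite card_central_ext c27.
have [Phi [PhiZ inf]] := presents_instance f c81 pres.
have dr : List.In (cyclic_par, (moves_10000100, leaves_10000100)) reps.
  by rewrite /reps; do 21!right; left.
by move=> /(rep_instance_classified c81 PhiZ dr inf)[].
Qed.

Lemma Z27_not_BH (h : 'Z_27 -> trit) (b : idx -> 'Z_27) :
  bijective b -> ~ is_tBH (fun x y => h (b x * b y)).
Proof.
move=> bb bh; have inj := exact_injP inj_Z27.
have c27 : #|'Z_27| = 27 by rewrite card_ord.
pose b0 x := ev 1 (inZp 1 : 'Z_27) (inZp 3 : 'Z_27) (inZp 9 : 'Z_27) (x, t0).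
have [b' bK Kb] := bb.
pose f := tab27 (fun x => h (b0 x)).
apply: (@cyclic_par_not_BH f); apply: teq_tBH bh.
have bi : injective (fun x => b' (b0 x)) by move=> x x' /(can_inj Kb)/inj.
exists (fun x => b' (b0 x)), (fun x => b' (b0 x)), (fun=> 0)%R, (fun=> 0)%R.
split=> // x x'; rewrite add0r addr0 !Kb /b0.
rewrite (exact_mul (isT : exact_par cyclic_par) relations_Z27) /gdev /fev.
by rewrite gmul_exact // tab27K taddC.
Qed.

(** Only v may be nonzero: the group is Z/3 x Z/3 x Z/3 for v = 0, and Z/9 x Z/3 with t^3 = k for v
    = 1. *)
Definition class_exact (d : class_data) : bool :=
  let: (P, f, _) := d in
  teqb (get27 f origin) t0 &&
  (let: Par p q l r s u v w := P in
   teqb p t0 && teqb q t0 && teqb l t0 && teqb r t0 && teqb s t0 && teqb u t0 && teqb w t0 &&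
   (teqb v t0 || teqb v t1)).

Lemma class_indexing n : n < 16 ->
  exists (gT : finGroupType) (c : tcocycle gT) (b : idx -> gT),
    [/\ #|gT| = 27, bijective b & teq (class_mat n) (fun x y => c (b x) (b y))].
Proof.
rewrite -size_classes => n16.
have ok : all class_exact bh_classes by vm_compute.
have := elimT (all_nthP class0) ok n n16.
rewrite /class_mat; case: (nth _ _ _) => [[[p q l r s u v w] f] y].
rewrite /class_exact /mat_of_class; cbn [fst snd].
case/andP=> /eqP f0; do 7![case/andP]; do 7![move/eqP=> ->].
case/orP => /eqP ->.
  have c27 : #|{: 'Z_3 * 'Z_3 * 'Z_3}| = 27 by rewrite !card_prod !card_ord.
  have inj := exact_injP inj_Z3cube.
  have [c cf] := exact_cocycle c27 (isT : exact_par (Par t0 t0 t0 t0 t0 t0 t0 t0)) relations_Z3cube inj f0.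
  by exists ('Z_3 * 'Z_3 * 'Z_3)%type, c; eexists; split; [| exact: exact_bij inj | exact: cf].
have c27 : #|{: 'Z_9 * 'Z_3}| = 27 by rewrite !card_prod !card_ord.
have inj := exact_injP inj_Z9Z3.
have [c cf] := exact_cocycle c27 (isT : exact_par (Par t0 t0 t0 t0 t0 t0 t1 t0)) relations_Z9Z3 inj f0.
by exists ('Z_9 * 'Z_3)%type, c; eexists; split; [| exact: exact_bij inj | exact: cf].
Qed.

Definition noncyclic_exact (P : par) : bool :=
  exact_par P && ~~ ((pp P != t0) && (pu P != t0)).

(** A balanced function vanishing at the identity for each tuple that a noncyclic group of order 27
    can have. *)
Definition exact_codes : seq positive := [::
  27410285401821184; 20708512717950976; 27410294605434880; 20993015409607696; 27682431771361360;
  29384472449257744; 28474069981922320; 24357482743992592; 25228299275092048; 28307100138557440;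
  20708512717950976; 24916592720872768; 27410314388131840; 28189580320572736; 27410294605434880;
  20694291001263616; 19796844607849984; 24084140786337280; 23107355803010560; 19703889551050240;
  18055656327235072; 23108798906516992; 27396668825683456; 24004956619425280; 27383706608042560;
  24033409703182912; 28240269070139968; 19863028199686720; 23954273864090176; 23173719939973696;
  19861585096180288; 18160162542027328; 28149788518482496]%positive.

Definition exact_func_ok (P : par) (h : positive) : bool :=
  let f := dec_func (dec h) in
  if is_tBHb (gdev P f) then teqb (get27 f origin) t0 else false.

Lemma exact_funcs_ok :
  all2w exact_func_ok
    (List.filter (fun P => noncyclic_exact P && consistent P) all_pars) exact_codes.
Proof. by vm_cast_no_check (erefl true). Qed.

(** The group is presented through its product with Z/3, which is again noncyclic; this brings it
    among finitely many tuples, each with a function at hand, and no list of the groups of order 27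
    is used. *)
Lemma noncyclic_indexing (gT : finGroupType) :
  #|gT| = 27 -> ~~ cyclic [set: gT] ->
  exists (c : tcocycle gT) (b : idx -> gT),
    bijective b /\ is_tBH (fun x y => c (b x) (b y)).
Proof.
move=> c27 ncG; pose c0 := trivial_cocycle gT; pose E := central_ext c0.
have c81 : #|{: E}| = 81 by rewrite card_central_ext c27.
have ncE : ~~ cyclic [set: E].
  apply: contra ncG => /cyclicP[e eE]; apply/cyclicP; exists e.1.
  apply/esym/eqP; rewrite eqEsubset subsetT; apply/subsetP => g _.
  have : (g, t0) \in <[e]> by rewrite -eE in_setT.
  by case/cycleP => i ei; rewrite -[g]/(g, t0).1 ei fst_exp mem_cycle.
have [t [y [k [P [rel inj]]]]] := presentation_exists c81 (@ext_zC _ c0) (order_ext_z c0) ncE.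
(* Projection to [gT] sends z to 1 and so erases the exponents of z. *)
pose Q := Par (pp P) t0 t0 (pr P) t0 (pu P) (pv P) t0.
have fX (x : E) a : (tpow x a).1 = tpow x.1 a by apply: fst_exp.
have fZ a : tpow (1 : gT) a = 1 by apply: expg1n.
have relQ : relations (1 : gT) t.1 y.1 k.1 Q.
  split=> /=; rewrite ?fZ ?mulg1.
  - by move=> x; apply/commute_sym/commute1.
  - exact: expg1n.
  - by rewrite -fst_exp (rel_k3 rel).
  - by have := congr1 fst (rel_yk rel).
  - by have := congr1 fst (rel_y3 rel); rewrite fst_exp fst_mul !fX fZ mulg1.
  - by have := congr1 fst (rel_tk rel); rewrite !fst_mul !fX fZ mulg1.
  - by have := congr1 fst (rel_ty rel); rewrite !fst_mul !fX fZ mulg1.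
  - by have := congr1 fst (rel_t3 rel); rewrite fst_exp !fst_mul !fX fZ mulg1.
have evE x d : (ev (ext_z c0 : E) t y k (x, d)).1 = ev 1 t.1 y.1 k.1 (x, t0).
  by case: x => [[n e] i]; rewrite /ev /eva !fst_mul !fX !fZ.
have injQ : injective (fun x => ev 1 t.1 y.1 k.1 (x, t0)).
  move=> x x'; cbv beta; rewrite -(evE x t0) -(evE x' t0) => e.
  set X := ev _ _ _ _ (x, t0) in e; set X' := ev _ _ _ _ (x', t0) in e.
  have : X * tpow (ext_z c0) (tadd X'.2 (topp X.2)) = X'.
    rewrite tpow_ext_z ext_mulE /= mulg1 e [RHS]surjective_pairing; congr (_, _).
    by case: (X.2); case: (X'.2).
  by rewrite /X (ev_z _ _ _ rel) => /inj [].
have exQ : exact_par Q by [].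
have consQ : consistent Q := presents_consistent (exact_presents exQ relQ injQ).
have ncQ : noncyclic_exact Q.
  (* If p and u are both nonzero, then t^9 = k^(u p) is not 1, so t has order 27 and generates the
     group. *)
  rewrite /noncyclic_exact exQ /=; apply: contra ncG => /andP[p0 u0].
  have t9 : t.1 ^+ 9 = tpow k.1 (tmul (pu P) (pp P)).
    rewrite (expgM _ 3 3) (rel_t3 relQ) fZ mulg1 expgMn; last exact/tpowC/(rel_yk relQ).
    rewrite -[tpow k.1 _ ^+ 3]expgM mulnC expgM (rel_k3 relQ) expg1n mulg1.
    rewrite -expgM mulnC expgM (rel_y3 relQ) fZ mulg1.
    exact: tpowM (rel_k3 relQ).
  apply/cyclicP; exists t.1; apply/eqP; rewrite eq_sym eqEcard subsetT cardsT c27.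
  rewrite -orderE; have : #[t.1] %| 27 by rewrite -c27 -cardsT order_dvdG ?in_setT.
  have : ~~ (#[t.1] %| 9).
    rewrite order_dvdn t9; apply/eqP => k0.
    have : ev 1 t.1 y.1 k.1 ((t0, t0, tmul (pu P) (pp P)), t0) = ev 1 t.1 y.1 k.1 (origin, t0).
      by rewrite [RHS]ev_gone /ev /eva k0 /tpow /= !mulg1.
    by move/injQ; case: (pp P) p0; case: (pu P) u0.
  move: #[t.1] => o o9 o27.
  have : o \in divisors 27 by rewrite -dvdn_divisors.
  by rewrite !inE => /or4P[] /eqP eo; rewrite eo in o9 *.
have Qin : List.In Q (List.filter (fun P => noncyclic_exact P && consistent P) all_pars).
  by apply/List.filter_In; split; [apply: in_all_pars | rewrite ncQ consQ].
have [h _] := all2w_in exact_funcs_ok Qin.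
rewrite /exact_func_ok; case: ifP => // /is_tBHP bh /eqP f0.
have [c cf] := exact_cocycle c27 exQ relQ injQ f0.
by exists c; eexists; split; [exact: exact_bij c27 injQ | exact: teq_tBH cf bh].
Qed.

Local Close Scope group_scope.

(** * Invariants of the classes *)

Local Open Scope group_scope.

Lemma class_group n : n < 16 ->
  exists (op : idx -> idx -> idx) (f : idx -> trit),
    [/\ commutative op, associative op, right_id origin op,
        forall a, injective (op a) & forall x y, class_mat n x y = f (op x y)].
Proof.
rewrite -size_classes => n16.
have ok : all class_exact bh_classes by vm_compute.
have := elimT (all_nthP class0) ok n n16.
rewrite /class_mat; case: (nth _ _ _) => [[P f] y].
rewrite /class_exact /mat_of_class; cbn [fst snd]; case/andP=> _ okP.
suff [exP [gT [g1 [g2 [g3 [cG rel inj abel]]]]]] : exact_par P /\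
    exists (gT : finGroupType) (g1 g2 g3 : gT), [/\ #|gT| = 27, relations 1 g1 g2 g3 P,
      injective (fun x => ev 1 g1 g2 g3 (x, t0)) & forall g h : gT, g * h = h * g].
  pose op x x' := (gmul P (x, t0) (x', t0)).1; exists op, (get27 f).
  have opE := exact_mul exP rel; split.
  - by move=> a b; apply: inj; rewrite -!opE.
  - by move=> a b c; apply: inj; rewrite -!opE mulgA.
  - by move=> a; apply: inj; rewrite -!opE [ev _ _ _ _ (origin, _)]ev_gone mulg1.
  - by move=> a b c abc; apply: inj; apply: (mulgI (ev 1 g1 g2 g3 (a, t0))); rewrite !opE -/(op _ _) abc.
  - by move=> a b; rewrite /gdev /fev gmul_exact // taddC.
move: P okP => [p q l r s u v w]; do 7![case/andP]; do 7![move/eqP=> ->].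
case/orP => /eqP ->; split=> //.
- exists ('Z_3 * 'Z_3 * 'Z_3)%type; do 3!eexists; split; last first.
  + by move=> [[a b] c] [[a' b'] c']; congr (_, _, _); apply: addrC.
  + exact: exact_injP inj_Z3cube.
  + exact: relations_Z3cube.
  + by rewrite !card_prod !card_ord.
- exists ('Z_9 * 'Z_3)%type; do 3!eexists; split; last first.
  + by move=> [a b] [a' b']; congr (_, _); apply: addrC.
  + exact: exact_injP inj_Z9Z3.
  + exact: relations_Z9Z3.
  + by rewrite !card_prod !card_ord.
Qed.

Lemma class_mat_sym n x y : n < 16 -> class_mat n x y = class_mat n y x.
Proof. by case/class_group=> op [f [opC _ _ _ E]]; rewrite !E opC. Qed.

(** A matrix [f(x + y)] is unchanged when a is added to the row index and subtracted from the column
    index. Row invariants may therefore be computed at [origin] alone. *)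
Lemma class_translate n a : n < 16 ->
  exists s u : idx -> idx, [/\ injective s, injective u, s origin = a
    & forall x y, class_mat n (s x) (u y) = class_mat n x y].
Proof.
case/class_group=> op [f [opC opA op1 opI E]]; have [v vK Kv] := injF_bij (opI a).
exists (op a), v; split=> //; first exact: can_inj Kv.
by move=> x y; rewrite !E [op a x]opC -opA Kv.
Qed.

Local Close Scope group_scope.

(** Entry k matches the negated exponents of class k; its leading digits name the conjugate
    class. *)
Definition conj_codes : seq positive := [::
  1074021376; 1180045380; 1075122280; 1251348560; 1680495944; 1160156184; 1411929428; 1343640612;
  1075122272; 1184174149; 1247088737; 1179979857; 1251283009; 1075187797; 1378160713; 1378160741]%positive.

Definition conj_index (k : nat) : nat :=
  nat_of_idx (dec_idx (dec (nth 1%positive conj_codes k)) 0).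

Lemma conj_codes_ok :
  all2w (fun d h => matched [seq trie_of_class d | d <- bh_classes] (tneg (mat_of_class d)) h)
    bh_classes conj_codes.
Proof. by vm_cast_no_check (erefl true). Qed.

Lemma all2w_nth (S T : Type) (r : S -> T -> bool) s t x0 y0 i :
  all2w r s t -> i < size s -> r (nth x0 s i) (nth y0 t i).
Proof.
elim: s t i => [|x s IH] [|y t] // i /=; case: ifP => // xy h.
by case: i => [//|i] /(IH _ i h).
Qed.

Lemma tneg_tBH M : is_tBH M -> is_tBH (tneg M).
Proof.
move=> bM x y /bM bal v; rewrite -(bal (- v)%R); apply: eq_card => j; rewrite !inE /tneg.
by rewrite -opprD eqr_oppLR.
Qed.

Lemma class_conj k : k < 16 -> conj_index k < 16 /\
  teq (class_mat (conj_index k)) (tneg (class_mat k)).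
Proof.
move=> k16; have bh := tneg_tBH (class_mat_BH k16); rewrite -size_classes in k16 *.
have := all2w_nth class0 1%positive conj_codes_ok k16.
rewrite /matched -[nat_of_idx _]/(conj_index k); move: (conj_index k) => i.
have [ilt|ige] := ltnP i (size bh_classes); last first.
  by rewrite nth_default ?size_map // matches_tip.
rewrite (nth_map class0) // => h; split=> //; apply: class_matches h => //.
have := classes_ok; rewrite allwE => /(all_nthP class0); exact.
Qed.

(** * Sums of three rows as invariants *)

Definition tcounts (s : seq trit) : nat * nat * nat :=
  foldr (fun v c => let: (a, b, d) := c in
    match v with t0 => (a.+1, b, d) | t1 => (a, b.+1, d) | t2 => (a, b, d.+1) end)
    (0, 0, 0) s.

Lemma tcountsE s : tcounts s = (count_mem t0 s, count_mem t1 s, count_mem t2 s).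
Proof. by elim: s => //= -[] s ->. Qed.

Definition rot3 (c : nat * nat * nat) : nat * nat * nat := (c.1.2, c.2, c.1.1).

Definition rot_invariant (q : nat * nat * nat -> bool) := forall c, q (rot3 c) = q c.

(** Permuting the columns preserves the three counts, and adding a constant rotates them. *)
Lemma tcounts_shift q (F G : idx -> trit) (u : idx -> idx) a :
  rot_invariant q -> injective u -> (forall y, G y = (a + F (u y))%R) ->
  q (tcounts [seq G y | y <- idxs]) = q (tcounts [seq F y | y <- idxs]).
Proof.
move=> qr ui GF; have [u' uK u'K] := injF_bij ui.
have E v : count_mem v [seq G y | y <- idxs] = count_mem (v - a)%R [seq F y | y <- idxs].
  rewrite !count_idxs -[LHS](card_image ui); apply: eq_card => y.
  rewrite -(u'K y) mem_image // !inE GF !u'K.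
  by rewrite [RHS]eq_sym subr_eq [(F y + a)%R]addrC eq_sym.
rewrite !tcountsE !E; case: a {GF E}.
- by [].
- by rewrite -qr.
- by rewrite -(qr (_, _, _)) -qr.
Qed.

Section Triples.

Variable q : nat * nat * nat -> bool.

(** Three rows are added because a column constant then enters three times and vanishes modulo 3,
    while the row constants merely rotate the counts. *)
Definition triple (M : tmat) (x j k : idx) : bool :=
  q (tcounts [seq tadd (tadd (M x y) (M j y)) (M k y) | y <- idxs]).

Definition profile (M : tmat) (x j : idx) : nat := count (triple M x j) idxs.

Definition triples (M : tmat) (x : idx) : nat := sumn [seq profile M x j | j <- idxs].

Lemma perm_inj_idxs (s : idx -> idx) : injective s -> perm_eq (map s idxs) idxs.
Proof.
move=> si; apply: uniq_perm; rewrite ?map_inj_uniq ?idxs_uniq // => x.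
have [s' sK s'K] := injF_bij si.
by rewrite mem_idxs -(s'K x) map_f ?mem_idxs.
Qed.

Variables (M N : tmat) (s u : idx -> idx) (r c : idx -> trit).
Hypotheses (qr : rot_invariant q) (si : injective s) (ui : injective u).
Hypothesis MN : forall x y, N x y = (r x + M (s x) (u y) + c y)%R.

Lemma triple_teq x j k : triple N x j k = triple M (s x) (s j) (s k).
Proof.
rewrite /triple; set F := fun y => _; set G := fun y => _.
apply: (@tcounts_shift q G F u (r x + r j + r k)%R) => // y.
rewrite /F /G !MN !taddE.
have c3 : (c y + c y + c y = 0)%R by case: (c y).
rewrite -[LHS]addr0 -{1}(oppr0 trit) -{1}c3; ring.
Qed.

Lemma profile_teq x j : profile N x j = profile M (s x) (s j).
Proof.
rewrite /profile -[RHS](seq.permP (perm_inj_idxs si)) count_map.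
by apply: eq_count => k; rewrite /= triple_teq.
Qed.

Lemma triples_teq x : triples N x = triples M (s x).
Proof.
rewrite /triples -(perm_sumn (perm_map (profile M (s x)) (perm_inj_idxs si))) -map_comp.
by congr sumn; apply: eq_map => j; apply: profile_teq.
Qed.

End Triples.

Lemma class_triples q n x : rot_invariant q -> n < 16 ->
  triples q (class_mat n) x = triples q (class_mat n) origin.
Proof.
move=> qr n16; have [s [u [si ui <- E]]] := class_translate x n16.
apply/esym/(@triples_teq q _ _ s u (fun=> 0%R) (fun=> 0%R)) => // x' y.
by rewrite E add0r addr0.
Qed.

Lemma teq_class_triples q n M x : rot_invariant q -> n < 16 -> teq (class_mat n) M ->
  triples q M x = triples q (class_mat n) origin.
Proof.
move=> qr n16 [s [u [r [c [si ui E]]]]].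
by rewrite (triples_teq qr si ui E) class_triples.
Qed.

Definition of_type (T c : nat * nat * nat) : bool :=
  [|| T == c, T == rot3 c | T == rot3 (rot3 c)].

Lemma of_type_rot T : rot_invariant (of_type T).
Proof. by case=> [[a b] c]; rewrite /of_type /rot3 /= orbA orbC. Qed.

(* Tabulating the matrix lets the kernel share the evaluation of its entries. *)
Definition memo (M : tmat) : tmat :=
  let T := tab27 (fun x => tab27 (M x)) in fun x => let r := get27 T x in get27 r.

Lemma memoE M : memo M = M.
Proof. by apply/funext => x; apply/funext => y; rewrite /memo !tab27K. Qed.

(** The numbers of triples of these three types, together, separate the sixteen classes. *)
Definition triple_types : seq (nat * nat * nat) := [:: (0, 9, 18); (3, 12, 12); (9, 9, 9)].

Definition spectrum (M : tmat) : seq nat :=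
  [seq triples (of_type T) M origin | T <- triple_types].

Lemma spectrum_teq n M : n < 16 -> teq (class_mat n) M -> spectrum M = spectrum (class_mat n).
Proof.
move=> n16 nM; apply: eq_map => T; exact: teq_class_triples (@of_type_rot T) n16 nM.
Qed.

Lemma spectra_uniq : uniq [seq spectrum (mat_of_class d) | d <- bh_classes].
Proof.
rewrite -(eq_map (fun d => congr1 spectrum (memoE (mat_of_class d)))).
by vm_cast_no_check (erefl true).
Qed.

Lemma spectrum_inj m n : m < 16 -> n < 16 ->
  spectrum (class_mat m) = spectrum (class_mat n) -> m = n.
Proof.
rewrite -size_classes => m16 n16 /eqP.
rewrite /class_mat -!(nth_map class0 [::] (fun d => spectrum (mat_of_class d))) //.
by rewrite nth_uniq ?spectra_uniq ?size_map // => /eqP.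
Qed.

Lemma class_teq_inj m n : m < 16 -> n < 16 -> teq (class_mat m) (class_mat n) -> m = n.
Proof. by move=> m16 n16 /(spectrum_teq m16)/esym; apply: spectrum_inj. Qed.

Definition multiples9 (c : nat * nat * nat) : bool :=
  let ok n := (n == 0) || (n == 9) || (n == 18) || (n == 27) in
  [&& ok c.1.1, ok c.1.2 & ok c.2].

Lemma multiples9_rot : rot_invariant multiples9.
Proof. by case=> [[a b] c]; rewrite /multiples9 /= andbA andbC. Qed.

Definition all_multiples9 (M : tmat) : bool := triples multiples9 M origin == 27 * 27.

Lemma all_multiples9_ok :
  all (fun n => all_multiples9 (memo (class_mat n)) ==> (n \in [:: 0; 2; 8])) (iota 0 16).
Proof. by vm_cast_no_check (erefl true). Qed.

Lemma all_multiples9_class n :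
  n < 16 -> all_multiples9 (class_mat n) -> n \in [:: 0; 2; 8].
Proof.
move=> n16; have /(allP all_multiples9_ok)/implyP : n \in iota 0 16 by rewrite mem_iota.
by rewrite memoE.
Qed.

Lemma all_multiples9_teq n M : n < 16 -> teq (class_mat n) M ->
  all_multiples9 M = all_multiples9 (class_mat n).
Proof. by move=> n16 nM; rewrite /all_multiples9 (teq_class_triples _ multiples9_rot n16 nM). Qed.

(** * Kronecker products *)

Definition uniform (T : finType) (m : nat) (F : T -> trit) : Prop :=
  forall v, #|[pred y | F y == v]| = m.

Definition is_gBH (S T : finType) (m : nat) (M : S -> T -> trit) : Prop :=
  forall x y, x != y -> uniform m (fun j => M x j - M y j)%R.

Lemma card_joint (T : finType) (u v : T -> trit) (q : trit -> trit -> bool) :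
  #|[pred y | q (u y) (v y)]| =
  \sum_s \sum_t q s t * #|[pred y | (u y == s) && (v y == t)]|.
Proof.
under [RHS]eq_bigr => s _ do under eq_bigr => t _ do
  rewrite -sum1_card big_mkcond /= big_distrr /=.
under [RHS]eq_bigr => s _ do rewrite exchange_big /=.
rewrite exchange_big /= -sum1_card big_mkcond /=; apply: eq_bigr => y _.
rewrite (bigD1 (u y)) //= (bigD1 (v y)) //= !inE !eqxx /= muln1.
rewrite !big1 ?addn0; first by case: (q _ _).
- by move=> s su; apply: big1 => t _; rewrite !inE [u y == s]eq_sym (negPf su) muln0.
- by move=> t tv; rewrite !inE eqxx [v y == t]eq_sym (negPf tv) muln0.
Qed.

Lemma sum_trit (F : trit -> nat) : \sum_t F t = F t0 + F t1 + F t2.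
Proof.
rewrite (bigD1 t0) //= (bigD1 t1) //= (bigD1 t2) //= big1 ?addn0 ?addnA //.
by case.
Qed.

(* Summing over the four lines of the affine plane through a point [p] counts
   every other point once and [p] four times. *)
Lemma uniform_sum (T : finType) (m : nat) (u v : T -> trit) :
  uniform m u -> uniform m v -> uniform m (fun y => v y - u y)%R ->
  forall w, 3 %| #|[pred y | (u y + v y)%R == w]|.
Proof.
move=> hu hv hd w.
have E q : _ := card_joint u v q.
pose n s t := #|[pred y | (u y == s) && (v y == t)]|.
have U s : #|[pred y | u y == s]| = _ := E (fun a b => a == s).
have V s : #|[pred y | v y == s]| = _ := E (fun a b => b == s).
have D s : #|[pred y | (v y - u y)%R == s]| = _ := E (fun a b => (b - a)%R == s).
rewrite (E (fun a b => (a + b)%R == w)).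
move: (U t0) (U t1) (U t2) (V t0) (V t1) (V t2) (D t0) (D t1) (D t2).
rewrite !hu !hv !hd !sum_trit -!/(n _ _).
move: {E U V D hu hv hd u v}n => n; case: w => /=; rewrite !(mul1n, mul0n, add0n, addn0).
- by move=> *; apply/dvdnP; exists (n t0 t0); lia.
- by move=> *; apply/dvdnP; exists (n t0 t1); lia.
- by move=> *; apply/dvdnP; exists (n t0 t2); lia.
Qed.

Definition same_or_uniform (T : finType) m (a b : T -> trit) : Prop :=
  a =1 b \/ uniform m (fun y => a y - b y)%R.

Lemma uniform_oppB (T : finType) m (F G : T -> trit) :
  uniform m (fun y => F y - G y)%R -> uniform m (fun y => G y - F y)%R.
Proof.
move=> h v; rewrite -(h (- v)%R); apply: eq_card => y; rewrite !inE.
by rewrite -eqr_oppLR opprB.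
Qed.

Section RowTriple.

Variables (T : finType) (m : nat) (a b c : T -> trit).
Hypotheses (card_T : #|T| = 3 * m) (ab : same_or_uniform m a b)
  (ac : same_or_uniform m a c) (bc : same_or_uniform m b c).

(** Modulo 3, a + b + c = (b - a) + (c - a). For three pairwise distinct rows this is [uniform_sum];
    if exactly two agree it is plus or minus one difference, and if all agree it is 0. *)
Lemma row_triple :
  (forall v, 3 %| #|[pred y | (a y + b y + c y)%R == v]|) \/
  uniform m (fun y => a y + b y + c y)%R.
Proof.
have t3 (x : trit) : (x + x + x = 0)%R by case: x.
have const v (F : T -> trit) d : F =1 (fun=> d) -> 3 %| #|[pred y | F y == v]|.
  move=> Fd; rewrite (eq_card (B := [pred y | d == v])); last by move=> y; rewrite !inE Fd.
  by case: eqP => _; [rewrite (eq_card (B := predT)) // card_T dvdn_mulr | rewrite eq_card0].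
have U (F G : T -> trit) : F =1 G -> uniform m F -> uniform m G.
  by move=> FG h v; rewrite -(h v); apply: eq_card => y; rewrite !inE FG.
case: ab => [E|uab].
  case: ac => [E'|/uniform_oppB uac]; [left=> v | right].
    by apply: (const v _ 0%R) => y; rewrite -E -E' t3.
  by apply: U uac => y; rewrite -E -[LHS]addr0 -(t3 (a y)); ring.
case: ac => [E|uac].
  by right; apply: U (uniform_oppB uab) => y; rewrite -E -[LHS]addr0 -(t3 (a y)); ring.
case: bc => [E|ubc].
  by right; apply: U uab => y; rewrite -E -[LHS]addr0 -(t3 (b y)); ring.
left=> v; rewrite (eq_card (B := [pred y | ((b y - a y) + (c y - a y))%R == v])); last first.
  by move=> y; rewrite !inE -[in RHS](addr0 (_ + _)%R) -(t3 (a y)); congr (_ == _); ring.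
apply: (@uniform_sum _ m); try exact: uniform_oppB.
by apply: U (uniform_oppB ubc) => y; ring.
Qed.

End RowTriple.

Lemma is_gBH_same (S T : finType) m (M : S -> T -> trit) x y :
  is_gBH m M -> same_or_uniform m (M x) (M y).
Proof. by move=> bM; have [->|/bM] := eqVneq x y; [left | right]. Qed.

Lemma card_add_pair (S T : finType) (F : S -> trit) (G : T -> trit) v :
  #|[pred y : S * T | (F y.1 + G y.2)%R == v]| = \sum_x #|[pred z | G z == v - F x]%R|.
Proof.
rewrite -sum1_card; under [RHS]eq_bigr => x _ do rewrite -sum1_card.
rewrite pair_big_dep /=; apply: eq_bigl => -[x z]; rewrite !inE /=.
by rewrite [RHS]eq_sym subr_eq [(G z + _)%R]addrC eq_sym.
Qed.

(** A sum of three rows has the form F(y1) + G(y2), and its counts are the convolution of those of F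
    and G. By [row_triple], the three values of G are either all distinct or all equal, and the
    counts of F are multiples of 3. *)
Lemma kron_multiples9 (A : trit * trit -> trit * trit -> trit) (B : trit -> trit -> trit) :
  is_gBH 3 A -> is_gBH 1 B -> all_multiples9 (fun x y => A x.1 y.1 + B x.2 y.2)%R.
Proof.
move=> bA bB; rewrite /all_multiples9 /triples; set K := fun x y => _.
have pE x j : profile multiples9 K x j = 27.
  rewrite /profile -[RHS]/(size idxs); apply/eqP; rewrite -all_count; apply/allP => k _.
  rewrite /triple tcountsE !count_idxs.
  pose F y := (A x.1 y + A j.1 y + A k.1 y)%R; pose G y := (B x.2 y + B j.2 y + B k.2 y)%R.
  have E v : #|[pred y | tadd (tadd (K x y) (K j y)) (K k y) == v]| =
      \sum_x #|[pred z | G z == v - F x]%R|.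
    rewrite -card_add_pair; apply: eq_card => y; rewrite !inE !taddE /K /F /G; congr (_ == _).
    ring.
  suff E9 w : exists n, \sum_x #|[pred z | G z == w - F x]%R| = 9 * n.
    have le27 v : #|[pred y | tadd (tadd (K x y) (K j y)) (K k y) == v]| <= 27.
      by rewrite -card_idx max_card.
    have m9 v : let n := #|[pred y | tadd (tadd (K x y) (K j y)) (K k y) == v]| in
        (n == 0) || (n == 9) || (n == 18) || (n == 27).
      by move: (le27 v); rewrite E; case: (E9 v) => n ->; case: n => [|[|[|[|n]]]] //; lia.
    by apply/and3P; split; apply: m9.
  have cardA : #|{: trit * trit}| = 3 * 3 by rewrite card_prod card_trit.
  have [G3|G1] : (forall v, 3 %| #|[pred y | G y == v]|) \/ uniform 1 G.
  - by apply: row_triple; rewrite ?card_trit //; apply: is_gBH_same.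
  - pose g v := #|[pred y | G y == v]|.
    have gsum : g t0 + g t1 + g t2 = 3.
      rewrite -sum_trit -card_trit -sum1_card [RHS](partition_big G predT) //=.
      by apply: eq_bigr => v _; rewrite /g -sum1_card; apply: eq_bigl => i; rewrite !inE.
    (* Counts that are divisible by 3 and have sum 3: G is constant. *)
    have [z gz] : exists z, forall v, g v = 3 * (v == z).
      have /dvdnP[n0 e0] : 3 %| g t0 := G3 t0.
      have /dvdnP[n1 e1] : 3 %| g t1 := G3 t1.
      have /dvdnP[n2 e2] : 3 %| g t2 := G3 t2.
      rewrite e0 e1 e2 in gsum.
      have [?|?] : n0 = 1 \/ n0 = 0 by lia.
        by exists t0; case; rewrite ?e0 ?e1 ?e2 /=; lia.
      have [?|?] : n1 = 1 \/ n1 = 0 by lia.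
        by exists t1; case; rewrite ?e0 ?e1 ?e2 /=; lia.
      by exists t2; case; rewrite ?e0 ?e1 ?e2 /=; lia.
    have [n Fn] : exists n, #|[pred x | F x == w - z]%R| = 3 * n.
      have [F3|F1] : (forall v, 3 %| #|[pred y | F y == v]|) \/ uniform 3 F.
      + by apply: row_triple; rewrite ?cardA //; apply: is_gBH_same.
      + by case/dvdnP: (F3 (w - z)%R) => n ->; exists n; rewrite mulnC.
      + by exists 1; rewrite F1.
    exists n; under eq_bigr => y _ do rewrite -/(g _) gz.
    rewrite -big_distrr /= -[9]/(3 * 3) -mulnA -Fn; congr (_ * _).
    rewrite -sum1_card [RHS]big_mkcond /=; apply: eq_bigr => y _; rewrite !inE.
    by rewrite subr_eq [X in (_ == X)%R]addrC -subr_eq eq_sym; case: eqP.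
  (* G takes each value once, so every count of the sum is 9. *)
  - exists 1; under eq_bigr => y _ do rewrite G1.
    by rewrite sum1_card cardA.
under eq_map => j do rewrite pE.
by rewrite /idxs.
Qed.

(** * Automorphisms of prime order *)

Local Open Scope group_scope.

Lemma perm_fix_mod (T : finType) (s : {perm T}) p (S : {set T}) :
  prime p -> s ^+ p = 1 -> (forall x, x \in S -> s x \in S) ->
  #|S| = #|[set x in S | s x == x]| %[mod p].
Proof.
move=> p_pr sp Ss.
have pG : p.-group <[s]>.
  rewrite /pgroup -orderE; have : #[s] %| p by rewrite order_dvdn sp.
  case/primeP: (p_pr) => _ h /h /orP[] /eqP ->; rewrite ?pnat_id //.
have aG : [acts <[s]>, on S | 'P].
  by rewrite cycle_subG !inE; apply/subsetP => x xS; rewrite !inE /= apermE Ss.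
rewrite (pgroup_fix_mod pG aG) afix_cycle ?inE //; congr (_ %% _); apply: eq_card => x.
by rewrite !inE sub1set !inE /= apermE.
Qed.

Lemma perm_fix_exists (T : finType) (s : {perm T}) p (S : {set T}) :
  prime p -> s ^+ p = 1 -> (forall x, x \in S -> s x \in S) -> ~~ (p %| #|S|) ->
  exists2 x, x \in S & s x = x.
Proof.
move=> p_pr sp Ss; rewrite /dvdn (perm_fix_mod p_pr sp Ss).
have [->|[x]] := set_0Vmem [set x in S | s x == x]; first by rewrite cards0 mod0n.
by rewrite !inE => /andP[xS /eqP sx]; exists x.
Qed.

Lemma perm_fix_small (T : finType) (s : {perm T}) p (S : {set T}) :
  prime p -> s ^+ p = 1 -> (forall x, x \in S -> s x \in S) -> #|S| < p ->
  forall x, x \in S -> s x = x.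
Proof.
move=> p_pr sp Ss lt x xS; have := perm_fix_mod p_pr sp Ss.
have sub : [set x in S | s x == x] \subset S by apply/subsetP => y; rewrite !inE => /andP[].
rewrite !modn_small // ?(leq_ltn_trans (subset_leq_card sub)) // => e.
have : [set x in S | s x == x] == S by rewrite eqEcard sub e leqnn.
by move/eqP/setP/(_ x); rewrite xS !inE xS /= => /eqP.
Qed.

Lemma card_preim_seq (T : finType) (t t' : T -> T) (A : seq T) :
  cancel t t' -> cancel t' t -> uniq A -> #|[set j | t' j \in A]| = size A.
Proof.
move=> tK Kt; rewrite -(map_inj_uniq (can_inj tK)) -(size_map t) => /card_uniqP <-.
by apply: eq_card => j; rewrite inE -{2}(Kt j) mem_map //; apply: can_inj tK.
Qed.

Lemma count_idxsE (P : pred idx) : count P idxs = #|P|.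
Proof. by rewrite (seq.permP perm_idxs) enumT cardE /enum_mem size_filter; apply: eq_count. Qed.

Definition labelled := ({perm idx} * {ffun idx -> trit})%type.

Definition relabel (w : labelled) (x : idx * trit) : idx * trit :=
  (w.1 x.1, (x.2 + w.2 x.1)%R).

Lemma relabel_inj w : injective (relabel w).
Proof. by move=> [x a] [y b] [/perm_inj -> /addIr ->]. Qed.

(** A monomial matrix acts on the 81 pairs of an index and a cube root of unity. In this way
    automorphisms form a subgroup of a finite group, to which Cauchy's theorem applies. *)
Definition wperm (w : labelled) : {perm idx * trit} := perm (@relabel_inj w).

Lemma wpermE w x a : wperm w (x, a) = (w.1 x, (a + w.2 x)%R).
Proof. by rewrite permE. Qed.

Lemma wperm_inj : injective wperm.
Proof.
move=> [s r] [s' r'] /permP e; congr (_, _).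
  by apply/permP => x; have := e (x, t0); rewrite !wpermE => -[].
apply/ffunP => x; have := e (x, t0); rewrite !wpermE => -[_] /=.
by case: (r x); case: (r' x).
Qed.

Definition wmul (w w' : labelled) : labelled :=
  (w.1 * w'.1, [ffun x => w.2 x + w'.2 (w.1 x)]%R).

Lemma wpermM w w' : wperm (wmul w w') = wperm w * wperm w'.
Proof.
by apply/permP => -[x a]; rewrite permM !wpermE /= permM ffunE addrA.
Qed.

Lemma wpermX w n x a :
  (wperm w ^+ n) (x, a) = ((w.1 ^+ n) x, (a + \sum_(i < n) w.2 ((w.1 ^+ i)%g x))%R).
Proof.
elim: n => [|n IH]; first by rewrite !expg0 !perm1 big_ord0 addr0.
by rewrite !expgSr !permM IH wpermE big_ord_recr /= addrA.
Qed.

Definition isos (M N : tmat) : {set labelled * labelled} :=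
  [set a : labelled * labelled | [forall x, forall y,
    N x y == (a.1.2 x + M (a.1.1 x) (a.2.1 y) + a.2.2 y)%R]].

Lemma in_isos M N (a : labelled * labelled) : reflect
  (forall x y, N x y = (a.1.2 x + M (a.1.1 x) (a.2.1 y) + a.2.2 y)%R) (a \in isos M N).
Proof.
rewrite inE; apply: (iffP forallP) => [h x y|h x]; last by apply/forallP => y; rewrite -h.
by apply/eqP; move: (h x) => /forallP.
Qed.

Lemma isos_mul M N K a b : a \in isos M N -> b \in isos N K ->
  (wmul b.1 a.1, wmul b.2 a.2) \in isos M K.
Proof.
move=> /in_isos aM /in_isos bM; apply/in_isos => x y /=; rewrite !ffunE !permM bM aM.
by rewrite !addrA [LHS]addrAC.
Qed.

Lemma teq_isos M N : teq M N -> exists a, a \in isos M N.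
Proof.
case=> s [u] [r] [c] [si ui MN].
exists ((perm si, [ffun x => r x]), (perm ui, [ffun y => c y])).
by apply/in_isos => x y; rewrite /= !ffunE !permE.
Qed.

Definition auts (M : tmat) := isos M M.

Lemma wmul_injl w : injective (wmul w).
Proof. by move=> a b /(congr1 wperm); rewrite !wpermM => /mulgI/wperm_inj. Qed.

Lemma wmul_injr w : injective (wmul^~ w).
Proof. by move=> a b /(congr1 wperm); rewrite !wpermM => /mulIg/wperm_inj. Qed.

(** Composition with a fixed isomorphism embeds [auts M] in [isos M N], and the latter in
    [auts N]. *)
Lemma leq_card_auts M N : teq M N -> #|auts M| <= #|auts N|.
Proof.
move=> MN; have [e eMN] := teq_isos MN; have [e' eNM] := teq_isos (teq_sym MN).
apply: (@leq_trans #|isos M N|).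
  rewrite -(card_imset _ (f := fun a => (wmul e.1 a.1, wmul e.2 a.2))); last first.
    move=> [a b] [a' b'] e0; congr (_, _); first exact: wmul_injl (congr1 fst e0).
    exact: wmul_injl (congr1 snd e0).
  by apply/subset_leq_card/subsetP => _ /imsetP[a aM ->]; apply: isos_mul aM eMN.
rewrite -(card_imset _ (f := fun a => (wmul a.1 e'.1, wmul a.2 e'.2))); last first.
  move=> [a b] [a' b'] e0; congr (_, _); first exact: wmul_injr (congr1 fst e0).
  exact: wmul_injr (congr1 snd e0).
by apply/subset_leq_card/subsetP => _ /imsetP[a aM ->]; apply: isos_mul eNM aM.
Qed.

Lemma card_auts_teq M N : teq M N -> #|auts M| = #|auts N|.
Proof. by move=> MN; apply/eqP; rewrite eqn_leq !leq_card_auts //; apply: teq_sym. Qed.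

Definition aut_perms (M : tmat) : {set {perm idx * trit} * {perm idx * trit}} :=
  [set (wperm a.1, wperm a.2) | a : labelled * labelled in auts M].

Lemma card_aut_perms M : #|aut_perms M| = #|auts M|.
Proof. by apply: card_imset => -[a b] [a' b'] [/wperm_inj -> /wperm_inj ->]. Qed.

Lemma aut_perms_group M : group_set (aut_perms M).
Proof.
apply/group_setP; split.
  apply/imsetP; exists (((1, [ffun=> 0%R]), (1, [ffun=> 0%R])) : labelled * labelled).
    by apply/in_isos => x y /=; rewrite !perm1 !ffunE addr0 add0r.
  by congr (_, _); apply/permP => -[x a]; rewrite wpermE !perm1 ffunE addr0.
move=> _ _ /imsetP[a aM ->] /imsetP[b bM ->].
apply/imsetP; exists (wmul a.1 b.1, wmul a.2 b.2); first exact: isos_mul bM aM.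
by rewrite /= !wpermM.
Qed.

Definition balanced_profile : tmat -> idx -> idx -> nat := profile (of_type (9, 9, 9)).

Definition aut_cell (M : tmat) (w : idx) : seq idx :=
  let n := balanced_profile M origin w in
  [seq j <- idxs | ~~ xeqb j origin && (balanced_profile M origin j == n)].

Definition joint (M : tmat) (x j k y : idx) : trit * trit :=
  (tadd (M j y) (topp (M x y)), tadd (M k y) (topp (M x y))).

Definition pair_teqb (v v' : trit * trit) : bool :=
  teqb v.1 v'.1 && teqb v.2 v'.2.

Lemma pair_teqbE v v' : pair_teqb v v' = (v == v').
Proof. by case: v v' => [a b] [a' b']. Qed.

(** The sizes have no prime factor above 3, so an automorphism of prime order p >= 5 fixing [origin]
    fixes a row in each cell. The bound 4 on repeated joint values leaves no room for a p-cycle of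
    columns. *)
Definition aut_rigid (M : tmat) (w1 w2 : idx) : bool :=
  let sizes := [:: 2; 6; 8; 12; 18; 24] in
  let c1 := aut_cell M w1 in let c2 := aut_cell M w2 in
  [&& size c1 \in sizes, size c2 \in sizes &
    all (fun j => all (fun k =>
      let L := [seq joint M origin j k y | y <- idxs] in
      all (fun v => count (pair_teqb v) L <= 4) L) c2) c1].

Section PrimeAutomorphism.

Variables (M : tmat) (w1 w2 : idx) (p : nat) (a : labelled * labelled).
Hypotheses (bhM : is_tBH M) (rigid : aut_rigid M w1 w2).
Hypothesis homog : forall z, exists s u : idx -> idx,
  [/\ injective s, injective u, s origin = z & forall x y, M (s x) (u y) = M x y].
Hypotheses (p_pr : prime p) (p5 : 5 <= p) (aM : a \in auts M).
Hypotheses (ap1 : wperm a.1 ^+ p = 1) (ap2 : wperm a.2 ^+ p = 1).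

Let s := a.1.1.
Let u := a.2.1.
Let r := a.1.2.
Let c := a.2.2.

Let autE x y : M x y = (r x + M (s x) (u y) + c y)%R.
Proof. by move/in_isos: aM; apply. Qed.

Lemma wperm_pow (w : labelled) : wperm w ^+ p = 1 ->
  w.1 ^+ p = 1 /\ forall x, (\sum_(i < p) w.2 ((w.1 ^+ i)%g x) = 0)%R.
Proof.
move/permP => e; split; last first.
  by move=> x; have := e (x, t0); rewrite wpermX perm1 => -[_]; rewrite add0r.
by apply/permP => x; have := e (x, t0); rewrite wpermX !perm1 => -[].
Qed.

Let sp : s ^+ p = 1. Proof. by case: (wperm_pow ap1). Qed.
Let up : u ^+ p = 1. Proof. by case: (wperm_pow ap2). Qed.

Lemma mulrn_prime_eq0 (d : trit) : (d *+ p = 0)%R -> d = 0%R.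
Proof.
have d3 : (d *+ 3 = 0)%R by case: (d).
rewrite (divn_eq p 3) mulrnDr mulnC mulrnA d3 mul0rn add0r.
have : p %% 3 != 0.
  apply: contraTneq p_pr => p0; apply/negP => /primeP[_ /(_ 3)].
  by rewrite /dvdn p0 => /(_ isT) /=; move: p5; lia.
have : p %% 3 < 3 by rewrite ltn_mod.
by case: (p %% 3) => [|[|[|]]] //; case: (d).
Qed.

(** Going p times along [u] adds p d and returns to the start; p is not 3. *)
Lemma shift_zero (L : idx -> trit) d : (forall y, L (u y) = L y + d)%R -> d = 0%R.
Proof.
move=> Lu; apply: mulrn_prime_eq0.
have it n y : (L ((u ^+ n)%g y) = L y + d *+ n)%R.
  elim: n => [|n IH]; first by rewrite expg0 perm1 mulr0n addr0.
  by rewrite expgSr permM Lu IH mulrSr addrA.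
by have := it p origin; rewrite up perm1 -{1}[L origin]addr0 => /addrI.
Qed.

Lemma p_ndvd n : n \in [:: 2; 6; 8; 12; 18; 24; 27] -> ~~ (p %| n).
Proof.
move=> nin; apply/negP => pn.
(* All these sizes divide 216. *)
have /allP/(_ n nin) n216 : all (fun n => n %| 2 ^ 3 * 3 ^ 3) [:: 2; 6; 8; 12; 18; 24; 27].
  by [].
have := dvdn_trans pn n216; rewrite Euclid_dvdM // !Euclid_dvdX //.
by case/orP => /andP[/dvdn_leq h _]; move: (h isT) p5; lia.
Qed.

(** Cells are computed at [origin] and carried by [t] to the fixed row x0. There [s] preserves the
    profile relative to x0, hence the cell, whose size is prime to p. *)
Lemma cell_fixed x0 (t : idx -> idx) w : s x0 = x0 -> injective t ->
  (forall j, balanced_profile M origin j = balanced_profile M x0 (t j)) -> t origin = x0 ->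
  size (aut_cell M w) \in [:: 2; 6; 8; 12; 18; 24] ->
  exists2 j, j \in aut_cell M w & s (t j) = t j.
Proof.
move=> sx ti prof t0x sz.
have bpE x j : balanced_profile M x j = balanced_profile M (s x) (s j).
  exact: profile_teq (@of_type_rot _) (@perm_inj _ s) (@perm_inj _ u) autE x j.
have uA : uniq (aut_cell M w) by apply: filter_uniq idxs_uniq.
have memA z : (z \in aut_cell M w) =
    (z != origin) && (balanced_profile M origin z == balanced_profile M origin w).
  by rewrite mem_filter mem_idxs andbT xeqbE.
move: (balanced_profile M) (aut_cell M w) bpE prof sz uA memA => bp A bpE prof sz uA memA.
have [t' tK Kt] := injF_bij ti.
pose S := [set j | t' j \in A].
have cS : #|S| = size A by apply: card_preim_seq tK Kt uA.
have Ss j : j \in S -> s j \in S.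
  have E z : (t' z \in A) = (z != x0) && (bp x0 z == bp origin w).
    by rewrite memA prof Kt -(inj_eq ti) Kt t0x.
  rewrite !inE !E => /andP[jx /eqP <-]; apply/andP; split.
    by rewrite -[X in _ != X]sx (inj_eq (@perm_inj _ s)).
  by rewrite [X in _ == X]bpE sx.
have [|j] := perm_fix_exists p_pr sp Ss.
  rewrite cS; apply: p_ndvd; move: (size A) sz => n; rewrite !inE.
  by do 5![case/orP=> [/eqP -> //|]]; move/eqP ->.
by rewrite inE => jS sj; exists (t' j); rewrite ?Kt.
Qed.

Lemma rigid_trivial : wperm a.1 = 1 /\ wperm a.2 = 1.
Proof.
have [x0 _ sx0] : exists2 x0, x0 \in [set: idx] & s x0 = x0.
  apply: (perm_fix_exists p_pr sp) => //.
  by rewrite cardsT card_idx; apply: p_ndvd.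
have [t [v [ti vi t0x tv]]] := homog x0.
have prof j : balanced_profile M origin j = balanced_profile M x0 (t j).
  rewrite /balanced_profile -t0x.
  apply: (@profile_teq _ M M t v (fun=> 0%R) (fun=> 0%R) (@of_type_rot _)) => // x y.
  by rewrite tv add0r addr0.
case/and3P: rigid => sz1 sz2 /allP lab.
have [j j1 sj] := cell_fixed sx0 ti prof t0x sz1.
have [k k2 sk] := cell_fixed sx0 ti prof t0x sz2.
have {lab} /allP lab := allP (lab j j1) k k2.
pose L y := joint M x0 (t j) (t k) y.
have Lv y : L (v y) = joint M origin j k y by rewrite /L /joint -t0x !tv.
have [v' vK Kv] := injF_bij vi.
have small y : #|[set y' | L y' == L y]| <= 4.
  have := lab (L y); rewrite -{1}(Kv y) Lv map_f ?mem_idxs // => /(_ isT).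
  apply: leq_trans; rewrite count_map count_idxsE -[leqRHS](card_image vi).
  apply/subset_leq_card/subsetP => z; rewrite inE -(Kv z) => /eqP Lz.
  by rewrite mem_image // inE -Lv Lz pair_teqbE.
(* Along [u], the difference of two fixed rows is shifted by a constant, which is 0 by
   [shift_zero]. *)
have Lu y : L (u y) = L y.
  have E z z' y' : s z = z -> s z' = z' ->
      (M z (u y') - M z' (u y') = (M z y' - M z' y') + (r z' - r z))%R.
    by move=> sz sz'; rewrite (autE z y') (autE z' y') sz sz'; ring.
  have D z z' : s z = z -> s z' = z' -> (r z' - r z = 0)%R.
    move=> sz sz'; apply: (shift_zero (L := fun y => M z y - M z' y)%R) => y'.
    exact: E.
  by rewrite /L /joint; congr (_, _); rewrite !taddE !toppE E // D ?addr0.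
(* The fibres of [L] are stable and have fewer than p elements. *)
have u1 y : u y = y.
  pose S := [set y' | L y' == L y].
  have Su y' : y' \in S -> u y' \in S by rewrite !inE Lu.
  have yS : y \in S by rewrite inE.
  have lt : #|S| < p by exact: leq_ltn_trans (small y) p5.
  exact: perm_fix_small p_pr up Su lt _ yS.
have cE y : c y = (- r x0)%R.
  by have := autE x0 y; rewrite sx0 u1 ; case: (M x0 y); case: (r x0); case: (c y).
(* With all columns fixed, rows x and s x differ by a constant, which balance forbids if they are
   distinct. *)
have s1 x : s x = x.
  apply/eqP/negPn/negP => sx; have /bhM/(_ (r x - r x0)%R) : x != s x by rewrite eq_sym.
  rewrite (@eq_card _ _ predT) ?card_idx // => y; rewrite !inE (autE x y) u1 cE.
  by apply/eqP; ring.
have rE x : r x = r x0.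
  have := autE x origin; rewrite s1 u1 cE.
  by case: (M x origin); case: (r x0); case: (r x).
(* All row labels are equal by now, and the p-th power is trivial, so p (r x0) = 0. *)
have r0 : (r x0 = 0)%R.
  apply: mulrn_prime_eq0; have [_ /(_ x0)] := wperm_pow ap1.
  under eq_bigr => i _ do rewrite rE.
  by rewrite big_const_ord iter_addr addr0.
split; apply/permP => -[x d]; rewrite wpermE perm1.
  by rewrite s1 rE r0 addr0.
by rewrite u1 cE r0 oppr0 addr0.
Qed.

End PrimeAutomorphism.

Lemma smooth_23 n : 0 < n -> (forall p, prime p -> p %| n -> p < 5) ->
  exists a b, n = (2 ^ a * 3 ^ b)%N.
Proof.
move=> n0 small; have [b bE] : exists b, (n`_2^' = 3 ^ b)%N.
  suff /p_natP[b bE] : 3.-nat (n`_2^')%N by exists b.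
  apply/pnatP; first exact: part_gt0.
  move=> p p_pr pn; have := small p p_pr (dvdn_trans pn (dvdn_part _ _)).
  have /(pnatP _ (part_gt0 _ _))/(_ p p_pr pn) := part_pnat 2^'%N n.
  by rewrite !inE; case: p p_pr {pn} => [|[|[|[|[|p]]]]].
by exists (logn 2 n), b; rewrite -{1}(partnC 2 n0) bE p_part.
Qed.

(** Entry k serves class k + 1. Class 0 is the generalized Sylvester matrix, on which GL(3,3) acts,
    with order divisible by 13. *)
Definition aut_codes : seq (idx * idx) :=
  let x n := nth origin idxs n in
  [seq (x p.1, x p.2) | p <- [:: (1, 3); (1, 9); (1, 3); (1, 9); (1, 17); (1, 9); (1, 14); (1, 9);
    (1, 3); (1, 3); (1, 3); (1, 3); (1, 9); (1, 3); (1, 3)]%N].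

Lemma class_rigid_ok :
  all (fun k => let p := nth (origin, origin) aut_codes k in aut_rigid (memo (class_mat k.+1)) p.1 p.2)
    (iota 0 15).
Proof. by vm_cast_no_check (erefl true). Qed.

Lemma class_rigid k : 0 < k -> k < 16 -> exists w1 w2, aut_rigid (class_mat k) w1 w2.
Proof.
case: k => // k _ k15; have kin : k \in iota 0 15 by rewrite mem_iota.
by move/allP: class_rigid_ok => /(_ k kin) ok; rewrite memoE in ok; do 2!eexists; exact: ok.
Qed.

Theorem card_auts_class k : 0 < k -> k < 16 ->
  exists a b, #|auts (class_mat k)| = (2 ^ a * 3 ^ b)%N.
Proof.
move=> k0 k16; have [w1 [w2 rigid]] := class_rigid k0 k16.
move: (class_mat_BH k16) rigid (fun z => class_translate z k16).
move: (class_mat k) => M bhM rigid homog.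
rewrite -card_aut_perms; pose G := Group (aut_perms_group M).
rewrite -[aut_perms M]/(gval G); apply: smooth_23; first exact: cardG_gt0.
move=> p p_pr pG; rewrite ltnNge; apply/negP => p5.
have [_ /imsetP[a aM ->] oa] := Cauchy p_pr pG.
have ap : (wperm a.1, wperm a.2) ^+ p = 1 by rewrite -oa expg_order.
have X n (x y : {perm idx * trit}) : (x, y) ^+ n = (x ^+ n, y ^+ n).
  by elim: n => // n IH; rewrite !expgS IH.
rewrite X in ap; case: ap => ap1 ap2.
have [e1 e2] := rigid_trivial bhM rigid homog p_pr p5 aM ap1 ap2.
by move: oa; rewrite e1 e2 order1 => p1; rewrite -p1 in p_pr.
Qed.

Local Close Scope group_scope.

From mathcomp Require Import spectral complex mxtens.
From mathcomp Require Import all_classical all_reals all_analysis.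
Import Order.TTheory GRing.Theory Num.Theory.

(** * Exponents and cube roots of unity *)

Local Open Scope classical_set_scope.
Local Open Scope card_scope.
Local Open Scope ring_scope.
Local Open Scope complex_scope.
Local Open Scope sesquilinear_scope.

Section CubeRoots.

Variable R : realType.
Notation w := (zeta R 3).

Lemma zeta_expE k n : zeta R k ^+ n =
  cos (2 * pi / k%:R *+ n) +i* sin (2 * pi / k%:R *+ n).
Proof.
elim: n => [|n IH]; first by rewrite expr0 mulr0n cos0 sin0.
rewrite exprS IH [_ *+ n.+1]mulrS cosD sinD /zeta; apply/eqP; rewrite eq_complex /=.
by rewrite eqxx /= addrC eqxx.
Qed.

Lemma zeta3_cube : w ^+ 3 = 1.
Proof.
rewrite zeta_expE -[_ *+ 3]mulr_natr divfK ?pnatr_eq0 // mulr_natl cos2pi.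
by rewrite sin2pi.
Qed.

Lemma zeta3_im : complex.Im w != 0.
Proof.
apply: lt0r_neq0; apply: sin_gt0_pi; have pi0 := pi_gt0 R; apply/andP; split.
  by rewrite divr_gt0 ?mulr_gt0.
by rewrite ltr_pdivrMr // mulrC ltr_pM2l // ltr_nat.
Qed.

Lemma zeta3_sum : 1 + w + w ^+ 2 = 0.
Proof.
have : (w - 1) * (1 + w + w ^+ 2) = 0.
  have -> : (w - 1) * (1 + w + w ^+ 2) = w ^+ 3 - 1 by ring.
  by rewrite zeta3_cube subrr.
move/eqP; rewrite mulf_eq0 => /orP[|/eqP //].
rewrite subr_eq0 => /eqP w1; have := zeta3_im; by rewrite w1 eqxx.
Qed.

Lemma zeta3_unit : w \is a GRing.unit.
Proof. by apply/unitrP; exists (w ^+ 2); rewrite -exprSr -exprS zeta3_cube. Qed.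

Lemma zeta3_conj : w^* = w ^+ 2.
Proof.
apply: (mulIr zeta3_unit); rewrite -exprSr zeta3_cube /zeta; apply/eqP.
rewrite eq_complex /=; apply/andP; split; apply/eqP.
  by rewrite mulNr opprK -!expr2 cos2Dsin2.
by ring.
Qed.

(** Replacing w^2 by - 1 - w leaves a real combination of 1 and w, which are independent because w
    is not real. This turns orthogonality of rows into equality of the three counts. *)
Lemma zeta3_free (a b c : nat) :
  a%:R + b%:R * w + c%:R * w ^+ 2 = 0 -> a = b /\ b = c.
Proof.
have -> : w ^+ 2 = - 1 - w by rewrite -[LHS]subr0 -zeta3_sum; ring.
move=> e; have {}e : (a%:R - c%:R) + (b%:R - c%:R) * w = 0 :> R[i] by rewrite -e; ring.
have E (x y : R) : x%:C + y%:C * w = 0 -> x = 0 /\ y = 0.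
  case: w zeta3_im => u v /= v0 /eqP; rewrite eq_complex /= !mul0r !subr0 !add0r addr0.
  by rewrite mulf_eq0 (negPf v0) orbF => /andP[/eqP xy /eqP y0]; rewrite y0 mul0r addr0 in xy.
have nC n : n%:R = (n%:R)%:C :> R[i] by rewrite rmorph_nat.
rewrite !nC -!rmorphB in e; have [/eqP xc /eqP yc] := E _ _ e.
move: xc yc; rewrite !subr_eq0 !eqr_nat => /eqP -> /eqP ->.
by [].
Qed.

Definition zt (a : trit) : R[i] := w ^+ nat_of_trit a.

Lemma ztD a b : zt (a + b) = zt a * zt b.
Proof.
rewrite /zt -exprD -[RHS](expr_mod _ zeta3_cube); congr (_ ^+ _).
by case: a; case: b.
Qed.

Lemma zt0 : zt 0 = 1. Proof. by []. Qed.

Lemma ztN a : zt (- a) = (zt a)^*.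
Proof.
case: a.
- by change (w ^+ 0 = (w ^+ 0)^*); rewrite expr0 rmorph1.
- by change (w ^+ 2 = (w ^+ 1)^*); rewrite expr1 zeta3_conj.
- change (w ^+ 1 = (w ^+ 2)^*); rewrite -zeta3_conj expr1; first [exact/esym/conjCK | exact/esym/conjcK].
Qed.

Lemma zt_neq0 a : zt a != 0.
Proof. by apply/negP => /eqP h; have := ztD a (- a); rewrite subrr h mul0r zt0 => /eqP; rewrite oner_eq0. Qed.

Lemma zt_inj : injective zt.
Proof.
have zt1 d : zt d = 1 -> d = 0.
  have z1 : w != 1 by apply: contraNneq zeta3_im => ->.
  case: d; rewrite /zt //= ?expr1 => h; first by rewrite h eqxx in z1.
  by have := zeta3_cube; rewrite exprS h mulr1 => w1; rewrite w1 eqxx in z1.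
move=> a b ab; apply/eqP; rewrite -subr_eq0; apply/eqP/zt1.
by rewrite ztD ab -ztD subrr.
Qed.

Lemma zeta_groupP z : zeta_group R 3 z <-> exists a, z = zt a.
Proof.
split=> [[j _ <-]|[a ->]]; last by exists (nat_of_trit a).
rewrite (divn_eq j 3) exprD mulnC exprM zeta3_cube expr1n mul1r.
exists (trit_of_nat (j %% 3)); rewrite /zt; have : (j %% 3 < 3)%N by rewrite ltn_mod.
by case: (j %% 3)%N => [|[|[|]]].
Qed.

Definition tz (z : R[i]) : trit :=
  if z == zt t1 then t1 else if z == zt t2 then t2 else t0.

Lemma ztK : cancel zt tz.
Proof. by move=> a; rewrite /tz !(inj_eq zt_inj); case: a. Qed.

Lemma tzK z : zeta_group R 3 z -> zt (tz z) = z.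
Proof. by case/zeta_groupP => a ->; rewrite ztK. Qed.

Lemma sum_zt (T : finType) (F : T -> trit) :
  \sum_y zt (F y) = \sum_v #|[pred y | F y == v]|%:R * zt v.
Proof.
rewrite (partition_big F predT) //=; apply: eq_bigr => v _.
rewrite (eq_bigr (fun=> zt v)); last by move=> y /eqP ->.
by rewrite sumr_const mulr_natl.
Qed.

Lemma sum_zt_eq0 (T : finType) m (F : T -> trit) : #|T| = (3 * m)%N ->
  \sum_y zt (F y) = 0 <-> uniform m F.
Proof.
move=> cT.
have sumE : \sum_v #|[pred y | F y == v]|%:R * zt v = #|[pred y | F y == t0]|%:R
    + #|[pred y | F y == t1]|%:R * w + #|[pred y | F y == t2]|%:R * w ^+ 2.
  rewrite (bigD1 t0) //= (bigD1 t1) //= (bigD1 t2) //= big1 ?addr0; last by case.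
  by rewrite /zt /= expr0 expr1 mulr1 addrA.
rewrite sum_zt sumE; split=> [/zeta3_free[e1 e2]|h]; last first.
  by rewrite !h -[X in X + _ + _](mulr1) -!mulrDr zeta3_sum mulr0.
have : \sum_v #|[pred y | F y == v]| = (3 * m)%N.
  rewrite -cT -sum1_card [RHS](partition_big F predT) //=; apply: eq_bigr => v _.
  by rewrite -sum1_card; apply: eq_bigl => y; rewrite inE.
rewrite sum_trit => h v.
suff [h0 h1 h2] : [/\ #|[pred y | F y == t0]| = m, #|[pred y | F y == t1]| = m
    & #|[pred y | F y == t2]| = m] by case: v.
move: e1 e2 h.
move: #|[pred y | F y == t0]| #|[pred y | F y == t1]| #|[pred y | F y == t2]| => *.
by split; lia.
Qed.

Lemma is_BH_uniform n m (H : 'M[R[i]]_n) (h : 'I_n -> 'I_n -> trit) : n = (3 * m)%N ->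
  (forall i j, H i j = zt (h i j)) -> is_BH 3 H <-> is_gBH m h.
Proof.
move=> nm Hh.
have cn : #|'I_n| = (3 * m)%N by rewrite card_ord.
have HH i k : (H *m H ^t*) i k = \sum_j zt (h i j - h k j).
  by rewrite mxE; apply: eq_bigr => j _; rewrite !mxE !Hh ztD ztN.
split=> [[_ bh] i k ik|bh].
  apply/(sum_zt_eq0 _ cn); rewrite -HH bh mxE (negPf ik).
  by rewrite mulr0n.
split; first by move=> i j; apply/zeta_groupP; exists (h i j).
apply/matrixP => i k; rewrite HH mxE; case: eqVneq => [->|ik].
  by under eq_bigr do rewrite subrr zt0; rewrite sumr_const card_ord mulr1n.
by rewrite mulr0n; apply/(sum_zt_eq0 _ cn)/bh.
Qed.

Section Monomial.

Variable n : nat.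
Implicit Types (s : {perm 'I_n}) (r : 'I_n -> trit) (X : 'M[R[i]]_n).

Definition mon s r : 'M[R[i]]_n := \matrix_(i, j) if j == s i then zt (r i) else 0.

Lemma mon_neq0 s r i j : (mon s r i j != 0) = (j == s i).
Proof. by rewrite mxE; case: (j =P s i) => _; rewrite ?zt_neq0 ?eqxx. Qed.

Lemma mon_monomial s r : is_monomial 3 (mon s r).
Proof.
split=> [i|j|i j].
- by exists (s i); split; [rewrite mon_neq0 | move=> j; rewrite mon_neq0 => /eqP].
- exists (s^-1%g j); split; first by rewrite mon_neq0 permKV.
  by move=> i; rewrite mon_neq0 => /eqP ->; rewrite permK.
- by rewrite mon_neq0 mxE => ->; apply/zeta_groupP; exists (r i).
Qed.

Lemma monomialP (P : 'M[R[i]]_n) : is_monomial 3 P ->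
  exists s r, P = mon s r.
Proof.
case=> rows cols ent; have [s sP] := choice rows.
have si : injective s.
  move=> i i' e; have [k [_ uk]] := cols (s i).
  by rewrite -(uk i (proj1 (sP i))) -(uk i') // e; exact: (proj1 (sP i')).
exists (perm si), (fun i => tz (P i (s i))); apply/matrixP => i j; rewrite mxE permE.
have [Pi uP] := sP i; case: eqP => [->|ne]; first by rewrite tzK //; apply: ent.
by apply/eqP/negPn/negP => /uP e; apply: ne.
Qed.

Lemma mul_mon s r X i j : (mon s r *m X) i j = zt (r i) * X (s i) j.
Proof.
rewrite mxE (bigD1 (s i)) //= big1 ?addr0; last first.
  by move=> k /negPf ki; rewrite mxE ki mul0r.
by rewrite mxE eqxx.
Qed.

Lemma mul_mon_adj s r X i j : (X *m (mon s r) ^t*) i j = X i (s j) * zt (- r j).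
Proof.
rewrite mxE (bigD1 (s j)) //= big1 ?addr0; last first.
  by move=> k /negPf ki; rewrite !mxE ki rmorph0 mulr0.
by rewrite !mxE eqxx ztN.
Qed.

Lemma mul_monr s r X i j :
  (X *m mon s r) i j = X i (s^-1%g j) * zt (r (s^-1%g j)).
Proof.
rewrite mxE (bigD1 (s^-1%g j)) //= big1 ?addr0; last first.
  move=> k kj; rewrite mxE; case: eqP => [jk|_]; last by rewrite mulr0.
  by rewrite jk permK eqxx in kj.
by rewrite mxE permKV eqxx.
Qed.

Lemma mon_inj s s' r r' : mon s r = mon s' r' -> s = s' /\ r =1 r'.
Proof.
move=> e; have ss : s = s'.
  by apply/permP => i; apply/eqP; rewrite -(mon_neq0 s' r') -e mon_neq0.
split=> // i; apply: zt_inj; have := congr1 (fun P : 'M[R[i]]_n => P i (s i)) e.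
by rewrite !mxE ss eqxx.
Qed.

Lemma BH_equivP X Y : BH_equiv 3 X Y <->
  exists s s' r r', forall i j, Y i j = zt (r i) * X (s i) (s' j) * zt (r' j).
Proof.
split=> [[P [Q [/monomialP[s [r ->]] /monomialP[s' [r' ->]] <-]]]|[s [s' [r [r' E]]]]].
  exists s, (s'^-1)%g, r, (r' \o s'^-1%g) => i j.
  by rewrite mul_monr mul_mon.
exists (mon s r), (mon s'^-1%g (r' \o s'^-1%g)); split; try exact: mon_monomial.
by apply/matrixP => i j; rewrite mul_monr mul_mon E invgK /= permK.
Qed.

Lemma BH_autP X s r s' r' : BH_aut 3 X (mon s r, mon s' r') <->
  forall i j, X i j = zt (r i) * X (s i) (s' j) * zt (- r' j).
Proof.
split=> [[_ _ /= E] i j|E]; first by rewrite -{1}E mul_mon_adj mul_mon.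
split; try exact: mon_monomial.
by apply/matrixP => i j; rewrite mul_mon_adj mul_mon -E.
Qed.

End Monomial.

End CubeRoots.

(** * The main theorem *)

Section Uniform.

Lemma uniform_comp (S T : finType) (u : S -> T) m (F : T -> trit) : bijective u ->
  uniform m F -> uniform m (fun y => F (u y)).
Proof.
case=> v uK vK h a; rewrite -(h a) -(fintype.card_image (can_inj uK)); apply: eq_card => y.
by rewrite -(vK y) (fintype.mem_image (can_inj uK)) !inE.
Qed.

Lemma gBH_comp (S T S' T' : finType) (e : S' -> S) (u : T' -> T) m (M : S -> T -> trit) :
  injective e -> bijective u -> is_gBH m M -> is_gBH m (fun x y => M (e x) (u y)).
Proof.
move=> ei ub bM x y xy; apply: (uniform_comp ub (F := fun j => M (e x) j - M (e y) j)).
by apply: bM; rewrite inj_eq.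
Qed.

Lemma kron_gBH (S T : finType) m n (A : S -> S -> trit) (B : T -> T -> trit) :
  #|S| = (3 * m)%N -> #|T| = (3 * n)%N -> is_gBH m A -> is_gBH n B ->
  is_gBH (3 * m * n) (fun x y : S * T => A x.1 y.1 + B x.2 y.2).
Proof.
move=> cS cT bA bB x x' xx' v.
pose F y := A x.1 y - A x'.1 y; pose G y := B x.2 y - B x'.2 y.
have -> : #|[pred y | A x.1 y.1 + B x.2 y.2 - (A x'.1 y.1 + B x'.2 y.2) == v]| =
    (\sum_y #|[pred z | G z == v - F y]%R|)%N.
  rewrite -card_add_pair; apply: eq_card => y; rewrite !inE /F /G; congr (_ == _).
  by ring.
have [e2|/bB uG] := eqVneq x.2 x'.2; last first.
  by under eq_bigr => y _ do rewrite (uG (v - F y)); rewrite sum_nat_const cS.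
have /bA uF : x.1 != x'.1.
  by apply: contraNneq xx' => e1; rewrite [x]surjective_pairing e1 e2 -surjective_pairing.
have E y : #|[pred z | G z == v - F y]| = ((F y == v) * #|{: T}|)%N.
  rewrite /G e2; case: eqP => [->|ne].
    by rewrite mul1n; apply: eq_card => z; rewrite !inE !subrr eqxx.
  rewrite mul0n; apply: eq_card0 => z; rewrite !inE subrr eq_sym subr_eq0.
  by apply/eqP => h; apply: ne.
under eq_bigr => y _ do rewrite E.
rewrite -big_distrl /= cT mulnCA mulnA; congr (_ * _)%N; congr (_ * _)%N.
rewrite -(uF v) -sum1_card [RHS]big_mkcond /=; apply: eq_bigr => y _; rewrite !inE.
by case: eqP.
Qed.

Lemma gBH1 : is_gBH 1 (fun x y : trit => x * y).
Proof.
move=> x y xy v; rewrite (@eq_card _ _ (pred1 ((x - y) * v : trit))) ?card1 // => j.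
by case: x xy; case: y => // _; case: v; case: j.
Qed.

Definition dot2 (x y : trit * trit) : trit := x.1 * y.1 + x.2 * y.2.

Definition dot3 : tmat := fun x y => dot2 x.1 y.1 + x.2 * y.2.

Lemma card_trit2 : #|{: trit * trit}| = 9%N.
Proof. by rewrite card_prod card_trit. Qed.

Lemma dot2_gBH : is_gBH 3 dot2.
Proof. exact: (kron_gBH (m := 1) (n := 1) card_trit card_trit gBH1 gBH1). Qed.

Lemma dot3_tBH : is_tBH dot3.
Proof. exact: (kron_gBH (m := 3) (n := 1) card_trit2 card_trit dot2_gBH gBH1). Qed.

Lemma class_dot3 : teq (class_mat 0) dot3.
Proof.
have ok : class_ok (nth class0 bh_classes 0).
  by have := classes_ok; rewrite allwE => /(all_nthP class0); apply; rewrite size_classes.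
(* The rows of the three unit vectors label each column by its own coordinates. *)
apply: (class_matches (e := origin) (y := ((t1, t0, t0), (t0, t1, t0), (t0, t0, t1))) ok dot3_tBH).
by vm_compute.
Qed.

End Uniform.

Lemma conj_index_lt k : (k < 16)%N -> (conj_index k < 16)%N.
Proof. by case/class_conj. Qed.

Lemma conj_indexK k : (k < 16)%N -> conj_index (conj_index k) = k.
Proof.
move=> k16; have [c16 kc] := class_conj k16; have [d16 cd] := class_conj c16.
apply: class_teq_inj => //; apply: teq_trans cd _; apply: teq_trans (teq_neg kc) _.
by apply: teq_ext => x y; rewrite /tneg opprK.
Qed.

Lemma conj_index_fixed k : (k < 16)%N -> conj_index k = k <-> k \in [:: 0; 13]%N.
Proof.
have ok : all (fun k => (conj_index k == k) == (k \in [:: 0; 13]%N)) (iota 0 16) by vm_compute.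
move=> k16; have /(allP ok)/eqP <- : k \in iota 0 16 by rewrite mem_iota.
by split=> /eqP.
Qed.

Lemma card_eq_I (T : Type) n (F : nat -> T) (A : set T) :
  (forall i, (i < n)%N -> A (F i)) ->
  (forall i j, (i < n)%N -> (j < n)%N -> F i = F j -> i = j) ->
  (forall x, A x -> exists2 i, (i < n)%N & F i = x) -> A #= `I_n.
Proof.
move=> FA Fi Fs.
have /choice[g gP] x : exists i, A x -> (i < n)%N /\ F i = x.
  have [/Fs[i ilt Fix]|nA] := EM (A x); first by exists i.
  by exists 0%N.
apply/card_set_bijP; exists g; split.
- by move=> x /gP[].
- by move=> x y /set_mem/gP[_ {2}<-] /set_mem/gP[_ {2}<-] ->.
- move=> i ilt; exists (F i); first exact: FA.
  by have [glt /Fi] := gP _ (FA i ilt); apply.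
Qed.

(** * Transfer to complex matrices of order 27 *)

Section Matrices27.

Variable R : realType.
Local Notation zt := (zt R).

Definition en (T : finType) n (cT : #|T| = n) (i : 'I_n) : T := enum_val (cast_ord (esym cT) i).
Definition ne (T : finType) n (cT : #|T| = n) (x : T) : 'I_n := cast_ord cT (enum_rank x).

Lemma enK (T : finType) n (cT : #|T| = n) : cancel (en cT) (ne cT).
Proof. by move=> i; rewrite /en /ne enum_valK cast_ordKV. Qed.

Lemma neK (T : finType) n (cT : #|T| = n) : cancel (ne cT) (en cT).
Proof. by move=> x; rewrite /en /ne cast_ordK enum_rankK. Qed.

Lemma en_bij (T : finType) n (cT : #|T| = n) : bijective (en cT).
Proof. exact: Bijective (enK cT) (neK cT). Qed.

Lemma ne_bij (T : finType) n (cT : #|T| = n) : bijective (ne cT).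
Proof. exact: Bijective (neK cT) (enK cT). Qed.

Definition imx (T : finType) n (cT : #|T| = n) (f : T -> T -> trit) : 'M[R[i]]_n :=
  indexed_mx cT (fun x y => zt (f x y)).

Lemma imxE (T : finType) n (cT : #|T| = n) f i j : imx cT f i j = zt (f (en cT i) (en cT j)).
Proof. by rewrite mxE. Qed.

Lemma imx_BH (T : finType) n m (cT : #|T| = n) f : n = (3 * m)%N ->
  is_BH 3 (imx cT f) <-> is_gBH m f.
Proof.
move=> nm; rewrite (is_BH_uniform nm (imxE cT f)); split=> h.
  move=> x y xy v; rewrite -(gBH_comp (can_inj (neK cT)) (ne_bij cT) h xy v).
  by apply: eq_card => j; rewrite !inE !neK.
exact: gBH_comp (can_inj (enK cT)) (en_bij cT) h.
Qed.

Lemma imx_equiv (T T' : finType) n (cT : #|T| = n) (cT' : #|T'| = n) f f' (b : T -> T') :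
  bijective b -> (forall x y, f x y = f' (b x) (b y)) -> BH_equiv 3 (imx cT f) (imx cT' f').
Proof.
case=> b' bK Kb ff'.
have si : injective (fun i => ne cT (b' (en cT' i))).
  exact: inj_comp (can_inj (neK cT)) (inj_comp (can_inj Kb) (can_inj (enK cT'))).
apply/BH_equivP; exists (perm si), (perm si), (fun=> 0), (fun=> 0) => i j.
by rewrite !imxE !permE !neK ff' !Kb zt0 mul1r mulr1.
Qed.

Notation mx := (imx card_idx).
Local Notation ix := (en card_idx).
Local Notation xi := (ne card_idx).

Lemma mx_BH M : is_BH 3 (mx M) <-> is_tBH M.
Proof. exact: (imx_BH (m := 9)). Qed.

Lemma BH_mx (H : 'M[R[i]]_27) : is_BH 3 H -> exists M, H = mx M.
Proof.
case=> ent _; exists (fun x y => tz (H (xi x) (xi y))).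
by apply/matrixP => i j; rewrite imxE !enK tzK.
Qed.

Lemma mx_inj M N : mx M = mx N -> forall x y, M x y = N x y.
Proof.
move=> e x y; apply: (@zt_inj R); have := congr1 (fun H : 'M[R[i]]_27 => H (xi x) (xi y)) e.
by rewrite !imxE !neK.
Qed.

Lemma mx_equiv M N : BH_equiv 3 (mx M) (mx N) <-> teq M N.
Proof.
rewrite BH_equivP; split=> [[s [s' [r [r' E]]]]|[s [u [r [c [si ui E]]]]]].
  exists (ix \o s \o xi), (ix \o s' \o xi), (r \o xi), (r' \o xi); split.
  - exact: inj_comp (inj_comp (can_inj (enK _)) (@perm_inj _ s)) (can_inj (neK _)).
  - exact: inj_comp (inj_comp (can_inj (enK _)) (@perm_inj _ s')) (can_inj (neK _)).
  - by move=> x y; apply: (@zt_inj R); rewrite !ztD -imxE -E imxE !neK.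
have si' : injective (xi \o s \o ix).
  exact: inj_comp (inj_comp (can_inj (neK _)) si) (can_inj (enK _)).
have ui' : injective (xi \o u \o ix).
  exact: inj_comp (inj_comp (can_inj (neK _)) ui) (can_inj (enK _)).
exists (perm si'), (perm ui'), (r \o ix), (c \o ix) => i j.
by rewrite !imxE !permE /= !neK E !ztD.
Qed.

Lemma mx_tr M : (mx M)^T = mx (ttr M).
Proof. by apply/matrixP => i j; rewrite mxE !imxE. Qed.

Lemma mx_adj M : (mx M) ^t* = mx (tneg (ttr M)).
Proof. by apply/matrixP => i j; rewrite !mxE ztN. Qed.

Lemma imx_mx (T : finType) (cT : #|T| = 27) f :
  imx cT f = mx (fun x y => f (en cT (xi x)) (en cT (xi y))).
Proof. by apply/matrixP => i j; rewrite !imxE !enK. Qed.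

Lemma imx_teq (T : finType) (cT : #|T| = 27) f (b : idx -> T) M : bijective b ->
  imx cT f = mx M -> teq (fun x y => f (b x) (b y)) M.
Proof. by move=> bb e; apply/mx_equiv; rewrite -e; apply: imx_equiv bb _. Qed.

Lemma cocycle_tcocycle (gT : finGroupType) (psi : gT -> gT -> R[i]) : is_cocycle 3 psi ->
  exists c : tcocycle gT, forall x y, psi x y = zt (c x y).
Proof.
case=> vals coc norm.
have E x y : psi x y = zt (tz (psi x y)) by rewrite tzK.
have P x y z : tadd (tz (psi x y)) (tz (psi (x * y)%g z)) =
    tadd (tz (psi x (y * z)%g)) (tz (psi y z)).
  by apply: (@zt_inj R); rewrite !taddE !ztD -!E coc.
have N1 x : tz (psi 1%g x) = t0 by apply: (@zt_inj R); rewrite -E norm //; left.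
have N2 x : tz (psi x 1%g) = t0 by apply: (@zt_inj R); rewrite -E norm //; right.
by exists (TCocycle P N1 N2).
Qed.

Lemma tcocycle_cocycle (gT : finGroupType) (c : tcocycle gT) :
  is_cocycle 3 (fun x y => zt (c x y)).
Proof.
split=> [x y|x y z|x y [->|->]].
- by apply/zeta_groupP; exists (c x y).
- by rewrite -!ztD -!taddE tcP.
- by rewrite tc1x.
- by rewrite tcx1.
Qed.

(** One direction is the classification; the other realizes each representative by a coboundary on
    an abelian group. All statements about cocyclic matrices are reduced to the sixteen
    representatives through it. *)
Lemma cocyclicP (H : 'M[R[i]]_27) : cocyclic_BH 3 H <->
  exists k M, [/\ (k < 16)%N, H = mx M & teq (class_mat k) M].
Proof.
split=> [[bH [gT [cG [psi [/cocycle_tcocycle[c cE] HY]]]]]|[k [M [k16 -> kM]]]].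
  have [M HM] := BH_mx bH.
  have YE : indexed_mx cG psi = imx cG c.
    by apply/matrixP => i j; rewrite !mxE cE.
  rewrite HM YE (imx_mx cG) mx_equiv in HY.
  have bb : bijective (fun x => en cG (xi x)) := bij_comp (en_bij cG) (ne_bij _).
  have bN := teq_tBH HY; rewrite -mx_BH -HM in bN.
  have [k k16 kN] := cocycle_classified cG bb (bN bH).
  by exists k, M; split=> //; apply: teq_trans kN (teq_sym HY).
split; first by apply/mx_BH; apply: teq_tBH kM (class_mat_BH k16).
have [gT [c [b [cG bb kc]]]] := class_indexing k16.
exists gT, cG, (fun x y => zt (c x y)); split; first exact: tcocycle_cocycle.
rewrite -/(imx cG c) (imx_mx cG) mx_equiv; apply: teq_trans (teq_sym kM) (teq_trans kc _).
exact: imx_teq bb (imx_mx cG c).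
Qed.

Definition cls (k : nat) : set 'M[R[i]]_27 := BH_class 3 (mx (class_mat k)).

Lemma clsP k H : (k < 16)%N -> cls k H <-> exists2 M, H = mx M & teq (class_mat k) M.
Proof.
move=> k16; split=> [[bH kH]|[M -> kM]].
  by have [M HM] := BH_mx bH; exists M => //; rewrite HM mx_equiv in kH.
by split; [apply/mx_BH/(teq_tBH kM)/class_mat_BH | apply/mx_equiv].
Qed.

Lemma BH_class_cls k M : (k < 16)%N -> teq (class_mat k) M -> BH_class 3 (mx M) = cls k.
Proof.
move=> k16 kM; apply/seteqP; split=> H [bH MH]; have [N HN] := BH_mx bH;
  rewrite HN mx_equiv in MH; (split; first exact: bH); rewrite HN mx_equiv.
- exact: teq_trans kM MH.
- exact: teq_trans (teq_sym kM) MH.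
Qed.

Lemma cls_inj k l : (k < 16)%N -> (l < 16)%N -> cls k = cls l -> k = l.
Proof.
move=> k16 l16 e; have : cls l (mx (class_mat l)).
  by apply/(clsP _ l16); exists (class_mat l); [|exact: teq_refl].
rewrite -e => /(clsP _ k16)[M /mx_inj lM kM]; apply: (class_teq_inj k16 l16).
by apply: teq_trans kM _; apply: teq_ext.
Qed.

Lemma classesP C : cocyclic_classes R 27 3 C <-> exists2 k, (k < 16)%N & C = cls k.
Proof.
split=> [[H /cocyclicP[k [M [k16 -> kM]]] <-]|[k k16 ->]].
  by exists k; [exact: k16 | exact: BH_class_cls k16 kM].
by exists (mx (class_mat k)) => //; apply/cocyclicP; exists k, (class_mat k); split=> //; apply: teq_refl.
Qed.

Lemma card_cls (s : seq nat) (A : set (set 'M[R[i]]_27)) :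
  uniq s -> all (fun k => k < 16)%N s ->
  (forall C, A C <-> exists2 k, k \in s & C = cls k) -> A #= `I_(size s).
Proof.
move=> us /allP s16 AE; apply: (@card_eq_I _ _ (fun i => cls (nth 0%N s i))).
- by move=> i si; apply/AE; exists (nth 0%N s i) => //; apply: mem_nth.
- move=> i j si sj /cls_inj e; apply/eqP; rewrite -(nth_uniq 0%N si sj us); apply/eqP/e;
    by apply: s16; apply: mem_nth.
- by move=> C /AE[k ks ->]; exists (index k s); rewrite ?index_mem ?nth_index.
Qed.

(** The representatives are symmetric, so up to equivalence the Hermitian only negates exponents. *)
Lemma hermitian_cls k : (k < 16)%N -> hermitian_class (cls k) = cls (conj_index k).
Proof.
have sub l : (l < 16)%N -> hermitian_class (cls l) `<=` cls (conj_index l).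
  move=> l16 _ [H /(clsP _ l16)[M -> lM] <-]; have [c16 lc] := class_conj l16.
  apply/clsP => //; exists (tneg (ttr M)); first exact: mx_adj.
  apply: teq_trans lc _; apply: teq_neg; apply: teq_trans (teq_tr lM).
  by apply: teq_ext => x y; rewrite /ttr class_mat_sym.
move=> k16; apply/seteqP; split; first exact: sub.
(* The other inclusion is the first one applied to the conjugate class. *)
move=> H HH; have c16 := conj_index_lt k16.
have [M HM _] := (clsP _ c16).1 HH; exists (H ^t*).
  by rewrite -(conj_indexK k16); apply: sub => //; exists H.
by rewrite HM !mx_adj; congr mx; apply/funext => x; apply/funext => y; rewrite /tneg /ttr opprK.
Qed.

Lemma classes_tr (H : 'M[R[i]]_27) : cocyclic_BH 3 H -> BH_equiv 3 H H^T.
Proof.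
case/cocyclicP=> k [M [k16 -> kM]]; rewrite mx_tr mx_equiv.
apply: teq_trans (teq_sym kM) (teq_trans _ (teq_tr kM)).
by apply: teq_ext => x y; rewrite /ttr class_mat_sym.
Qed.

Definition perm27 (s : {perm idx}) : {perm 'I_27} :=
  perm (inj_comp (inj_comp (can_inj (neK card_idx)) (@perm_inj _ s)) (can_inj (enK card_idx))).

Lemma perm27E s i : perm27 s i = xi (s (ix i)).
Proof. by rewrite permE. Qed.

Lemma card_BH_aut M : BH_aut 3 (mx M) #= `I_#|auts M|.
Proof.
pose a0 : labelled * labelled := ((1%g, [ffun=> 0]), (1%g, [ffun=> 0])).
(* [BH_aut] multiplies by the adjoint of the second matrix, hence the sign of the column labels. *)
pose G (a : labelled * labelled) : 'M[R[i]]_27 * 'M[R[i]]_27 :=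
  (mon R (perm27 a.1.1) (a.1.2 \o ix), mon R (perm27 a.2.1) (fun j => - a.2.2 (ix j))).
have Ginj : injective G.
  have P s s' : perm27 s = perm27 s' -> s = s'.
    move=> e; apply/permP => x; have := congr1 (fun p : {perm 'I_27} => p (xi x)) e.
    by rewrite !perm27E neK => /(can_inj (neK _)).
  move=> [[s r] [s' r']] [[u c] [u' c']] e.
  have [/P /= -> rc] := mon_inj (congr1 fst e); have [/P /= -> rc'] := mon_inj (congr1 snd e).
  congr (_, _, (_, _)); apply/ffunP => x.
    by have := rc (xi x); rewrite /= neK.
  by have := rc' (xi x); rewrite /= neK => /oppr_inj.
apply: (@card_eq_I _ _ (fun i => G (nth a0 (enum (auts M)) i))).
- move=> i iM; have /in_isos aM : nth a0 (enum (auts M)) i \in auts M.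
    by rewrite -mem_enum mem_nth // -cardE.
  apply/BH_autP => x y; rewrite !imxE !perm27E !neK opprK -!ztD /=.
  by rewrite -aM.
- move=> i j; rewrite cardE => iM jM /Ginj/eqP; rewrite nth_uniq ?enum_uniq //.
  by move/eqP.
- move=> [P Q] PQ; have [/monomialP[s [r Pm]] /monomialP[s' [r' Qm]] _] := PQ.
  rewrite /= in Pm Qm; rewrite Pm Qm in PQ *; move/BH_autP: PQ => E.
  have si : injective (ix \o s \o xi).
    exact: inj_comp (inj_comp (can_inj (enK _)) (@perm_inj _ s)) (can_inj (neK _)).
  have si' : injective (ix \o s' \o xi).
    exact: inj_comp (inj_comp (can_inj (enK _)) (@perm_inj _ s')) (can_inj (neK _)).
  pose a : labelled * labelled :=
    ((perm si, [ffun x => r (xi x)]), (perm si', [ffun x => - r' (xi x)])).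
  have aM : a \in auts M.
    apply/in_isos => x y; rewrite /= !ffunE !permE /=; apply: (@zt_inj R).
    by have := E (xi x) (xi y); rewrite !imxE !neK !ztD.
  exists (index a (enum (auts M))); first by rewrite cardE index_mem mem_enum.
  rewrite nth_index ?mem_enum // /G; congr (_, _); apply/matrixP => i j; rewrite !mxE.
    by rewrite perm27E permE /= ffunE !enK.
  by rewrite perm27E permE /= ffunE !enK opprK.
Qed.

Definition f3_of_trit (a : trit) : 'F_3 := inZp (nat_of_trit a).
Definition trit_of_f3 (a : 'F_3) : trit := trit_of_nat (nat_of_ord a).

Lemma f3_of_tritK : cancel f3_of_trit trit_of_f3. Proof. by case. Qed.

Lemma trit_of_f3E a : nat_of_trit (trit_of_f3 a) = a.
Proof. by case: a => [[|[|[|]]]]. Qed.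

Lemma f3_of_tritD a b : f3_of_trit (a + b) = f3_of_trit a + f3_of_trit b.
Proof. by apply: val_inj; case: a; case: b. Qed.

Lemma f3_of_tritM a b : f3_of_trit (a * b) = f3_of_trit a * f3_of_trit b.
Proof. by apply: val_inj; case: a; case: b. Qed.

Definition gf3_vector (x : idx) : 'rV['F_3]_3 :=
  \row_j f3_of_trit (nth t0 [:: x.1.1; x.1.2; x.2] j).

Lemma gf3_vector_bij : bijective gf3_vector.
Proof.
apply: inj_card_bij; last by rewrite card_GF3_3 card_idx.
move=> [[a b] c] [[a' b'] c'] e.
have E j : nth t0 [:: a; b; c] j = nth t0 [:: a'; b'; c'] j.
  have [j3|j3] := ltnP j 3; last by rewrite !nth_default.
  apply: (can_inj f3_of_tritK); have := congr1 (fun v : 'rV_3 => v 0 (Ordinal j3)) e.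
  by rewrite !mxE.
by move: (E 0%N) (E 1%N) (E 2%N) => /= -> -> ->.
Qed.

Lemma gf3_dot x y : (gf3_vector x *m (gf3_vector y)^T) 0 0 = f3_of_trit (dot3 x y).
Proof.
rewrite mxE !big_ord_recl big_ord0 !mxE /= addr0 -!f3_of_tritM -!f3_of_tritD.
by rewrite /dot3 /dot2 addrA.
Qed.

Lemma sylvester_teq M : sylvester_27_3 R = mx M -> teq (class_mat 0) M.
Proof.
move=> SM; apply: teq_trans class_dot3 _.
pose f (v v' : 'rV['F_3]_3) := trit_of_f3 ((v *m v'^T) 0 0).
have SE : sylvester_27_3 R = imx card_GF3_3 f.
  by apply/matrixP => i j; rewrite [LHS]mxE imxE /zt /f trit_of_f3E.
rewrite SE in SM; apply: teq_trans (imx_teq gf3_vector_bij SM).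
by apply: teq_ext => x y; rewrite /f gf3_dot f3_of_tritK.
Qed.

Lemma card_aut_23 (H : 'M[R[i]]_27) : cocyclic_BH 3 H -> ~ BH_equiv 3 H (sylvester_27_3 R) ->
  exists a b, BH_aut 3 H #= `I_(2 ^ a * 3 ^ b).
Proof.
case/cocyclicP=> k [M [k16 -> kM]] nS.
have SM : sylvester_27_3 R = mx (fun x y => trit_of_f3
    ((en card_GF3_3 (xi x) *m (en card_GF3_3 (xi y))^T) 0 0)).
  by apply/matrixP => i j; rewrite [LHS]mxE imxE !enK /zt trit_of_f3E.
have k0 : (0 < k)%N.
  rewrite lt0n; apply/negP => /eqP k0; apply: nS; rewrite SM mx_equiv.
  by rewrite k0 in kM; apply: teq_trans (teq_sym kM) (sylvester_teq SM).
have [a [b ab]] := card_auts_class k0 k16.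
by exists a, b; rewrite -ab (card_auts_teq kM); apply: card_BH_aut.
Qed.

Lemma is_BH_entries n (H : 'M[R[i]]_n) i j : is_BH 3 H -> H i j = zt (tz (H i j)).
Proof. by case=> ent _; rewrite tzK. Qed.

Definition kron_index (x : idx) : 'I_27 :=
  mxtens_index (ne card_trit2 x.1, ne card_trit x.2).

Lemma kron_index_inj : injective kron_index.
Proof.
move=> x y /(can_inj (@mxtens_indexK 9 3)) e.
rewrite [x]surjective_pairing [y]surjective_pairing; congr (_, _).
  exact: can_inj (neK card_trit2) _ _ (congr1 fst e).
exact: can_inj (neK card_trit) _ _ (congr1 snd e).
Qed.

Lemma kron_indexE (A : 'M[R[i]]_9) (B : 'M[R[i]]_3) x y :
  (A *t B : 'M[R[i]]_27) (kron_index x) (kron_index y) =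
  A (ne card_trit2 x.1) (ne card_trit2 y.1) * B (ne card_trit x.2) (ne card_trit y.2).
Proof. exact: (@tensmxE _ 9 9 3 3 A B). Qed.

Lemma kron_classes k (A : 'M[R[i]]_9) (B : 'M[R[i]]_3) : (k < 16)%N ->
  is_BH 3 A -> is_BH 3 B -> cls k (A *t B) -> k \in [:: 0; 2; 8]%N.
Proof.
move=> k16 bA bB /(clsP _ k16)[M ABM kM].
pose e9 := ne card_trit2; pose e3 := ne card_trit.
pose a x y := tz (A (e9 x) (e9 y)); pose b x y := tz (B (e3 x) (e3 y)).
have ga : is_gBH 3 a.
  apply: (gBH_comp (M := fun i j => tz (A i j)) (can_inj (neK card_trit2)) (ne_bij card_trit2)).
  by rewrite -(@is_BH_uniform R 9 3 A _ erefl (fun i j => is_BH_entries i j bA)).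
have gb : is_gBH 1 b.
  apply: (gBH_comp (M := fun i j => tz (B i j)) (can_inj (neK card_trit)) (ne_bij card_trit)).
  by rewrite -(@is_BH_uniform R 3 1 B _ erefl (fun i j => is_BH_entries i j bB)).
have := kron_multiples9 ga gb; set N := fun x y => _ => mN.
suff MN : teq M N.
  by apply: (all_multiples9_class k16); rewrite -(all_multiples9_teq k16 (teq_trans kM MN)).
pose g := kron_index.
have gxi : injective (fun x => ix (g x)) by apply: inj_comp (can_inj (enK _)) kron_index_inj.
exists (fun x => ix (g x)), (fun x => ix (g x)), (fun=> 0), (fun=> 0); split=> // x y.
rewrite add0r addr0; apply: (@zt_inj R); rewrite -imxE -ABM kron_indexE ztD.
by rewrite -!is_BH_entries.
Qed.

(** The Sylvester matrix of order 27 is the product of those of orders 9 and 3. *)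
Lemma kron_exists : exists (A : 'M[R[i]]_9) (B : 'M[R[i]]_3),
  [/\ cocyclic_BH 3 A, is_BH 3 B & cls 0 (A *t B)].
Proof.
pose f (x y : trit) := x * y.
pose A := imx card_trit2 dot2; pose B := imx card_trit f.
have bA : is_BH 3 A by apply/(imx_BH (m := 3)) => //; apply: dot2_gBH.
have bB : is_BH 3 B by apply/(imx_BH (m := 1)) => //; apply: gBH1.
exists A, B; split=> //; last first.
  apply/clsP => //.
  have [g' gK Kg] : bijective kron_index.
    by apply: inj_card_bij kron_index_inj _; rewrite card_ord card_idx.
  exists (fun x y => dot3 (g' (xi x)) (g' (xi y))); last first.
    apply: teq_trans class_dot3 _.
    have gxi : injective (fun x => g' (xi x)) by apply: inj_comp (can_inj Kg) (can_inj (neK _)).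
    by exists (fun x => g' (xi x)), (fun x => g' (xi x)), (fun=> 0), (fun=> 0); split=> // x y;
      rewrite add0r addr0.
  apply/matrixP => i j; rewrite imxE !enK -{1}(Kg i) -{1}(Kg j) kron_indexE !imxE !neK.
  by rewrite -ztD.
split=> //; pose gT := ('Z_3 * 'Z_3)%type.
pose h (a : 'Z_3) : trit := trit_of_nat a; pose h' (a : trit) : 'Z_3 := inZp (nat_of_trit a).
have hK : cancel h h' by move=> a; apply: val_inj; case: a => [[|[|[|]]]].
have h'K : cancel h' h by case.
have hD a b : h (a * b)%g = h a + h b.
  by case: a => [[|[|[|//]]] ?]; case: b => [[|[|[|//]]] ?].
(* A bilinear form is a normalized cocycle. *)
pose c (x y : gT) := h x.1 * h y.1 + h x.2 * h y.2.
have c9 : #|{: gT}| = 9%N by rewrite card_prod !card_ord.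
pose c' := @TCocycle gT c.
have P x y z : tadd (c x y) (c (x * y)%g z) = tadd (c x (y * z)%g) (c y z).
  by rewrite !taddE /c !hD; ring.
have P1 x : c 1%g x = t0 by rewrite /c; case: (h x.1); case: (h x.2).
have P2 x : c x 1%g = t0 by rewrite /c; case: (h x.1); case: (h x.2).
exists gT, c9, (fun x y => zt (c x y)); split.
  exact: (tcocycle_cocycle (TCocycle P P1 P2)).
pose b (x : trit * trit) : gT := (h' x.1, h' x.2).
apply: (@imx_equiv _ _ _ card_trit2 c9 _ _ b).
  by exists (fun x : gT => (h x.1, h x.2)) => -[x y]; rewrite /b /= ?hK ?h'K.
by move=> x y; rewrite /c /b /= !h'K.
Qed.

(** The entries c(j - i) become c(x + y) when the rows are reversed by i = - x, so the matrix is
    equivalent to a development over Z/27. *)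
Lemma circulant_not_BH (H : 'M[R[i]]_27) : is_BH 3 H -> ~ is_circulant H.
Proof.
move=> bH [c Hc]; have [M HM] := BH_mx bH.
pose h (z : 'Z_27) := tz (c z); pose b : idx -> 'Z_27 := xi.
have bb : bijective b := ne_bij card_idx.
apply: (@Z27_not_BH h b bb).
apply: (teq_tBH (M := M)); last by apply/mx_BH; rewrite -HM.
have oppi : injective (fun x : idx => ix (- b x : 'Z_27)).
  by apply: inj_comp (can_inj (enK _)) (inj_comp (@oppr_inj 'Z_27) (can_inj (neK _))).
exists (fun x => ix (- b x : 'Z_27)), (fun y => ix (b y)), (fun=> 0), (fun=> 0); split=> //.
  by apply: inj_comp (can_inj (enK _)) (can_inj (neK _)).
move=> x y; rewrite add0r addr0; apply: (@zt_inj R); rewrite -imxE -HM /h.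
have E : c (b x * b y)%g = H (- b x : 'Z_27) (b y).
  rewrite Hc; congr c.
  change ((b x + b y) %% 27 = (b y + (27 - (27 - b x) %% 27)) %% 27)%N.
  have hx : (b x < 27)%N := ltn_ord (b x); have hy : (b y < 27)%N := ltn_ord (b y).
  by move: (nat_of_ord (b x)) (nat_of_ord (b y)) hx hy => m n; lia.
by rewrite E -is_BH_entries.
Qed.

End Matrices27.

Theorem mainTheorem4 (R : realType) :
  cocyclic_classes R 27 3 #= `I_16 /\
  [/\ (* (1) *)
      exists m : nat,
        [/\ [set C | cocyclic_classes R 27 3 C /\
               exists (A : 'M[R[i]]_9) (B : 'M[R[i]]_3),
                 [/\ cocyclic_BH 3 A, is_BH 3 B & C (A *t B)]] #= `I_m,
            (0 < m)%N & (2 * m < 16)%N],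
      (* (2) *)
      forall H : 'M[R[i]]_27, cocyclic_BH 3 H -> BH_equiv 3 H H^T,
      (* (3) *)
      [set C | cocyclic_classes R 27 3 C /\ hermitian_class C = C] #= `I_2 /\
      (forall C, cocyclic_classes R 27 3 C -> hermitian_class C <> C ->
         exists C', [/\ cocyclic_classes R 27 3 C', C' <> C,
                        hermitian_class C = C' & hermitian_class C' = C]),
      (* (4) *)
      forall H : 'M[R[i]]_27, cocyclic_BH 3 H ->
        ~ BH_equiv 3 H (sylvester_27_3 R) ->
        exists a b : nat, BH_aut 3 H #= `I_(2 ^ a * 3 ^ b)
    & (* (5) *)
      (forall gT : finGroupType, #|gT| = 27%N -> ~~ cyclic [set: gT]%SET ->
         exists H : 'M[R[i]]_27, cocyclic_BH 3 H /\ is_indexing_group 3 gT H) /\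
      (* (6) *)
      ~ exists H : 'M[R[i]]_27, is_BH 3 H /\ is_circulant H].
Proof.
have inc k : (k < 16)%N -> (k \in iota 0 16) by rewrite mem_iota.
split.
  apply: (@card_cls R (iota 0 16)); rewrite ?iota_uniq //.
  by move=> C; rewrite classesP; split=> -[k k16 ->]; exists k => //; move: k16; rewrite mem_iota.
split.
(* The number of these classes is not computed: class 0 gives m >= 1, and the multiples of 9 give m
   <= 3. *)
- pose good k := `[< exists (A : 'M[R[i]]_9) (B : 'M[R[i]]_3),
    [/\ cocyclic_BH 3 A, is_BH 3 B & cls k (A *t B)] >].
  pose s := [seq k <- iota 0 16 | good k].
  have s3 : (size s <= 3)%N.
    apply: (@uniq_leq_size _ s [:: 0; 2; 8]%N); first by rewrite filter_uniq ?iota_uniq.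
    move=> k; rewrite mem_filter mem_iota => /andP[/asboolP[A [B [[bA _] bB AB]]] k16].
    exact: kron_classes k16 bA bB AB.
  have s0 : (0 < size s)%N.
    have : 0%N \in s by rewrite mem_filter; apply/andP; split=> //; apply/asboolP/kron_exists.
    by move: (s) => -[].
  exists (size s); split=> //; last by lia.
  apply: (@card_cls R s); first by rewrite filter_uniq ?iota_uniq.
    by apply/allP => k; rewrite mem_filter mem_iota => /andP[].
  move=> C; split.
    case=> /classesP[k k16 ->] AB; exists k => //.
    by rewrite mem_filter inc // andbT; apply/asboolP.
  case=> k; rewrite mem_filter mem_iota => /andP[/asboolP AB k16] ->.
  by split; [apply/classesP; exists k | exact: AB].
- exact: classes_tr.
- split.
    apply: (@card_cls R [:: 0; 13]%N) => // C; split.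
      case=> /classesP[k k16 ->]; rewrite (hermitian_cls R k16) => e; exists k; last by [].
      by apply/(conj_index_fixed k16); apply: (@cls_inj R _ _ (conj_index_lt k16) k16 e).
    case=> k k013 ->; have k16 : (k < 16)%N by move: k013; rewrite !inE => /orP[] /eqP ->.
    split; first by apply/classesP; exists k.
    by rewrite (hermitian_cls R k16) (proj2 (conj_index_fixed k16) k013).
  move=> C /classesP[k k16 ->]; rewrite hermitian_cls // => ne.
  have c16 := conj_index_lt k16.
  exists (cls (conj_index k)); split; [|exact: ne|by []|].
    by apply/classesP; exists (conj_index k).
  by rewrite (hermitian_cls R c16) (conj_indexK k16).
- by move=> H; apply: card_aut_23.
- split.
    move=> gT c27 /(noncyclic_indexing c27)[c [b [bb bh]]].
    have ind : is_indexing_group 3 gT (imx R c27 c).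
      exists c27, (fun x y => zt R (c x y)); split; first exact: tcocycle_cocycle.
      by apply: (@imx_equiv R _ _ _ c27 c27 c c id) => //; exists id.
    exists (imx R c27 c); split=> //; split; last by exists gT.
    rewrite (imx_mx R c27) mx_BH; apply: teq_tBH bh.
    exact: imx_teq bb (imx_mx R c27 c).
  by case=> H [bH]; apply: circulant_not_BH.
Qed.
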